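(* Let $p\ge 11$ be a prime and let $K$ be the $\mathbb{Z}_p$-extension of $\mathbb{Q}$. Then for every elliptic curve $E$ defined over $\mathbb{Q}$ we have $E(K)_{\mathrm{tors}}=E(\mathbb{Q})_{\mathrm{tors}}$.
   Context: The $\mathbb{Z}_p$-extension of $\mathbb{Q}$ is the unique Galois extension $K/\mathbb{Q}$ with $\operatorname{Gal}(K/\mathbb{Q})\simeq\mathbb{Z}_p$ (as topological groups). *)

(* Defs.v *)
From HB Require Import structures.
From mathcomp Require Import all_boot all_order all_algebra.
From mathcomp Require Import separable ring.
From mathcomp Require Import all_classical topology.
Set Implicit Arguments.
Unset Strict Implicit.
Unset Printing Implicit Defensive.
Import GRing.Theory.
Local Open Scope classical_set_scope.
Local Open Scope ring_scope.

Section GaloisExtension.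
Variables (F K : fieldType) (iota : {rmorphism F -> K}).

Definition algebraic_extension := forall x : K, algebraicOver iota x.

(* Up to a scalar, q is the minimal polynomial of x. *)
Definition separable_extension :=
  forall x : K, exists q : {poly F},
    [/\ irreducible_poly q, root (map_poly iota q) x & separable_poly q].

Definition normal_extension :=
  forall (q : {poly F}) (x : K),
    irreducible_poly q -> root (map_poly iota q) x ->
    exists s : seq K, map_poly iota q %= \prod_(y <- s) ('X - y%:P).

Definition galois_extension :=
  [/\ algebraic_extension, separable_extension & normal_extension].

(* Giving K the discrete topology, pointwise convergence of functions K -> K
   induces the Krull topology: a neighbourhood basis of s is given by the sets
   of automorphisms that agree with s on a finite subset of K. *)
Definition is_aut : set {ptws K -> discrete_topology K} :=
  [set s : K -> K |
    [/\ zmod_morphism s, monoid_morphism s, bijective s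
      & forall a : F, s (iota a) = iota a]].

Definition Gal : Type := is_aut.

HB.instance Definition _ := Topological.on Gal.

Definition Gal_fun (s : Gal) : K -> K := val s.

Lemma GalP (s : Gal) : is_aut (Gal_fun s).
Proof. exact: set_mem (valP s). Qed.

Lemma Gal_ext (s t : Gal) : Gal_fun s =1 Gal_fun t -> s = t.
Proof. by move=> st; apply: val_inj; apply: funext. Qed.

Definition Gal_mk (s : K -> K) (Hs : is_aut s) : Gal := exist _ s (mem_set Hs).

Lemma Gal_one_subproof : is_aut id.
Proof. by split=> //; exists id. Qed.

Lemma Gal_mul_subproof (s t : Gal) : is_aut (Gal_fun s \o Gal_fun t).
Proof.
have [sB [s1 sM] sb sF] := GalP s; have [tB [t1 tM] tb tF] := GalP t.
split; last by move=> a /=; rewrite tF sF.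
- by move=> x y /=; rewrite tB sB.
- by split=> [|x y] /=; rewrite ?t1 ?s1 ?tM ?sM.
- exact: bij_comp.
Qed.

Lemma Gal_inv_ex (s : Gal) :
  exists t : Gal, cancel (Gal_fun s) (Gal_fun t) /\
                  cancel (Gal_fun t) (Gal_fun s).
Proof.
have [sB [s1 sM] [t sK tK] sF] := GalP s.
have Ht : is_aut t.
  split; last by move=> a; rewrite -{1}sF sK.
  - by move=> x y; apply: (can_inj sK); rewrite sB !tK.
  - by split=> [|x y]; apply: (can_inj sK); rewrite ?sM !tK ?s1.
  - by exists (Gal_fun s).
by exists (Gal_mk Ht).
Qed.

Definition Gal_one : Gal := Gal_mk Gal_one_subproof.
Definition Gal_mul (s t : Gal) : Gal := Gal_mk (Gal_mul_subproof s t).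
Definition Gal_inv (s : Gal) : Gal := projT1 (cid (Gal_inv_ex s)).

Lemma Gal_mulA : associative Gal_mul.
Proof. by move=> s t u; apply: Gal_ext. Qed.

Lemma Gal_mul1 : left_id Gal_one Gal_mul.
Proof. by move=> s; apply: Gal_ext. Qed.

Lemma Gal_mulr1 : right_id Gal_one Gal_mul.
Proof. by move=> s; apply: Gal_ext. Qed.

Lemma Gal_mulV : left_inverse Gal_one Gal_inv Gal_mul.
Proof.
move=> s; apply: Gal_ext => x.
by rewrite /Gal_inv; case: cid => t [/= sK _]; exact: sK.
Qed.

Lemma Gal_mulrV : right_inverse Gal_one Gal_inv Gal_mul.
Proof.
move=> s; apply: Gal_ext => x.
by rewrite /Gal_inv; case: cid => t [/= _ tK]; exact: tK.
Qed.

HB.instance Definition _ :=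
  isGroup.Build Gal Gal_mulA Gal_mul1 Gal_mulr1 Gal_mulV Gal_mulrV.

End GaloisExtension.

(* The inverse limit of the discrete groups Z/p, Z/p^2, Z/p^3, ...  The tower
   starts at Z/p since 'Z_1 is not the zero ring. *)
Definition is_padic_int (p : nat) :
    set (prod_topology (fun n => discrete_topology 'Z_(p ^ n.+1))) :=
  [set x : forall n, 'Z_(p ^ n.+1) |
    forall n, (x n.+1 : nat)%:R = x n :> 'Z_(p ^ n.+1)].

Definition padic_int (p : nat) : Type := @is_padic_int p.

HB.instance Definition _ (p : nat) := Topological.on (padic_int p).

Section PadicGroup.
Variable p : nat.

Definition padic_proj (x : padic_int p) : forall n, 'Z_(p ^ n.+1) := val x.

Lemma padicP (x : padic_int p) n :
  (padic_proj x n.+1 : nat)%:R = padic_proj x n.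
Proof. exact: set_mem (valP x) n. Qed.

Lemma padic_ext (x y : padic_int p) :
  (forall n, padic_proj x n = padic_proj y n) -> x = y.
Proof. by move=> xy; apply: val_inj; apply: functional_extensionality_dep. Qed.

Definition padic_mk (x : forall n, 'Z_(p ^ n.+1)) (Hx : is_padic_int x) :
    padic_int p :=
  exist _ x (mem_set Hx).

Lemma padic_natr_eq n (a b : nat) :
  a%:R = b%:R :> 'Z_(p ^ n.+2) -> a%:R = b%:R :> 'Z_(p ^ n.+1).
Proof.
have dvd : ((Zp_trunc (p ^ n.+1)).+2 %| (Zp_trunc (p ^ n.+2)).+2)%N.
  case: p => [|[|q]]; rewrite ?exp1n ?exp0n //.
  by rewrite !Zp_cast ?dvdn_exp2l // -{1}(expn0 q.+2) ltn_exp2l.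
rewrite !(@Zp_nat (Zp_trunc _)) => /(congr1 val)/= ab; apply: val_inj.
by rewrite /= -(modn_dvdm a dvd) ab modn_dvdm.
Qed.

Lemma padic_zero_subproof : is_padic_int (fun n => 0 : 'Z_(p ^ n.+1)).
Proof. by []. Qed.

Lemma padic_add_subproof (x y : padic_int p) :
  is_padic_int (fun n => padic_proj x n + padic_proj y n : 'Z_(p ^ n.+1)).
Proof.
move=> n; rewrite /= -(padicP x n) -(padicP y n) -natrD; apply: padic_natr_eq.
by rewrite natrD !natr_Zp; exact: (natr_Zp (padic_proj x n.+1 + padic_proj y n.+1)).
Qed.

Lemma padic_opp_subproof (x : padic_int p) :
  is_padic_int (fun n => - padic_proj x n : 'Z_(p ^ n.+1)).
Proof.
move=> n; apply/eqP; rewrite -subr_eq0 opprK -(padicP x n) -natrD; apply/eqP.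
by apply: (@padic_natr_eq n _ 0); rewrite natrD !natr_Zp addrC subrr.
Qed.

Definition padic_zero : padic_int p := padic_mk padic_zero_subproof.
Definition padic_add (x y : padic_int p) : padic_int p :=
  padic_mk (padic_add_subproof x y).
Definition padic_opp (x : padic_int p) : padic_int p := padic_mk (padic_opp_subproof x).

Lemma padic_addA : associative padic_add.
Proof. by move=> x y z; apply: padic_ext => n /=; exact: addrA. Qed.

Lemma padic_addC : commutative padic_add.
Proof. by move=> x y; apply: padic_ext => n /=; exact: addrC. Qed.

Lemma padic_add0 : left_id padic_zero padic_add.
Proof. by move=> x; apply: padic_ext => n /=; exact: add0r. Qed.

Lemma padic_addN : left_inverse padic_zero padic_opp padic_add.
Proof. by move=> x; apply: padic_ext => n /=; exact: addNr. Qed.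

HB.instance Definition _ :=
  GRing.isZmodule.Build (padic_int p)
    padic_addA padic_addC padic_add0 padic_addN.

End PadicGroup.

Definition is_Zp_extension (p : nat) (F K : fieldType)
    (iota : {rmorphism F -> K}) :=
  galois_extension iota /\
  exists (f : Gal iota -> padic_int p) (g : padic_int p -> Gal iota),
    [/\ {morph f : s t / (s * t)%g >-> s + t},
        cancel f g, cancel g f, continuous f & continuous g].

Record weierstrass (F : fieldType) := Weierstrass {
  wa1 : F; wa2 : F; wa3 : F; wa4 : F; wa6 : F }.

Definition discriminant (F : fieldType) (W : weierstrass F) : F :=
  let: Weierstrass a1 a2 a3 a4 a6 := W in
  let b2 := a1 ^+ 2 + 4 * a2 in
  let b4 := 2 * a4 + a1 * a3 in
  let b6 := a3 ^+ 2 + 4 * a6 in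
  let b8 := a1 ^+ 2 * a6 + 4 * a2 * a6 - a1 * a3 * a4 + a2 * a3 ^+ 2
            - a4 ^+ 2 in
  - b2 ^+ 2 * b8 - 8 * b4 ^+ 3 - 27 * b6 ^+ 2 + 9 * b2 * b4 * b6.

Record elliptic_curve (F : fieldType) := EllipticCurve {
  ec_weierstrass :> weierstrass F;
  ec_smooth : discriminant ec_weierstrass != 0 }.

Section Points.
Variables (F : fieldType) (E : elliptic_curve F).
Local Notation a1 := (wa1 E).
Local Notation a2 := (wa2 E).
Local Notation a3 := (wa3 E).
Local Notation a4 := (wa4 E).
Local Notation a6 := (wa6 E).

(* None stands for the point at infinity. *)
Definition on_curve (P : option (F * F)) : bool :=
  if P is Some (x, y) then
    y ^+ 2 + a1 * x * y + a3 * y == x ^+ 3 + a2 * x ^+ 2 + a4 * x + a6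
  else true.

Record ec_point := Point {
  coords :> option (F * F);
  ec_pointP : on_curve coords }.

HB.instance Definition _ := [isSub for coords].
HB.instance Definition _ := [Choice of ec_point by <:].

(* The line of slope l through (x1, y1) meets the curve at points of abscissae
   x1, x2, x3; the result is the opposite of the third point, the opposite of
   (x, y) being (x, - y - a1 x - a3). *)
Definition chord (l x1 y1 x2 : F) : F * F :=
  let x3 := l ^+ 2 + a1 * l - a2 - x1 - x2 in
  (x3, - (l * (x3 - x1) + y1) - a1 * x3 - a3).

Definition coords_add (P Q : option (F * F)) : option (F * F) :=
  match P, Q with
  | None, _ => Q
  | _, None => P
  | Some (x1, y1), Some (x2, y2) =>
    if x1 != x2 then Some (chord ((y2 - y1) / (x2 - x1)) x1 y1 x2)
    else if y1 + y2 + a1 * x2 + a3 == 0 then None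
    else Some (chord ((3 * x1 ^+ 2 + 2 * a2 * x1 + a4 - a1 * y1)
                      / (2 * y1 + a1 * x1 + a3)) x1 y1 x2)
  end.

Let weq x y : F :=
  x ^+ 3 + a2 * x ^+ 2 + a4 * x + a6 - (y ^+ 2 + a1 * x * y + a3 * y).

Let on_curveE x y : on_curve (Some (x, y)) = (weq x y == 0).
Proof. by rewrite /= /weq subr_eq0 eq_sym. Qed.

Lemma coords_add_on_curve P Q :
  on_curve P -> on_curve Q -> on_curve (coords_add P Q).
Proof.
case: P => [[x1 y1]|] //; case: Q => [[x2 y2]|] //.
rewrite !on_curveE => /eqP P1 /eqP P2; rewrite /coords_add.
case: eqVneq => [ex|nx]; last first.
  have nz : x2 - x1 != 0 by rewrite subr_eq0 eq_sym.
  rewrite on_curveE.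
  set l := (_ / _).
  have ey : y2 = y1 + l * (x2 - x1) by rewrite /l divfK // addrC subrK.
  rewrite -(mulrI_eq0 _ (mulfI nz)); apply/eqP.
  set x3 := l ^+ 2 + a1 * l - a2 - x1 - x2.
  transitivity ((x3 - x1) * weq x2 y2 - (x3 - x2) * weq x1 y1).
    by rewrite ey /x3 /weq; ring.
  by rewrite P1 P2; ring.
case: eqVneq => [//|ny].
rewrite on_curveE -ex.
rewrite -ex in P2 ny.
have e12 : y1 = y2.
  apply/eqP; rewrite -subr_eq0 -(mulrI_eq0 _ (mulfI ny)); apply/eqP.
  transitivity (weq x1 y2 - weq x1 y1); first by rewrite /weq; ring.
  by rewrite P1 P2 subrr.
rewrite -e12 in ny.
have nz : 2 * y1 + a1 * x1 + a3 != 0.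
  by rewrite (_ : 2 * y1 = y1 + y1) //; ring.
set l := (_ / _).
have el : l * (2 * y1 + a1 * x1 + a3)
          = 3 * x1 ^+ 2 + 2 * a2 * x1 + a4 - a1 * y1.
  by rewrite /l divfK.
set x3 := l ^+ 2 + a1 * l - a2 - x1 - x1; apply/eqP.
transitivity (weq x1 y1 + (x3 - x1) *
  (3 * x1 ^+ 2 + 2 * a2 * x1 + a4 - a1 * y1 - l * (2 * y1 + a1 * x1 + a3))).
  by rewrite /x3 /weq; ring.
by rewrite P1 el; ring.
Qed.

Definition ec_zero : ec_point := @Point None isT.

Definition ec_add (P Q : ec_point) : ec_point :=
  Point (coords_add_on_curve (ec_pointP P) (ec_pointP Q)).

Definition torsion : set ec_point :=
  [set P | exists2 n : nat, (0 < n)%N & iter n (ec_add P) ec_zero = ec_zero].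

End Points.

Arguments torsion {F} E _.

Section BaseChange.
Variables (F K : fieldType) (iota : {rmorphism F -> K}).

Definition map_weierstrass (W : weierstrass F) : weierstrass K :=
  Weierstrass (iota (wa1 W)) (iota (wa2 W)) (iota (wa3 W)) (iota (wa4 W))
              (iota (wa6 W)).

Lemma discriminant_map (W : weierstrass F) :
  discriminant (map_weierstrass W) = iota (discriminant W).
Proof.
by case: W => * /=; ring.
Qed.

Lemma base_change_subproof (E : elliptic_curve F) :
  discriminant (map_weierstrass E) != 0.
Proof. by rewrite discriminant_map fmorph_eq0 ec_smooth. Qed.

Definition base_change (E : elliptic_curve F) : elliptic_curve K :=
  EllipticCurve (base_change_subproof E).

Definition map_coords (P : option (F * F)) : option (K * K) :=
  omap (fun xy => (iota xy.1, iota xy.2)) P.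

Lemma map_coords_on_curve (E : elliptic_curve F) (P : ec_point E) :
  on_curve (base_change E) (map_coords P).
Proof.
case: P => [[[x y]|] //= /eqP exy]; apply/eqP.
transitivity (iota (y ^+ 2 + wa1 E * x * y + wa3 E * y)); first by ring.
by rewrite exy; ring.
Qed.

Definition ec_map (E : elliptic_curve F) (P : ec_point E) :
  ec_point (base_change E) := Point (map_coords_on_curve P).

End BaseChange.

(* Main.v *)
(* Let [g] be a topological generator of [Gal(K/Q)] and [O] the ring of integers of [K]; [K] is
   real, since complex conjugation would be an element of order 2.  The ideal of [O] generated by
   the [x - g x] is proper: otherwise the first layer of [K/Q] would have a unimodular trace
   form, whereas, for [p >= 11], a positive definite unimodular form of rank [p] takes a nonzero
   value below [p] on the lattice, and [Tr (x ^ 2) >= p] for [x != 0] by AM-GM.  A maximal ideal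
   [M] containing it has residue characteristic [p] and yields a [g]-invariant valuation [v] with
   [v p = 1], integral on [Q], for which [g] is wildly ramified: [v (g x - x) > v x].

   Write the curve as [y^2 = x^3 + A x + B] over [Q] and let [m = min (v A / 4, v B / 6)].  The
   points with [v x < 2 m] form a [g]-stable subgroup that contains [g P - P] for every [P], by
   wildness.  It is torsion free: [35 z + 14 A z^5 + 15 B z^7], with [z = x / y], is a
   logarithm up to high order, so only [p]-torsion is possible; [g - 1] is nilpotent on the
   [p]-torsion, so there would be a nonzero [p]-torsion point fixed by [g], whose [v z] is an
   integer, and [8 (v z + m) <= v p = 1] contradicts [v z + m >= 1/6].  Hence [g P = P] for
   every torsion point [P]. *)
Require Import Defs.
From HB Require Import structures.
From mathcomp Require Import all_boot all_order all_algebra.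
From mathcomp Require Import separable algC algnum cyclic.
From mathcomp Require Import all_classical topology.
From mathcomp Require Import ring lra zify.
Set Implicit Arguments.
Unset Strict Implicit.
Unset Printing Implicit Defensive.
Import Order.TTheory GRing.Theory Num.Theory.
Local Open Scope ring_scope.

(** * The group law on a short Weierstrass curve *)

(** [K] is known only through its Galois group, so ramification has to be proved, not quoted. If it
    failed, a relation [\sum u (x - g x) = 1] would hold in some high layer; to reach a
    contradiction in the layer of degree [p], the relation is turned into an idempotent function on
    the Galois group, and a norm brings that function down. A pigeonhole count in the lattice then
    stands in for volumes.

    The valuation is the [p]-adic valuation of the norm to [rat], divided by the degree.

    No reduction type is assumed: the rational number [m] does the work of rescaling the curve so
    that its coefficients become integral, one of them a unit, which would otherwise take a ramified
    extension. As [4 m] or [6 m] is an integer, the bound 1/6 appears. The factor 8 is [9 - 1]: the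
    truncated logarithm has order 1 and is additive up to order 9. The term in [z^7] matters:
    without it the factor would be 6, and [6 / 6 <= 1] is no contradiction.

    Associativity of the group law comes from ideal classes of the coordinate ring, with no case
    analysis. *)

Section CoordinateRing.
Variable F : fieldType.

(* [u : coord_ring c] stands for [u.1 + u.2 * Y] with [Y ^+ 2 = c]. *)
Definition coord_ring of {poly F} : Type := ({poly F} * {poly F})%type.

Variable c : {poly F}.
Local Notation cring := (coord_ring c).

HB.instance Definition _ := GRing.Zmodule.copy cring ({poly F} * {poly F})%type.

Definition cmul (u v : cring) : cring :=
  (u.1 * v.1 + c * (u.2 * v.2), u.1 * v.2 + u.2 * v.1).
Definition cone : cring := (1, 0).

Lemma cmulA : associative cmul.
Proof. by move=> [a a'] [b b'] [d d']; congr (_, _) => /=; ring. Qed.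
Lemma cmulC : commutative cmul.
Proof. by move=> [a a'] [b b']; congr (_, _) => /=; ring. Qed.
Lemma cmul1 : left_id cone cmul.
Proof. by move=> [a a']; rewrite /cmul /=; congr (_, _); ring. Qed.
Lemma cmulDl : left_distributive cmul +%R.
Proof. by move=> [a a'] [b b'] [d d']; congr (_, _) => /=; ring. Qed.
Lemma cone_neq0 : cone != 0 :> cring.
Proof. by apply/eqP => -[] /eqP; rewrite oner_eq0. Qed.

HB.instance Definition _ :=
  GRing.Zmodule_isComNzRing.Build cring cmulA cmulC cmul1 cmulDl cone_neq0.

Definition cinj (a : {poly F}) : cring := (a, 0).
Lemma cinj_is_zmod : zmod_morphism cinj.
Proof. by move=> a b; congr (_, _); rewrite /= subrr. Qed.
Lemma cinj_is_monoid : monoid_morphism cinj.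
Proof. by split=> // a b; congr (_, _) => /=; ring. Qed.
HB.instance Definition _ := GRing.isZmodMorphism.Build _ _ cinj cinj_is_zmod.
HB.instance Definition _ := GRing.isMonoidMorphism.Build _ _ cinj cinj_is_monoid.

Definition cY : cring := (0, 1).

Lemma cYsq : cY * cY = cinj c.
Proof. by congr (_, _) => /=; ring. Qed.

Definition cnorm (u : cring) : {poly F} := u.1 ^+ 2 - c * u.2 ^+ 2.

Lemma cnormM u v : cnorm (u * v) = cnorm u * cnorm v.
Proof. by rewrite /cnorm /=; ring. Qed.

Hypothesis size_c : size c = 4.

(** The terms [a ^+ 2] and [c * b ^+ 2] have degrees of opposite parity, the second at least 3, so
    they cannot cancel and degree 1 is never reached. In geometric terms, a curve of genus 1 has no
    function of degree 1. *)
Lemma cnorm_size u : size (cnorm u) != 2.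
Proof.
case: u => a b; rewrite /cnorm /=.
have [-> | a0] := eqVneq a 0.
  rewrite expr0n /= sub0r size_polyN.
  have [-> | b0] := eqVneq b 0; first by rewrite expr0n mulr0 size_poly0.
  have c0 : c != 0 by rewrite -size_poly_eq0 size_c.
  rewrite size_mul ?expf_neq0 // size_c expr2 size_mul //.
have [-> | b0] := eqVneq b 0.
  rewrite expr0n /= mulr0 subr0 expr2 size_mul //.
  have := size_poly_eq0 a; rewrite (negPf a0); case: (size a) => // n _.
  by rewrite addSn addnS /= addnn; case: n => // n; rewrite doubleS.
have c0 : c != 0 by rewrite -size_poly_eq0 size_c.
have sa : size (a ^+ 2) = (size a).*2.-1 by rewrite expr2 size_mul // addnn.
have sb : size (- (c * b ^+ 2)) = (size b).*2.+2.
  rewrite size_polyN size_mul ?expf_neq0 // size_c expr2 size_mul //.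
  have := size_poly_eq0 b; rewrite (negPf b0); case: (size b) => // n _.
  by rewrite addSn addnS addnn doubleS.
have a1 : (0 < size a)%N by rewrite size_poly_gt0.
have b1 : (0 < size b)%N by rewrite size_poly_gt0.
case: (ltngtP (size (a ^+ 2)) (size (- (c * b ^+ 2)))) => h.
- rewrite addrC size_polyDl // sb.
  by case: (size b) b1 => // n _; rewrite doubleS.
- rewrite size_polyDl // sa; move: h; rewrite sa sb.
  case: (size a) a1 => // n _; case: (size b) b1 => // k _.
  by rewrite !doubleS /=; case: n => [|n] //; rewrite doubleS.
- move: h; rewrite sa sb => h.
  have : odd ((size a).*2.-1) by rewrite -[(size a)](prednK a1) doubleS /= odd_double.
  by rewrite h /= odd_double.
Qed.

Lemma cnorm_eq0 u : (cnorm u == 0) = (u == 0).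
Proof.
apply/idP/eqP => [/eqP h | ->]; last by rewrite /cnorm /= expr0n mulr0 subr0.
have := cnorm_size (u * cinj 'X).
case: u h => a b; rewrite cnormM => h _.
have [b0 | b0] := eqVneq b 0.
  move: h; rewrite /cnorm b0 /= expr0n mulr0 subr0 => /eqP.
  by rewrite expf_eq0 /= => /eqP ->.
move: h; rewrite /cnorm /= => /eqP; rewrite subr_eq0 => /eqP /(congr1 (fun p : {poly F} => size p)).
have c0 : c != 0 by rewrite -size_poly_eq0 size_c.
have [-> | a0] := eqVneq a 0.
  rewrite expr0n size_poly0 => /esym/eqP.
  by rewrite size_poly_eq0 mulf_eq0 expf_eq0 /= (negPf c0) (negPf b0).
rewrite (size_mul c0) ?expf_neq0 // size_c !expr2 !size_mul //.
have a1 : (0 < size a)%N by rewrite size_poly_gt0.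
have b1 : (0 < size b)%N by rewrite size_poly_gt0.
case: (size a) a1 => // n _; case: (size b) b1 => // k _.
rewrite !addnn !doubleS /= => /(congr1 odd).
by rewrite /= !odd_double.
Qed.

Lemma cring_mul_neq0 (u v : cring) : u != 0 -> v != 0 -> u * v != 0.
Proof. by rewrite -!cnorm_eq0 cnormM mulf_eq0 negb_or => -> ->. Qed.

End CoordinateRing.

(** * Ideal classes of a domain *)

Section IdealClasses.
Variable R : comNzRingType.
Hypothesis domR : forall u v : R, u != 0 -> v != 0 -> u * v != 0.
Implicit Types (I J L : R -> Prop) (f g u v : R).

Inductive iprod I J : R -> Prop :=
| IProd0 : iprod I J 0
| IProdS a b x : I a -> J b -> iprod I J x -> iprod I J (a * b + x).

Lemma iprod1 I J a b : I a -> J b -> iprod I J (a * b).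
Proof. by move=> Ia Jb; rewrite -[_ * _]addr0; apply: IProdS => //; exact: IProd0. Qed.

Lemma iprodD I J u v : iprod I J u -> iprod I J v -> iprod I J (u + v).
Proof.
move=> Iu Iv; elim: Iu => [|a b x Ia Jb _ IH]; first by rewrite add0r.
by rewrite -addrA; apply: IProdS.
Qed.

Lemma iprodC I J u : iprod I J u -> iprod J I u.
Proof. by elim=> [|a b x Ia Jb _ IH]; [exact: IProd0 | rewrite mulrC; apply: IProdS]. Qed.

Lemma iprodA I J L u : iprod (iprod I J) L u -> iprod I (iprod J L) u.
Proof.
elim=> [|ab d x Iab Ld _ IH]; first exact: IProd0.
apply: iprodD IH; elim: Iab => [|a b y Ia Jb _ IH]; first by rewrite mul0r; exact: IProd0.
by rewrite mulrDl -mulrA; apply: IProdS => //; apply: iprod1.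
Qed.

(** Equality of ideal classes, [f I = g J], written without a fraction field. *)
Definition isim I J : Prop := exists f g, [/\ f != 0, g != 0,
  forall u, I u -> exists2 v, J v & f * u = g * v &
  forall v, J v -> exists2 u, I u & f * u = g * v].

Lemma isim_sym I J : isim I J -> isim J I.
Proof.
move=> [f [g [f0 g0 IJ JI]]]; exists g, f; split=> // u.
  by move=> /JI [v Iv e]; exists v.
by move=> /IJ [v Iv e]; exists v.
Qed.

Lemma isim_trans I J L : isim I J -> isim J L -> isim I L.
Proof.
move=> [f [g [f0 g0 IJ JI]]] [f' [g' [f'0 g'0 JL LJ]]].
exists (f' * f), (g * g'); split; try exact: domR.
- move=> u /IJ [v /JL [w Lw e'] e]; exists w => //.
  by rewrite -!mulrA e -e' mulrCA.
move=> w /LJ [v /JI [u Iu e] e']; exists u => //.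
by rewrite -!mulrA -e' e mulrCA.
Qed.

Lemma isim_ext I J : (forall u, I u <-> J u) -> isim I J.
Proof.
move=> IJ; exists 1, 1; split; rewrite ?oner_eq0 // => u.
  by move/IJ; exists u.
by move/IJ; exists u.
Qed.

Lemma isim_prodl I J L : isim I J -> isim (iprod I L) (iprod J L).
Proof.
move=> [f [g [f0 g0 IJ JI]]]; exists f, g; split=> // u.
  elim=> [|a b x Ia Lb _ [y Jy e]]; first by exists 0; rewrite ?mulr0 //; exact: IProd0.
  have [a' Ja' ea] := IJ a Ia; exists (a' * b + y); first exact: IProdS.
  by rewrite !mulrDr e !mulrA ea.
elim=> [|a b x Ja Lb _ [y Iy e]]; first by exists 0; rewrite ?mulr0 //; exact: IProd0.
have [a' Ia' ea] := JI a Ja; exists (a' * b + y); first exact: IProdS.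
by rewrite !mulrDr e !mulrA ea.
Qed.

Lemma isim_prodC I J : isim (iprod I J) (iprod J I).
Proof. by apply: isim_ext => u; split; apply: iprodC. Qed.

Lemma isim_prodA I J L : isim (iprod (iprod I J) L) (iprod I (iprod J L)).
Proof.
apply: isim_ext => u; split; first exact: iprodA.
move=> /iprodC h; apply: iprodC.
have {}h : iprod (iprod L J) I u.
  elim: h => [|a b x h Ib _ IH]; first exact: IProd0.
  by apply: IProdS => //; apply: iprodC.
have := iprodA h; elim=> [|a b x La h' _ IH]; first exact: IProd0.
by apply: IProdS => //; apply: iprodC.
Qed.

Definition ispan (u v : R) : R -> Prop := fun w => exists a b, w = a * u + b * v.

Lemma ispanD u v x y : ispan u v x -> ispan u v y -> ispan u v (x + y).
Proof. by move=> [a [b ->]] [a' [b' ->]]; exists (a + a'), (b + b'); ring. Qed.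

Lemma ispan0 u v : ispan u v 0.
Proof. by exists 0, 0; ring. Qed.

End IdealClasses.

(** * Ideals of points, and chords as relations between them *)

Section PointIdeals.
Variables (F : fieldType) (R : comNzRingType) (k : {rmorphism F -> R}).
Variables (A B : F) (X Y : R).
Hypothesis domR : forall u v : R, u != 0 -> v != 0 -> u * v != 0.
Hypothesis XY : Y ^+ 2 = X ^+ 3 + k A * X + k B.
Hypothesis X0 : forall a, X - k a != 0.
Hypothesis Y0 : forall a b, Y - (k a * X + k b) != 0.

(** The functions that vanish at [P]. The origin lies at infinity, off the affine curve, hence the
    unit ideal. *)
Definition pideal (P : option (F * F)) : R -> Prop :=
  if P is Some (x, y) then ispan (X - k x) (Y - k y) else fun _ => True.

Lemma pideal0l J : (forall a u, J u -> J (a * u)) -> (forall u v, J u -> J v -> J (u + v)) -> J 0 ->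
  isim (iprod (pideal None) J) J.
Proof.
move=> Jm Ja J0; apply: isim_ext => u; split.
  by elim=> // a b x _ Jb _ Jx; apply: Ja => //; apply: Jm.
by move=> Ju; rewrite -[u]mul1r; apply: iprod1.
Qed.

Lemma pideal_mul P a u : pideal P u -> pideal P (a * u).
Proof.
case: P => [[x y]|] //= [b [d ->]]; exists (a * b), (a * d); ring.
Qed.

Lemma pidealD P u v : pideal P u -> pideal P v -> pideal P (u + v).
Proof. by case: P => [[x y]|] //=; apply: ispanD. Qed.

Lemma pideal_0 P : pideal P 0.
Proof. by case: P => [[x y]|] //=; apply: ispan0. Qed.

Lemma iprod_pideal P J a u : iprod (pideal P) J u -> iprod (pideal P) J (a * u).
Proof.
elim=> [|b d x Pb Jd _ IH]; first by rewrite mulr0; exact: IProd0.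
by rewrite mulrDr mulrA; apply: IProdS => //; apply: pideal_mul.
Qed.

Variables (x1 y1 : F).
Hypothesis P1 : y1 ^+ 2 = x1 ^+ 3 + A * x1 + B.

Let Yk : (Y - k y1) * (Y + k y1) = (X - k x1) * (X ^+ 2 + k x1 * X + k x1 ^+ 2 + k A).
Proof.
have -> : (Y - k y1) * (Y + k y1) = Y ^+ 2 - k (y1 ^+ 2) by ring.
by rewrite XY P1; ring.
Qed.

(** The vertical line [X = x1] meets the curve in [P] and [- P] only, so the product is generated by
    [X - k x1]. To write this generator as a combination of products, one divides by [2 * y1], or,
    at a point of order 2, by the derivative [3 * x1 ^+ 2 + A]. *)
Lemma pideal_opp : (y1 != 0 \/ 3 * x1 ^+ 2 + A != 0) -> 2 != 0 :> F ->
  isim (iprod (pideal (Some (x1, y1))) (pideal (Some (x1, - y1)))) (pideal None).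
Proof.
move=> ns two; exists 1, (X - k x1); split=> //; first exact: oner_neq0.
  move=> u; elim=> [|a b x [a1 [a2 ->]] [b1 [b2 ->]] _ [v _ e]].
    by exists 0; rewrite ?mulr0.
  exists (a1 * b1 * (X - k x1) + a1 * b2 * (Y + k y1) + a2 * b1 * (Y - k y1) + a2 * b2 * (X ^+ 2 + k x1 * X + k x1 ^+ 2 + k A) + v) => //.
  rewrite [LHS]mulrDr e rmorphN opprK [in RHS]mulrDr; congr (_ + _).
  transitivity (a1 * b1 * (X - k x1) ^+ 2 + a1 * b2 * (X - k x1) * (Y + k y1) + a2 * b1 * (X - k x1) * (Y - k y1) + a2 * b2 * ((Y - k y1) * (Y + k y1))).
    by ring.
  by rewrite Yk; ring.
move=> v _; exists ((X - k x1) * v); last by rewrite mul1r.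
rewrite mulrC; apply: iprod_pideal.
have g1 : iprod (pideal (Some (x1, y1))) (pideal (Some (x1, - y1))) ((X - k x1) * (X - k x1)).
  by apply: iprod1; [exists 1, 0; ring | exists 1, 0; ring].
have g2 : iprod (pideal (Some (x1, y1))) (pideal (Some (x1, - y1))) ((X - k x1) * (Y + k y1)).
  by apply: iprod1; [exists 1, 0; ring | exists 0, 1; rewrite rmorphN; ring].
have g3 : iprod (pideal (Some (x1, y1))) (pideal (Some (x1, - y1))) ((Y - k y1) * (X - k x1)).
  by apply: iprod1; [exists 0, 1; ring | exists 1, 0; ring].
have g4 : iprod (pideal (Some (x1, y1))) (pideal (Some (x1, - y1))) ((Y - k y1) * (Y + k y1)).
  by apply: iprod1; [exists 0, 1; ring | exists 0, 1; rewrite rmorphN; ring].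
have [ey | y0] := eqVneq y1 0; last first.
  have y20 : 2 * y1 != 0 by rewrite mulf_neq0.
  have -> : X - k x1 = k ((2 * y1)^-1) * ((X - k x1) * (Y + k y1)) + (- k ((2 * y1)^-1)) * ((Y - k y1) * (X - k x1)).
    transitivity (k ((2 * y1)^-1 * (2 * y1)) * (X - k x1)); last by ring.
    by rewrite mulVf // rmorph1 mul1r.
  by apply: iprodD; apply: iprod_pideal.
have {ns} ns : 3 * x1 ^+ 2 + A != 0 by case: ns => //; rewrite ey eqxx.
set d := 3 * x1 ^+ 2 + A in ns.
have -> : X - k x1 = k d^-1 * ((Y - k y1) * (Y + k y1)) + (- k d^-1 * (X + 2 * k x1)) * ((X - k x1) * (X - k x1)).
  rewrite Yk; transitivity (k (d^-1 * d) * (X - k x1)); last by rewrite rmorphM /d; ring.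
  by rewrite mulVf // rmorph1 mul1r.
by apply: iprodD; apply: iprod_pideal.
Qed.

Variables (x2 y2 l : F).
Hypothesis P2 : y2 ^+ 2 = x2 ^+ 3 + A * x2 + B.
Hypothesis l1 : l * (x2 - x1) = y2 - y1.
Hypothesis l2 : l * (y1 + y2) = x1 ^+ 2 + x1 * x2 + x2 ^+ 2 + A.

(** The chord [m] vanishes at [P1], [P2] and [- P3], and [u3] at [P3] and [- P3]; hence
    [u3 I1 I2 = m I3]. All inclusions follow from [m * m' = u1 * u2 * u3], where [m'] is the
    conjugate of [m] up to sign. *)
Lemma pideal_add : x1 != x2 \/ (x1 = x2 /\ 2 * y1 != 0) ->
  let x3 := l ^+ 2 - x1 - x2 in let y3 := - (l * (x3 - x1) + y1) in
  isim (iprod (pideal (Some (x1, y1))) (pideal (Some (x2, y2)))) (pideal (Some (x3, y3))).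
Proof.
move=> ns x3 y3.
set u1 := X - k x1; set u2 := X - k x2; set u3 := X - k x3.
pose m : R := Y - (k l * u1 + k y1).
pose m' : R := Y + (k l * u1 + k y1).
have mm : m * m' = u1 * u2 * u3.
  transitivity (Y ^+ 2 - (k l * u1 + k y1) ^+ 2); first by rewrite /m /m'; ring.
  rewrite XY.
  have -> : k B = k (y1 ^+ 2 - x1 ^+ 3 - A * x1) by congr (k _); rewrite P1; ring.
  have -> : A = l * (2 * y1 + l * (x2 - x1)) - x1 ^+ 2 - x1 * x2 - x2 ^+ 2.
    have -> : 2 * y1 + l * (x2 - x1) = y1 + y2 by rewrite l1; ring.
    by rewrite l2; ring.
  by rewrite /u1 /u2 /u3 /x3; ring.
have e1 : Y - k y1 = m + k l * u1 by rewrite /m; ring.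
have e2 : Y - k y2 = m + k l * u2.
  have -> : y2 = y1 + l * (x2 - x1) by rewrite l1; ring.
  by rewrite /m /u1 /u2; ring.
have e3 : Y - k y3 = m' + k l * u3 - 2 * k l * u3 by rewrite /m' /y3 /u1 /u3; ring.
have m0 : m != 0.
  have := Y0 l (y1 - l * x1); congr (_ != 0); rewrite /m /u1; ring.
have u30 : u3 != 0 by apply: X0.
exists u3, m; split=> //.
  move=> u; elim=> [|a b x [a1 [a2 ->]] [b1 [b2 ->]] _ [v Iv e]].
    by exists 0; rewrite ?mulr0 //; apply: ispan0.
  rewrite mulrDr e e1 e2.
  exists ((a1 + a2 * k l) * (b1 + b2 * k l) * m' + (a2 * (b1 * u2 + b2 * (m + k l * u2)) + (a1 + a2 * k l) * u1 * b2) * u3 + v).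
    apply: ispanD => //.
    exists ((a1 + a2 * k l) * (b1 + b2 * k l) * k l + (a2 * (b1 * u2 + b2 * (m + k l * u2)) + (a1 + a2 * k l) * u1 * b2)).
    exists ((a1 + a2 * k l) * (b1 + b2 * k l)).
    by rewrite e3 -/u3; ring.
  rewrite [RHS]mulrDr; congr (_ + _).
  by rewrite [RHS]mulrDr (mulrCA m) mm -/u1 -/u2; ring.
pose II := iprod (pideal (Some (x1, y1))) (pideal (Some (x2, y2))).
have g1 : II (u1 * u2) by apply: iprod1; [exists 1, 0; rewrite -/u1; ring | exists 1, 0; rewrite -/u2; ring].
have g2 : II (u1 * m).
  by apply: iprod1; [exists 1, 0; rewrite -/u1; ring | exists (- k l), 1; rewrite e2 -/u2; ring].
have g3 : II (m * u2).
  by apply: iprod1; [exists (- k l), 1; rewrite e1 -/u1; ring | exists 1, 0; rewrite -/u2; ring].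
have g4 : II (m * m).
  by apply: iprod1; [exists (- k l), 1; rewrite e1 -/u1; ring | exists (- k l), 1; rewrite e2 -/u2; ring].
have gm : II m.
  case: ns => [x12 | [x12 y0]].
    have x0 : x2 - x1 != 0 by rewrite subr_eq0 eq_sym.
    have -> : m = k (x2 - x1)^-1 * (u1 * m) + (- k (x2 - x1)^-1) * (m * u2).
      transitivity (k ((x2 - x1)^-1 * (x2 - x1)) * m); first by rewrite mulVf // rmorph1 mul1r.
      by rewrite rmorphM /u1 /u2; ring.
    by apply: iprodD; apply: iprod_pideal.
  (* For a tangent, multiply [m' - m = 2 * k l * u1 + 2 * k y1] by [m] and replace [m * m'] by
     [u1 * u2 * u3]. *)
  have -> : m = (k (2 * y1)^-1 * u3) * (u1 * u2) + ((- k (2 * y1)^-1) * (m * m) + (- k (2 * y1)^-1 * 2 * k l) * (u1 * m)).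
    transitivity (k ((2 * y1)^-1 * (2 * y1)) * m); first by rewrite mulVf // rmorph1 mul1r.
    transitivity (k (2 * y1)^-1 * (m * m') + (- k (2 * y1)^-1 * (m * m) + - k (2 * y1)^-1 * 2 * k l * (u1 * m))).
      by rewrite rmorphM /m /m'; ring.
    by rewrite mm; ring.
  by apply: iprodD; [|apply: iprodD]; apply: iprod_pideal.
move=> v [a [b ->]]; rewrite -/u3 e3.
exists ((a - k l * b) * m + b * (u1 * u2)).
  by apply: iprodD; apply: iprod_pideal.
transitivity (u3 * ((a - k l * b) * m) + b * (m * m')); last by ring.
by rewrite mm; ring.
Qed.

End PointIdeals.

(** The factor 2 excludes characteristic 2, where every short equation is singular. *)
Record scurve (F : fieldType) := SCurve {
  sA : F; sB : F; s_smooth : 2 * (4 * sA ^+ 3 + 27 * sB ^+ 2) != 0 }.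

(** * The group of points of a short Weierstrass curve *)

Section ShortCurve.
Variables (F : fieldType) (E : scurve F).
Local Notation A := (sA E).
Local Notation B := (sB E).

Definition son (P : option (F * F)) : bool :=
  if P is Some (x, y) then y ^+ 2 == x ^+ 3 + A * x + B else true.

Definition sline (l x1 y1 x2 : F) : F * F :=
  let x3 := l ^+ 2 - x1 - x2 in (x3, - (l * (x3 - x1) + y1)).

Definition sadd (P Q : option (F * F)) : option (F * F) :=
  match P, Q with
  | None, _ => Q
  | _, None => P
  | Some (x1, y1), Some (x2, y2) =>
    if x1 != x2 then Some (sline ((y2 - y1) / (x2 - x1)) x1 y1 x2)
    else if y1 + y2 == 0 then None
    else Some (sline ((3 * x1 ^+ 2 + A) / (2 * y1)) x1 y1 x2)
  end.

Definition sopp (P : option (F * F)) : option (F * F) :=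
  if P is Some (x, y) then Some (x, - y) else None.

Lemma two_neq0 : 2 != 0 :> F.
Proof. by have := s_smooth E; rewrite mulf_eq0 negb_or => /andP[]. Qed.

Lemma s_nonsing x y : y ^+ 2 = x ^+ 3 + A * x + B -> y != 0 \/ 3 * x ^+ 2 + A != 0.
Proof.
move=> e; have [y0|] := eqVneq y 0; last by left.
right; apply/eqP => h; have /eqP[] := s_smooth E.
have eA : A = - 3 * x ^+ 2 by transitivity (A - (3 * x ^+ 2 + A)); [rewrite h subr0 | ring].
have eB : B = 2 * x ^+ 3.
  transitivity (y ^+ 2 - x ^+ 3 - A * x); first by rewrite e; ring.
  by rewrite y0 eA; ring.
by rewrite eA eB; ring.
Qed.

Lemma s_same x y1 y2 : y1 ^+ 2 = x ^+ 3 + A * x + B -> y2 ^+ 2 = x ^+ 3 + A * x + B ->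
  y1 + y2 != 0 -> y1 = y2.
Proof.
move=> e1 e2 ny; apply/eqP; rewrite -subr_eq0 -(mulrI_eq0 _ (mulfI ny)); apply/eqP.
by transitivity (y1 ^+ 2 - y2 ^+ 2); [ring | rewrite e1 e2 subrr].
Qed.

(** Chord and tangent slopes satisfy the same two polynomial equations, so that later computations
    treat both cases at once. *)
Lemma sadd_slope x1 y1 x2 y2 : son (Some (x1, y1)) -> son (Some (x2, y2)) ->
  [/\ x1 = x2, y1 + y2 = 0 & sadd (Some (x1, y1)) (Some (x2, y2)) = None] \/
  exists l, [/\ sadd (Some (x1, y1)) (Some (x2, y2)) = Some (sline l x1 y1 x2),
    l * (x2 - x1) = y2 - y1, l * (y1 + y2) = x1 ^+ 2 + x1 * x2 + x2 ^+ 2 + A &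
    x1 != x2 \/ (x1 = x2 /\ 2 * y1 != 0)].
Proof.
rewrite /= => /eqP P1 /eqP P2; case: eqVneq => [ex|nx] /=; last first.
  have nz : x2 - x1 != 0 by rewrite subr_eq0 eq_sym.
  right; eexists; split; first by [].
  - by rewrite divfK.
  - apply: (mulfI nz); rewrite mulrA [_ * (_ / _)]mulrC divfK //.
    transitivity (y2 ^+ 2 - y1 ^+ 2); first by ring.
    by rewrite P1 P2; ring.
  - by left.
subst x2; case: eqVneq => [ny | ny]; first by left.
right; have e := s_same P1 P2 ny; subst y2.
have y2 : 2 * y1 = y1 + y1 by ring.
eexists; split; first by [].
- by rewrite !subrr mulr0.
- by rewrite -y2 divfK ?y2 //; ring.
- by rewrite y2; right.
Qed.

Lemma sline_on x1 y1 x2 y2 l : son (Some (x1, y1)) ->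
  l * (x2 - x1) = y2 - y1 -> l * (y1 + y2) = x1 ^+ 2 + x1 * x2 + x2 ^+ 2 + A ->
  son (Some (sline l x1 y1 x2)).
Proof.
rewrite /= => /eqP P1 e1 e2; apply/eqP.
have -> : B = y1 ^+ 2 - x1 ^+ 3 - A * x1 by rewrite P1; ring.
have -> : A = l * (2 * y1 + l * (x2 - x1)) - x1 ^+ 2 - x1 * x2 - x2 ^+ 2.
  have -> : 2 * y1 + l * (x2 - x1) = y1 + y2 by rewrite e1; ring.
  by rewrite e2; ring.
by ring.
Qed.

Lemma sadd_on P Q : son P -> son Q -> son (sadd P Q).
Proof.
case: P => [[x1 y1]|] //; case: Q => [[x2 y2]|] // h1 h2.
case: (sadd_slope h1 h2) => [[_ _ ->] // | [l [-> e1 e2 _]]].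
exact: (sline_on h1 e1 e2).
Qed.

Lemma sopp_on P : son P -> son (sopp P).
Proof. by case: P => [[x y]|] //=; rewrite sqrrN. Qed.

Definition scubic : {poly F} := 'X^3 + A *: 'X + B%:P.

Lemma size_scubic : size scubic = 4.
Proof.
rewrite /scubic -addrA size_polyDl size_polyXn //.
apply: leq_ltn_trans (size_polyD _ _) _; rewrite gtn_max.
apply/andP; split; first by apply: leq_ltn_trans (size_scale_leq _ _) _; rewrite size_polyX.
by apply: leq_ltn_trans (size_polyC_leq1 _) _.
Qed.

Local Notation R := (coord_ring scubic).
Let k : {rmorphism F -> R} := (@cinj F scubic) \o polyC.
Let X : R := cinj scubic 'X.
Let Y : R := cY scubic.

Let domR (u v : R) : u != 0 -> v != 0 -> u * v != 0.
Proof. exact: (cring_mul_neq0 size_scubic). Qed.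

Let XY : Y ^+ 2 = X ^+ 3 + k A * X + k B.
Proof.
rewrite /Y expr2 cYsq /scubic /X /k /= -mul_polyC.
by rewrite !rmorphD rmorphM rmorphXn.
Qed.

Let X0 a : X - k a != 0.
Proof.
apply/eqP => /(congr1 fst) /= /eqP.
by rewrite polyXsubC_eq0.
Qed.

Let Y0 a b : Y - (k a * X + k b) != 0.
Proof.
apply/eqP => /(congr1 snd) /= /eqP.
by rewrite !mulr0 mul0r !addr0 subr0 oner_eq0.
Qed.

Local Notation pid := (pideal k X Y).

(** A generator [w] would divide [X - k x] and [Y - k y], whose norms have degrees 2 and 3. Its own
    norm vanishes at [x] and cannot have degree 1, so it has degree 2; then the cofactor of
    [Y - k y] has a norm of degree 1, which does not exist. *)
Let pid_affine x y : son (Some (x, y)) -> isim (pid (Some (x, y))) (pid None) -> False.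
Proof.
move=> /eqP P1 [f [g [f0 g0 IJ JI]]].
have [w [a [b ew]] ewg] := JI 1 I.
have dvd u : pid (Some (x, y)) u -> exists r, u = w * r.
  move=> /IJ [v _ e]; exists v; apply/eqP; rewrite -subr_eq0.
  apply/negPn/negP => n0; have := domR f0 n0.
  by rewrite mulrBr e mulrA ewg mulr1 subrr eqxx.
have [r1 e1] : exists r, X - k x = w * r by apply: dvd; exists 1, 0; ring.
have [r2 e2] : exists r, Y - k y = w * r by apply: dvd; exists 0, 1; ring.
have n1 : cnorm (X - k x) = ('X - x%:P) ^+ 2.
  by rewrite /cnorm /= oppr0 addr0 expr0n mulr0 subr0.
have n2 : cnorm (Y - k y) = (y ^+ 2)%:P - scubic.
  by rewrite /cnorm /= sub0r oppr0 addr0 sqrrN expr1n mulr1 rmorphXn.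
have s2 : size (cnorm (Y - k y)) = 4.
  rewrite n2 addrC size_polyDl ?size_polyN size_scubic //.
  by apply: leq_ltn_trans (size_polyC_leq1 _) _.
have rw : root (cnorm w) x.
  rewrite /root /cnorm; case: w ew {IJ JI ewg dvd e1 e2} => w1 w2 ew.
  have h : w1.[x] + w2.[x] * y = 0.
    have := congr1 (fun u : R => u.1.[x] + u.2.[x] * y) ew.
    rewrite /= => ->; rewrite /scubic !(hornerD, hornerM, hornerN, hornerC, hornerX, hornerXn, hornerZ, horner_exp).
    transitivity (b.2.[x] * ((x ^+ 3 + A * x + B) - y ^+ 2)); first by ring.
    by rewrite P1 subrr mulr0.
  apply/eqP; rewrite /= /scubic !(hornerD, hornerM, hornerN, hornerC, hornerX, hornerXn, hornerZ, horner_exp) -P1.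
  transitivity ((w1.[x] + w2.[x] * y) * (w1.[x] - w2.[x] * y)); first by ring.
  by rewrite h mul0r.
have w0 : w != 0.
  by apply: contraNneq (X0 x) => w0; rewrite e1 w0 mul0r.
have Nw0 : cnorm w != 0 by rewrite (cnorm_eq0 size_scubic).
have sw : (1 < size (cnorm w))%N by apply: root_size_gt1 Nw0 rw.
have nz1 : cnorm r1 != 0.
  by rewrite (cnorm_eq0 size_scubic); apply: contraNneq (X0 x) => r0; rewrite e1 r0 mulr0.
have nz2 : cnorm r2 != 0.
  rewrite (cnorm_eq0 size_scubic); apply: contraTneq (isT) => r0.
  by move: s2; rewrite e2 r0 mulr0 /cnorm /= expr0n mulr0 subr0 size_poly0.
have := cnorm_size size_scubic w; have := cnorm_size size_scubic r2.
have := congr1 (fun p : {poly F} => size p) (cnormM w r1); rewrite -e1 n1 size_exp_XsubC.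
rewrite size_mul //.
have := congr1 (fun p : {poly F} => size p) (cnormM w r2); rewrite -e2 s2 size_mul //.
move: nz1 nz2; rewrite -!size_poly_gt0; move: sw.
case: (size (cnorm w)) => [|[|[|[|n]]]] //.
  by move=> _ _; case: (size _) => // m _ [<-].
by move=> _; case: (size (cnorm r1)) => // m _ _ _; rewrite !addnS !addSn.
Qed.

Let pid_None_l P : isim (iprod (pid None) (pid P)) (pid P).
Proof. by apply: pideal0l; [apply: pideal_mul | apply: pidealD | apply: pideal_0]. Qed.

Let pid_opp P : son P -> isim (iprod (pid P) (pid (sopp P))) (pid None).
Proof.
case: P => [[x y]|]; last by move=> _; apply: pid_None_l.
by move=> /eqP h; apply: (pideal_opp XY X0 h (s_nonsing h) two_neq0).
Qed.

Let pid_add P Q : son P -> son Q -> isim (iprod (pid P) (pid Q)) (pid (sadd P Q)).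
Proof.
case: P => [[x1 y1]|]; last by move=> *; apply: pid_None_l.
case: Q => [[x2 y2]|] h1; last first.
  by move=> _; apply: isim_trans (isim_prodC _ _) _ => //; apply: pid_None_l.
move=> h2; case: (sadd_slope h1 h2) => [[ex ey ->] | [l [-> e1 e2 ns]]].
  have -> : Some (x2, y2) = sopp (Some (x1, y1)).
    by rewrite /= ex; congr (Some (_, _)); apply/eqP; rewrite -addr_eq0 addrC ey.
  exact: (pid_opp h1).
exact: (pideal_add XY X0 Y0 (eqP h1) e1 e2 ns).
Qed.

Let sadd_opp_eq0 P Q : sadd P (sopp Q) = None -> P = Q.
Proof.
case: P => [[x1 y1]|]; case: Q => [[x2 y2]|] //=.
case: eqVneq => [->|] //=; case: eqVneq => [|] //= e _.
by congr (Some (_, _)); apply/eqP; rewrite -subr_eq0 e.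
Qed.

(** Equal classes give [P - Q] the trivial class, so [P - Q] is the origin. Commutativity and
    associativity of points are those of ideal products, pulled back along this injection. *)
Let pid_inj P Q : son P -> son Q -> isim (pid P) (pid Q) -> P = Q.
Proof.
move=> hP hQ h; apply: sadd_opp_eq0.
have hS : son (sadd P (sopp Q)) by apply: sadd_on => //; apply: sopp_on.
have : isim (pid (sadd P (sopp Q))) (pid None).
  apply: isim_trans (isim_sym (pid_add hP (sopp_on hQ))) _ => //.
  apply: isim_trans (isim_prodl _ h) _ => //.
  exact: pid_opp.
by case: (sadd _ _) hS => [[x y]|] // hS /(pid_affine hS).
Qed.

Lemma saddC P Q : son P -> son Q -> sadd P Q = sadd Q P.
Proof.
move=> hP hQ; apply: pid_inj; try exact: sadd_on.
apply: isim_trans (isim_sym (pid_add hP hQ)) _ => //.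
by apply: isim_trans (isim_prodC _ _) (pid_add hQ hP).
Qed.

Lemma saddA P Q S : son P -> son Q -> son S -> sadd P (sadd Q S) = sadd (sadd P Q) S.
Proof.
move=> hP hQ hS.
have hPQ := sadd_on hP hQ; have hQS := sadd_on hQ hS.
apply: pid_inj; try exact: sadd_on.
apply: isim_trans (isim_sym (pid_add hP hQS)) _ => //.
apply: isim_trans (isim_prodC _ _) _ => //.
apply: isim_trans (isim_prodl _ (isim_sym (pid_add hQ hS))) _ => //.
apply: isim_trans (isim_prodC _ _) _ => //.
apply: isim_trans (isim_sym (isim_prodA _ _ _)) _ => //.
apply: isim_trans (isim_prodl _ (pid_add hP hQ)) _ => //.
exact: pid_add.
Qed.

Lemma saddN P : sadd (sopp P) P = None.
Proof. by case: P => [[x y]|] //=; rewrite eqxx addNr eqxx. Qed.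

Record spoint := SPoint { scoords :> option (F * F); spointP : son scoords }.
HB.instance Definition _ := [isSub for scoords].
HB.instance Definition _ := [Choice of spoint by <:].

Definition spadd (P Q : spoint) := SPoint (sadd_on (spointP P) (spointP Q)).
Definition spopp (P : spoint) := SPoint (sopp_on (spointP P)).
Definition spzero : spoint := @SPoint None isT.

Let spaddA : associative spadd.
Proof. by move=> P Q S; apply: val_inj; apply: saddA; apply: spointP. Qed.
Let spaddC : commutative spadd.
Proof. by move=> P Q; apply: val_inj; apply: saddC; apply: spointP. Qed.
Let spadd0 : left_id spzero spadd.
Proof. by move=> P; apply: val_inj. Qed.
Let spaddN : left_inverse spzero spopp spadd.
Proof. by move=> P; apply: val_inj; apply: saddN. Qed.

HB.instance Definition _ := GRing.isZmodule.Build spoint spaddA spaddC spadd0 spaddN.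

End ShortCurve.

(** * Valuations and the kernel of reduction *)

(* The value at [0] is unspecified; [vge] and [vgt] below treat it as [+oo]. *)
Record valuation (K : fieldType) := Valuation {
  val_fun :> K -> rat;
  valM : forall x y, x != 0 -> y != 0 -> val_fun (x * y) = val_fun x + val_fun y;
  valD : forall r x y, x != 0 -> y != 0 -> x + y != 0 ->
    r <= val_fun x -> r <= val_fun y -> r <= val_fun (x + y) }.

Section Valuation.
Variables (K : fieldType) (v : valuation K).
Implicit Types (x y : K) (r s : rat).

Definition vge r x := (x == 0) || (r <= v x).
Definition vgt r x := (x == 0) || (r < v x).

Lemma vge0 r : vge r 0. Proof. by rewrite /vge eqxx. Qed.
Lemma vgt0 r : vgt r 0. Proof. by rewrite /vgt eqxx. Qed.

Lemma vge_v x : vge (v x) x. Proof. by rewrite /vge lexx orbT. Qed.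

Lemma vgeW r s x : vge s x -> r <= s -> vge r x.
Proof. by move=> /orP[/eqP->|h] rs; rewrite /vge ?eqxx // (le_trans rs h) orbT. Qed.

Lemma vgtW r s x : vgt s x -> r <= s -> vgt r x.
Proof. by move=> /orP[/eqP->|h] rs; rewrite /vgt ?eqxx // (le_lt_trans rs h) orbT. Qed.

Lemma vge_gt r s x : vge s x -> r < s -> vgt r x.
Proof. by move=> /orP[/eqP->|h] rs; rewrite /vgt ?eqxx // (lt_le_trans rs h) orbT. Qed.

Lemma vgt_ge r x : vgt r x -> vge r x.
Proof. by move=> /orP[/eqP->|h]; rewrite /vge ?eqxx // (ltW h) orbT. Qed.

Lemma vgeP r x : x != 0 -> vge r x = (r <= v x).
Proof. by rewrite /vge => /negPf->. Qed.

Lemma vgtP r x : x != 0 -> vgt r x = (r < v x).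
Proof. by rewrite /vgt => /negPf->. Qed.

Lemma vgeN_gt r x : ~~ vge r x -> x != 0 /\ v x < r.
Proof. by rewrite /vge negb_or -ltNge => /andP[]. Qed.

Lemma vgtN_ge r x : ~~ vgt r x -> x != 0 /\ v x <= r.
Proof. by rewrite /vgt negb_or -leNgt => /andP[]. Qed.

Lemma val1 : v 1 = 0.
Proof.
have := valM v (oner_neq0 K) (oner_neq0 K); rewrite mulr1 => /eqP.
by rewrite -subr_eq0 opprD addNKr oppr_eq0 => /eqP.
Qed.

Lemma valX x n : x != 0 -> v (x ^+ n) = n%:R * v x.
Proof.
move=> x0; elim: n => [|n IH]; first by rewrite val1 mul0r.
by rewrite exprS valM ?expf_neq0 // IH -natr1 mulrDl mul1r addrC.
Qed.

Lemma valV x : x != 0 -> v x^-1 = - v x.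
Proof.
move=> x0; have xV0 : x^-1 != 0 by rewrite invr_eq0.
have := valM v x0 xV0; rewrite mulfV // val1 => /esym/eqP.
by rewrite addrC addr_eq0 => /eqP.
Qed.

Lemma valN x : v (- x) = v x.
Proof.
have [->|x0] := eqVneq x 0; first by rewrite oppr0.
have m0 : -1 != 0 :> K by rewrite oppr_eq0 oner_eq0.
have e : v (-1) = 0.
  have := valX 2 m0; rewrite sqrrN expr1n val1 => /esym/eqP.
  by rewrite mulf_eq0 pnatr_eq0 => /eqP.
by rewrite -mulN1r valM // e add0r.
Qed.

Lemma vgeD r x y : vge r x -> vge r y -> vge r (x + y).
Proof.
move=> /orP[/eqP->|hx] => [|/orP[/eqP->|hy]]; rewrite ?add0r ?addr0 //.
  by rewrite /vge hx orbT.
have [->|x0] := eqVneq x 0; first by rewrite add0r /vge hy orbT.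
have [->|y0] := eqVneq y 0; first by rewrite addr0 /vge hx orbT.
by rewrite /vge; have [//|xy0] := eqVneq (x + y) 0; rewrite valD.
Qed.

Lemma vgeN r x : vge r x -> vge r (- x).
Proof. by rewrite /vge oppr_eq0 valN. Qed.

Lemma vgtN r x : vgt r x -> vgt r (- x).
Proof. by rewrite /vgt oppr_eq0 valN. Qed.

Lemma vgeB r x y : vge r x -> vge r y -> vge r (x - y).
Proof. by move=> hx hy; apply: vgeD => //; apply: vgeN. Qed.

Lemma vgtD r x y : vgt r x -> vgt r y -> vgt r (x + y).
Proof.
have [->|x0] := eqVneq x 0; first by rewrite add0r.
have [->|y0] := eqVneq y 0; first by rewrite addr0.
rewrite (vgtP _ x0) (vgtP _ y0) => hx hy.
have h : vge (Num.min (v x) (v y)) (x + y).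
  by apply: vgeD; rewrite vgeP // ge_min lexx ?orbT.
by apply: vge_gt h _; rewrite lt_min hx hy.
Qed.

Lemma vgtB r x y : vgt r x -> vgt r y -> vgt r (x - y).
Proof. by move=> hx hy; apply: vgtD => //; apply: vgtN. Qed.

Lemma vgeM r s x y : vge r x -> vge s y -> vge (r + s) (x * y).
Proof.
have [->|x0] := eqVneq x 0; first by move=> *; rewrite mul0r vge0.
have [->|y0] := eqVneq y 0; first by move=> *; rewrite mulr0 vge0.
by rewrite (vgeP _ x0) (vgeP _ y0) vgeP ?mulf_neq0 // valM //; apply: lerD.
Qed.

Lemma vgtM r s x y : vgt r x -> vge s y -> vgt (r + s) (x * y).
Proof.
have [->|x0] := eqVneq x 0; first by move=> *; rewrite mul0r vgt0.
have [->|y0] := eqVneq y 0; first by move=> *; rewrite mulr0 vgt0.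
rewrite (vgtP _ x0) (vgeP _ y0) vgtP ?mulf_neq0 // valM // => hx hy.
exact: ltr_leD.
Qed.

Lemma vgeX r x n : vge r x -> vge (n%:R * r) (x ^+ n).
Proof.
move=> h; elim: n => [|n IH]; first by rewrite mul0r vgeP ?oner_neq0 // val1.
by rewrite exprS -natr1 mulrDl mul1r addrC; apply: vgeM.
Qed.

Lemma vge_nat n : vge 0 (n%:R : K).
Proof.
elim: n => [|n IH]; first exact: vge0.
by rewrite -natr1; apply: vgeD => //; rewrite vgeP ?oner_neq0 // val1.
Qed.

Lemma vge1 : vge 0 1.
Proof. exact: (vge_nat 1). Qed.

Lemma valD_eq x y : x != 0 -> vgt (v x) y -> x + y != 0 /\ v (x + y) = v x.
Proof.
move=> x0 hy; have xy0 : x + y != 0.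
  apply: contraTneq hy => /eqP; rewrite addrC addr_eq0 => /eqP->.
  by rewrite vgtP ?oppr_eq0 // valN ltxx.
split=> //; apply/eqP; rewrite eq_le; apply/andP; split; last first.
  by have := vgeD (vge_v x) (vgt_ge hy); rewrite vgeP.
rewrite leNgt; apply/negP => h.
have : vgt (v x) ((x + y) - y) by apply: vgtB => //; rewrite vgtP.
by rewrite addrK vgtP // ltxx.
Qed.

Lemma vgt1_neq0 x : vgt 0 (x - 1) -> x != 0 /\ v x = 0.
Proof.
move=> h; have := @valD_eq 1 (x - 1) (oner_neq0 K).
by rewrite val1 addrCA subrr addr0 => /(_ h).
Qed.

Lemma vge_unitM r x u : u != 0 -> v u = 0 -> vge r (x * u) -> vge r x.
Proof.
move=> u0 vu; have [->|x0] := eqVneq x 0; first by move=> *; rewrite vge0.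
by rewrite (vgeP _ x0) vgeP ?mulf_neq0 // valM // vu addr0.
Qed.

End Valuation.

(** [vmon] assembles a bound for a monomial by unification with the hypotheses; [vest] applies it to
    each term of a sum and leaves the comparison of bounds to [lra]. *)
Ltac vmon := lazymatch goal with
  | |- is_true (vge _ _ (_ * _)) => eapply vgeM; [vmon | vmon]
  | |- is_true (vge _ _ (_ ^+ _)) => eapply vgeX; vmon
  | |- is_true (vge _ _ (- _)) => eapply vgeN; vmon
  | |- is_true (vge _ _ (_%:R)) => first [eassumption | eapply vge_nat]
  | |- is_true (vge _ _ 1) => eapply vge1
  | |- _ => eassumption
  end.
Ltac vest := lazymatch goal with
  | |- is_true (vge _ _ (_ + _)) => apply: vgeD; vest
  | |- is_true (vge _ _ (- _)) => apply: vgeN; vest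
  | |- is_true (vge _ _ 0) => apply: vge0
  | |- _ => eapply vgeW; [vmon | lra]
  end.

(** * Addition near the origin and a truncated logarithm *)

Section FormalGroup.
Variables (K : fieldType) (v : valuation K) (E : scurve K) (m s : rat).
Local Notation A := (sA E).
Local Notation B := (sB E).
Local Notation vge := (vge v).
Hypothesis hA : vge (4 * m) A.
Hypothesis hB : vge (6 * m) B.
Hypothesis s_gt0 : 0 < s.

Definition zc (P : option (K * K)) : K := if P is Some (x, y) then x / y else 0.

(** Level [s] of the filtration of the kernel of reduction, in the coordinates [z = x / y] and
    [w = 1 / y] at the origin. The shift by [m] accounts for rescaling [x] by [2 m] and [y] by
    [3 m]. *)
Definition E1 (P : option (K * K)) : Prop :=
  if P is Some (x, y) then
    [/\ y != 0, vge (s - m) (x / y) & vge (3 * (s - m)) y^-1] else True.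

(* [35] times the invariant differential [(1 + 2 A z^4 + 3 B z^6) dz], integrated. *)
Definition flog (z : K) : K := 35 * z + 14 * A * z ^+ 5 + 15 * B * z ^+ 7.

(** In the plane [(z, w)] the curve is [w = z^3 + A z w^2 + B w^3] and the line is [w = lam z + nu].
    Substitution gives a cubic in [z], whose coefficients yield [z1 + z2 + z3]; it remains to expand
    [lam] and [nu] to sufficient order. *)
Lemma E1_add_core x1 y1 x2 y2 l : son E (Some (x1, y1)) -> son E (Some (x2, y2)) ->
  l * (x2 - x1) = y2 - y1 -> l * (y1 + y2) = x1 ^+ 2 + x1 * x2 + x2 ^+ 2 + A ->
  E1 (Some (x1, y1)) -> E1 (Some (x2, y2)) ->
  let P3 := Some (sline l x1 y1 x2) in
  E1 P3 /\ vge (9 * s - m) (flog (zc P3) - flog (x1 / y1) - flog (x2 / y2)).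
Proof.
have s0 := s_gt0; move=> /eqP P1 /eqP P2 e1 e2 [y10 hz1 hw1] [y20 hz2 hw2].
pose c := y1 - l * x1.
have ey1 : y1 = l * x1 + c by rewrite /c; ring.
have ey2 : y2 = l * x2 + c.
  by transitivity (y1 + (y2 - y1)); [ring | rewrite -e1 /c; ring].
have eA : A = l * (y1 + y2) - (x1 ^+ 2 + x1 * x2 + x2 ^+ 2) by rewrite e2; ring.
have eB : B = y1 ^+ 2 - x1 ^+ 3 - A * x1 by rewrite P1; ring.
clear P1 P2 e1 e2.
set z1 := x1 / y1 in hz1 *; set z2 := x2 / y2 in hz2 *.
set w1 := y1^-1 in hw1 *; set w2 := y2^-1 in hw2 *.
(* The slope [lam] is [N / d]: subtract the equations of the two points and cancel [z1 - z2]. In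
   this form it also covers tangents. *)
pose d := 1 - (A * z1 * (w1 + w2) + B * (w1 ^+ 2 + w1 * w2 + w2 ^+ 2)).
pose N := z1 ^+ 2 + z1 * z2 + z2 ^+ 2 + A * w2 ^+ 2.
have lN : - l * d = c * N.
  rewrite /d /N /z1 /z2 /w1 /w2 eB eA; move: y10 y20; rewrite ey1 ey2 => y10 y20.
  by field; rewrite y10 y20.
have hd1 : vge (4 * s) (d - 1).
  have -> : d - 1 = - (A * z1 * w1) - A * z1 * w2 - (B * w1 ^+ 2) - B * w1 * w2 - B * w2 ^+ 2 by rewrite /d; ring.
  vest.
have [d0 vd] : d != 0 /\ v d = 0 by apply: vgt1_neq0; apply: vge_gt hd1 _; lra.
have c0 : c != 0.
  apply: contraNneq y10 => c0; move: lN; rewrite c0 mul0r => /eqP.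
  by rewrite mulf_eq0 (negPf d0) orbF oppr_eq0 ey1 c0 addr0 => /eqP->; rewrite mul0r.
pose lam := - l / c; pose nu := c^-1.
have lamd : lam * d = N.
  by apply: (mulfI c0); rewrite -lN /lam; field.
have w1E : w1 = lam * z1 + nu.
  rewrite /w1 /lam /nu /z1; move: y10; rewrite ey1 => y10; field; by rewrite c0 y10.
have w1E' : w1 = z1 ^+ 3 + A * z1 * w1 ^+ 2 + B * w1 ^+ 3.
  rewrite eB /w1 /z1; field; exact: y10.
have hN : vge (2 * (s - m)) N by rewrite /N; vest.
have hlam : vge (2 * (s - m)) lam by apply: vge_unitM d0 vd _; rewrite lamd.
pose Q := z1 ^+ 2 + z1 * z2 + z2 ^+ 2.
have hQ : vge (2 * (s - m)) Q by rewrite /Q; vest.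
pose el := lam - Q.
have hel : vge (6 * s - 2 * m) el.
  have -> : el = A * w2 ^+ 2 - lam * (d - 1).
    rewrite /el; transitivity (N - Q - (lam * d - lam)); first by rewrite lamd; ring.
    by rewrite /N /Q; ring.
  by vest.
have elam : lam = Q + el by rewrite /el; ring.
pose nu0 := - (z1 * z2 * (z1 + z2)).
have hnu0 : vge (3 * (s - m)) nu0.
  have -> : nu0 = - (z1 ^+ 2 * z2) - z1 * z2 ^+ 2 by rewrite /nu0; ring.
  vest.
have hnu : vge (3 * (s - m)) nu.
  have -> : nu = w1 - lam * z1 by rewrite w1E; ring.
  vest.
pose en := nu - nu0.
have hen : vge (7 * s - 3 * m) en.
  have -> : en = A * z1 * w1 ^+ 2 + B * w1 ^+ 3 - el * z1.
    transitivity (w1 - lam * z1 - nu0); first by rewrite /en w1E; ring.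
    by rewrite [in LHS]w1E' elam /nu0 /Q; ring.
  vest.
have enu : nu = nu0 + en by rewrite /en; ring.
(* [D] is the leading coefficient of the cubic in [z] cut out by the line; its next coefficient will
   be [- e * D]. *)
pose D := 1 + A * lam ^+ 2 + B * lam ^+ 3.
have hD1 : vge (4 * s) (D - 1).
  have -> : D - 1 = A * lam ^+ 2 + B * lam ^+ 3 by rewrite /D; ring.
  vest.
have [D0 vD] : D != 0 /\ v D = 0 by apply: vgt1_neq0; apply: vge_gt hD1 _; lra.
pose x3 := l ^+ 2 - x1 - x2; pose y3 := l * x3 + c.
have y123 : y1 * y2 * y3 = c ^+ 3 * D.
  rewrite /D /lam; transitivity (c ^+ 3 + A * c * l ^+ 2 - B * l ^+ 3); last by field.
  by rewrite eB eA /y3 /x3 ey1 ey2; ring.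
have y30 : y3 != 0.
  apply/eqP => y30; have := y123; rewrite y30 mulr0 => /esym/eqP.
  by rewrite mulf_eq0 (negPf D0) orbF expf_eq0 (negPf c0).
pose z3 := x3 / y3.
pose e := z1 + z2 + z3.
have eD : e * D = - (2 * A * lam * nu + 3 * B * lam ^+ 2 * nu).
  have ce : e * (y1 * y2 * y3) = 2 * A * l * c - 3 * B * l ^+ 2.
    transitivity (x1 * y2 * y3 + x2 * y1 * y3 + x3 * y1 * y2).
      by rewrite /e /z1 /z2 /z3; field; rewrite y10 y20 y30.
    by rewrite eB eA /y3 /x3 ey1 ey2; ring.
  apply: (mulfI (expf_neq0 3 c0)); rewrite mulrCA -y123 ce /lam /nu; field; exact: c0.
have he : vge (5 * s - m) e.
  by apply: vge_unitM D0 vD _; rewrite eD; vest.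
(* The main part of [e], with [lam], [nu] and [D] replaced by their lowest terms [Q], [nu0] and
   1. *)
pose e0 := - (2 * A * Q * nu0 + 3 * B * Q ^+ 2 * nu0).
have hee : vge (9 * s - m) (e - e0).
  have -> : e - e0 = - (2 * A * Q * en) - 2 * A * el * nu - 3 * B * Q ^+ 2 * en - 3 * B * (2 * Q * el * nu) - 3 * B * el ^+ 2 * nu - e * (D - 1).
    transitivity (e * D - e0 - e * (D - 1)); first by ring.
    by rewrite eD /e0 enu elam; ring.
  vest.
have z3E : z3 = e - (z1 + z2) by rewrite /e; ring.
have hz3 : vge (s - m) z3.
  have -> : z3 = e - z1 - z2 by rewrite /e; ring.
  vest.
have w3E : y3^-1 = lam * z3 + nu.
  have := y30; rewrite /lam /nu /z3 /y3 => y30'; field; by rewrite c0 y30'.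
have hw3 : vge (3 * (s - m)) y3^-1 by rewrite w3E; vest.
have sl : sline l x1 y1 x2 = (x3, - y3).
  by rewrite /sline -/x3; congr (_, - _); rewrite /y3 ey1; ring.
move=> P3; rewrite /P3 sl /= invrN mulrN -/z3; split.
  by split; [rewrite oppr_eq0 | apply: vgeN | apply: vgeN].
pose Z := z1 + z2.
have hZ : vge (s - m) Z by rewrite /Z; vest.
pose f5 := 5 * Z ^+ 4 * e - 10 * Z ^+ 3 * e ^+ 2 + 10 * Z ^+ 2 * e ^+ 3 - 5 * Z * e ^+ 4 + e ^+ 5.
pose f7 := 7 * Z ^+ 6 * e - 21 * Z ^+ 5 * e ^+ 2 + 35 * Z ^+ 4 * e ^+ 3 - 35 * Z ^+ 3 * e ^+ 4 + 21 * Z ^+ 2 * e ^+ 5 - 7 * Z * e ^+ 6 + e ^+ 7.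
have h5 : vge (9 * s - 5 * m) f5 by rewrite /f5; vest.
have h7 : vge (11 * s - 7 * m) f7 by rewrite /f7; vest.
(* The main terms cancel by [Z^5 - z1^5 - z2^5 = 5 z1 z2 Z Q] and
   [Z^7 - z1^7 - z2^7 = 7 z1 z2 Z Q^2], since [14 * 5 = 35 * 2] and [15 * 7 = 35 * 3]. *)
have -> : flog (- z3) - flog z1 - flog z2 = - (35 * (e - e0)) - 14 * A * f5 - 15 * B * f7.
  by rewrite /flog z3E /f5 /f7 /e0 /nu0 /Q /Z; ring.
vest.
Qed.

End FormalGroup.

(** * The operator [g - 1] on elements killed by [p] *)

Section DifferenceOperator.
Variables (V : zmodType) (g : V -> V) (p : nat).
Hypothesis gB : zmod_morphism g.
Hypothesis p_prime : prime p.

Definition gdiff (x : V) : V := g x - x.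

Let g0 : g 0 = 0. Proof. by rewrite -[X in g X](subrr 0) gB subrr. Qed.
Let gN x : g (- x) = - g x. Proof. by rewrite -sub0r gB g0 sub0r. Qed.
Let gD x y : g (x + y) = g x + g y. Proof. by rewrite -{1}[y]opprK gB gN opprK. Qed.
Let gMn x n : g (x *+ n) = g x *+ n.
Proof. by elim: n => [|n IH]; rewrite ?mulr0n ?g0 // !mulrS gD IH. Qed.
Let gsum n (f : 'I_n -> V) : g (\sum_i f i) = \sum_i g (f i).
Proof. exact: (big_morph g gD g0). Qed.

Variable x : V.
Hypothesis px : x *+ p = 0.

Let pg i : iter i g x *+ p = 0.
Proof. by elim: i => //= i IH; rewrite -gMn IH g0. Qed.

(* The action of [{poly 'F_p}] on [x] in which ['X] acts as [g], truncated at degree [N]. *)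
Let act (N : nat) (q : {poly 'F_p}) : V := \sum_(i < N) iter i g x *+ ((q`_i)%R : 'F_p).

Let mulr_modp (y : V) n d : d = p -> y *+ p = 0 -> y *+ (n %% d) = y *+ n.
Proof.
by move=> -> py; rewrite [in RHS](divn_eq n p) mulrnDr mulnC mulrnA py mul0rn add0r.
Qed.

Let Fp_natD (y : V) (a b : 'F_p) : y *+ p = 0 -> y *+ (a + b)%R = y *+ a + y *+ b.
Proof. by move=> py; rewrite -mulrnDr /= mulr_modp ?Fp_cast. Qed.

Let Fp_nat1 (y : V) : y *+ (1%R : 'F_p) = y.
Proof. by rewrite /= modn_small. Qed.

Let actD N q r : act N (q + r) = act N q + act N r.
Proof. by rewrite /act -big_split; apply: eq_bigr => i _; rewrite coefD Fp_natD ?pg. Qed.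

Let actN N q : act N (- q) = - act N q.
Proof.
apply/eqP; rewrite -addr_eq0 -actD addNr /act big1 // => i _.
by rewrite coef0 mulr0n.
Qed.

Let actX N (q : {poly 'F_p}) : (size q < N)%N -> act N (q * 'X) = g (act N q).
Proof.
case: N => // N sq; rewrite /act gsum big_ord_recl [RHS]big_ord_recr /=.
rewrite coefMX /= mulr0n add0r (nth_default _ sq) mulr0n g0 addr0.
by apply: eq_bigr => i _; rewrite coefMX /= gMn.
Qed.

Let act_diff N k : (k < N.-1)%N -> act N (('X - 1) ^+ k) = iter k gdiff x.
Proof.
elim: k => [|k IH] kN.
  rewrite expr0 /act; case: N kN => // N _.
  rewrite big_ord_recl coef1 /= Fp_nat1 big1 ?addr0 // => i _.
  by rewrite coef1 /= mulr0n.
rewrite exprSr mulrBr mulr1 actD actN /= actX ?IH //; try exact: ltnW.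
by rewrite -polyC1 size_exp_XsubC; apply: leq_trans kN (leq_pred N).
Qed.

(** This is [('X - 1) ^+ (p ^ n) = 'X^(p ^ n) - 1] in characteristic [p], applied to [x] through
    [act]; the truncation degree only has to exceed [p ^ n]. *)
Lemma iter_gdiff_pexp n : iter (p ^ n) gdiff x = iter (p ^ n) g x - x.
Proof.
have chF : p \in [pchar {poly 'F_p}].
  by rewrite inE p_prime /= -polyC_natr pchar_Fp_0 ?polyC0 ?eqxx.
rewrite -(@act_diff (p ^ n).+2) //.
have chn : [pchar {poly 'F_p}].-nat (p ^ n)%N.
  by rewrite (eq_pnat _ (pcharf_eq chF)) pnatX pnat_id.
rewrite exprDn_pchar // exprNn_pchar // expr1n actD actN.
congr (_ - _); last by rewrite -(expr0 ('X - 1)) act_diff.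
have actXn k : (k < (p ^ n).+1)%N -> act (p ^ n).+2 'X^k = iter k g x.
  elim: k => [|k IH] kN; first by rewrite expr0 -(expr0 ('X - 1)) act_diff.
  rewrite exprSr actX ?size_polyXn; last exact: ltnW.
  by congr g; apply: IH; apply: ltnW.
exact: actXn.
Qed.

Lemma gdiff_fixed n : x != 0 -> iter (p ^ n) g x = x ->
  exists k, iter k gdiff x != 0 /\ g (iter k gdiff x) = iter k gdiff x.
Proof.
move=> x0 gx; have := iter_gdiff_pexp n; rewrite gx subrr => e.
have ex : exists k, iter k gdiff x == 0 by exists (p ^ n)%N; rewrite e.
case: (ex_minnP ex) => [[|k]]; first by move=> /=; rewrite (negPf x0).
move=> /eqP e0 mink; exists k; split.
  by apply/negP => /mink; rewrite ltnn.
by move: e0; rewrite /= {1}/gdiff => /eqP; rewrite subr_eq0 => /eqP.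
Qed.

End DifferenceOperator.

(** * The kernel of reduction as a subgroup *)

Section KernelOfReduction.
Variables (K : fieldType) (v : valuation K) (E : scurve K) (m : rat).
Local Notation A := (sA E).
Local Notation B := (sB E).
Hypothesis hA : vge v (4 * m) A.
Hypothesis hB : vge v (6 * m) B.

Lemma E1W s s' P : E1 v m s P -> s' <= s -> E1 v m s' P.
Proof.
case: P => [[x y]|] //= [y0 h1 h2] ss; split=> //; first by apply: vgeW h1 _; lra.
by apply: vgeW h2 _; lra.
Qed.

Lemma flogN z : flog E (- z) = - flog E z.
Proof. by rewrite /flog; ring. Qed.

Lemma flog0 : flog E 0 = 0.
Proof. by rewrite /flog; ring. Qed.

Lemma E1_add s (P Q : spoint E) : 0 < s -> E1 v m s P -> E1 v m s Q ->
  E1 v m s (P + Q : spoint E) /\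
  vge v (9 * s - m) (flog E (zc (P + Q : spoint E)) - flog E (zc P) - flog E (zc Q)).
Proof.
move=> s0; case: P => [[[x1 y1]|] hP]; last first.
  by move=> _ hQ /=; rewrite flog0 subr0 subrr; split=> //; exact: vge0.
case: Q => [[[x2 y2]|] hQ]; last first.
  by move=> hP' _ /=; rewrite flog0 subr0 subrr; split=> //; exact: vge0.
move=> h1 h2; case: (sadd_slope hP hQ) => [[ex ey e] | [l [e e1 e2 _]]].
  have {}e : scoords (SPoint hP + SPoint hQ : spoint E) = None := e.
  rewrite e /=; split=> //; rewrite flog0 sub0r -opprD.
  have -> : x2 / y2 = - (x1 / y1).
    have -> : y2 = - y1 by apply/eqP; rewrite -addr_eq0 addrC ey.
    by rewrite invrN mulrN ex.
  by rewrite flogN subrr oppr0; exact: vge0.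
have {}e : scoords (SPoint hP + SPoint hQ : spoint E) = Some (sline l x1 y1 x2) := e.
by rewrite e; apply: E1_add_core h1 h2.
Qed.

Lemma E1_muln s (P : spoint E) n : 0 < s -> E1 v m s P ->
  E1 v m s (P *+ n : spoint E) /\
  vge v (9 * s - m) (flog E (zc (P *+ n : spoint E)) - n%:R * flog E (zc P)).
Proof.
move=> s0 hP; elim: n => [|n [IH1 IH2]].
  by rewrite mulr0n; split=> //; rewrite /= flog0 mul0r subrr; exact: vge0.
rewrite mulrS; have [h1 h2] := E1_add s0 hP IH1; split=> //.
have -> : flog E (zc (P + P *+ n : spoint E)) - n.+1%:R * flog E (zc P) =
  (flog E (zc (P + P *+ n : spoint E)) - flog E (zc P) - flog E (zc (P *+ n : spoint E)))
  + (flog E (zc (P *+ n : spoint E)) - n%:R * flog E (zc P)).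
  by rewrite -natr1; ring.
exact: vgeD.
Qed.

Definition inE1 (P : spoint E) : bool :=
  if scoords P is Some (x, y) then ~~ vge v (2 * m) x else true.

(** When [v x < 2 m] the term [x ^+ 3] dominates the right-hand side, so [2 v y = 3 v x] and
    [v (x / y) = - v x / 2]. *)
Lemma inE1_E1 x y : son E (Some (x, y)) -> ~~ vge v (2 * m) x ->
  let s := m - v x / 2 in
  [/\ 0 < s, E1 v m s (Some (x, y)), x / y != 0 & v (x / y) = s - m].
Proof.
move=> /eqP e /vgeN_gt [x0 vx] s.
have x30 : x ^+ 3 != 0 by rewrite expf_neq0.
have [y20 vy2] : y ^+ 2 != 0 /\ v (y ^+ 2) = 3 * v x.
  rewrite e -addrA; have := @valD_eq _ v (x ^+ 3) (A * x + B) x30.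
  rewrite valX //; apply; apply: vgtD; last by apply: vge_gt hB _; lra.
  by apply: vge_gt (vgeM hA (vge_v v x)) _; lra.
have y0 : y != 0 by move: y20; rewrite sqrf_eq0.
have vy : 2 * v y = 3 * v x by rewrite -vy2 valX.
have yV0 : y^-1 != 0 by rewrite invr_eq0.
have z0 : x / y != 0 by rewrite mulf_neq0.
have vz : v (x / y) = s - m by rewrite valM // valV // /s; lra.
split=> //; first by rewrite /s; lra.
by split=> //; rewrite vgeP ?vz // valV // /s; lra.
Qed.

Lemma E1_inE1 s (P : spoint E) : 0 < s -> E1 v m s P -> inE1 P.
Proof.
move=> s0; case: P => [[[x y]|] hP] //= [y0]; rewrite /inE1 /=.
set z := x / y; set w := y^-1 => hz hw.
have w0 : w != 0 by rewrite invr_eq0.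
have ew : w * (1 - A * z * w - B * w ^+ 2) = z ^+ 3.
  move: hP => /eqP P1.
  have -> : B = y ^+ 2 - x ^+ 3 - A * x by rewrite P1; ring.
  by rewrite /w /z; field.
set d := 1 - _ - _ in ew.
have hd : vge v (4 * s) (d - 1).
  have -> : d - 1 = - (A * z * w) - B * w ^+ 2 by rewrite /d; ring.
  vest.
have [d0 vd] : d != 0 /\ v d = 0 by apply: vgt1_neq0; apply: vge_gt hd _; lra.
have z0 : z != 0.
  have : z ^+ 3 != 0 by rewrite -ew mulf_neq0.
  by rewrite expf_eq0.
have x0 : x != 0 by apply: contraNneq z0 => x0; rewrite /z x0 mul0r.
have vw : v w = 3 * v z by rewrite -[RHS]valX // -ew valM // vd addr0.
have vx : v x = v z - v w.
  by rewrite /z valM ?invr_eq0 // -/w addrK.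
rewrite vgeP // -ltNge vx vw; move: hz; rewrite vgeP //; lra.
Qed.

Lemma inE1D P Q : inE1 P -> inE1 Q -> inE1 (P + Q).
Proof.
have [-> _|P0] := eqVneq P 0; first by rewrite add0r.
have [-> ? _|Q0] := eqVneq Q 0; first by rewrite addr0.
case: P P0 => [[[x1 y1]|] hP] P0 hP1; last by case/eqP: P0; apply: val_inj.
case: Q Q0 => [[[x2 y2]|] hQ] Q0 hQ1; last by case/eqP: Q0; apply: val_inj.
have [s1 e1 _ _] := inE1_E1 hP hP1; have [s2 e2 _ _] := inE1_E1 hQ hQ1.
have s0 : 0 < Num.min (m - v x1 / 2) (m - v x2 / 2) by rewrite lt_min s1 s2.
apply: (E1_inE1 s0); apply: (E1_add s0 _ _).1.
  by apply: E1W e1 _; rewrite ge_min lexx.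
by apply: E1W e2 _; rewrite ge_min lexx orbT.
Qed.

Lemma inE1N P : inE1 P -> inE1 (- P).
Proof. by case: P => [[[x y]|] hP]. Qed.

Lemma inE1Mn P n : inE1 P -> inE1 (P *+ n).
Proof. by move=> h; elim: n => // n IH; rewrite mulrS; apply: inE1D. Qed.

End KernelOfReduction.

(** * Torsion points and a wildly ramified automorphism *)

Section WildInertia.
Variables (p : nat) (K : fieldType) (v : valuation K) (g : {rmorphism K -> K}).
Hypothesis p_prime : prime p.
Hypothesis p_ge11 : (11 <= p)%N.
Hypothesis p_neq0 : p%:R != 0 :> K.
Hypothesis v_p : v p%:R = 1.
Hypothesis v_nat : forall n, ~~ (p %| n)%N -> n%:R != 0 :> K /\ v n%:R = 0.
Hypothesis v_g : forall x, x != 0 -> vgt v (v x) (g x - x).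
Hypothesis v_int : forall x, g x = x -> x != 0 -> exists k : int, v x = k%:~R.
Hypothesis g_per : forall x, exists n, iter (p ^ n) g x = x.

Let v_unit n : (0 < n < 11)%N -> n%:R != 0 :> K /\ v n%:R = 0.
Proof.
move=> /andP[n0 n11]; apply: v_nat; apply/negP => /(dvdn_leq n0) h.
by have := leq_trans p_ge11 h; rewrite leqNgt n11.
Qed.

Let unitM n k : (n%:R != 0 :> K /\ v n%:R = 0) -> (k%:R != 0 :> K /\ v k%:R = 0) ->
  (n * k)%:R != 0 :> K /\ v (n * k)%:R = 0.
Proof. by move=> [n0 vn] [k0 vk]; rewrite natrM mulf_neq0 // valM // vn vk. Qed.

Let vge_g r x : vge v r x -> vge v r (g x).
Proof.
have [->|x0] := eqVneq x 0; first by rewrite rmorph0.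
move=> h; have -> : g x = x + (g x - x) by ring.
by apply: vgeD => //; apply: vgeW (vgt_ge (v_g x0)) _; rewrite -vgeP.
Qed.

Let vgt_g r x : vge v r x -> vgt v r (g x - x).
Proof.
have [->|x0] := eqVneq x 0; first by rewrite rmorph0 subrr vgt0.
by move=> h; apply: vgtW (v_g x0) _; rewrite -vgeP.
Qed.

Let v_gE x : x != 0 -> v (g x) = v x.
Proof.
move=> x0; have := valD_eq x0 (v_g x0).
by rewrite addrCA subrr addr0 => -[].
Qed.

Variable E : scurve K.
Local Notation A := (sA E).
Local Notation B := (sB E).
Hypothesis gA : g A = A.
Hypothesis gB : g B = B.

Lemma sadd_morph P Q :
  omap (fun xy => (g xy.1, g xy.2)) (sadd E P Q) =
  sadd E (omap (fun xy => (g xy.1, g xy.2)) P) (omap (fun xy => (g xy.1, g xy.2)) Q).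
Proof.
case: P => [[x1 y1]|] //; case: Q => [[x2 y2]|] //=.
rewrite (inj_eq (fmorph_inj g)); case: eqVneq => [_|n] /=.
  rewrite -rmorphD fmorph_eq0; case: eqVneq => //= _.
  by rewrite /sline !(rmorph_nat, rmorphXn, rmorphB, rmorphN, rmorphD, rmorphM, fmorphV) gA.
by rewrite /sline !(rmorphXn, rmorphB, rmorphN, rmorphD, rmorphM, fmorphV).
Qed.

Lemma son_morph P : son E P -> son E (omap (fun xy => (g xy.1, g xy.2)) P).
Proof.
case: P => [[x y]|] //= /eqP h; apply/eqP.
by rewrite -rmorphXn h !rmorphD rmorphM rmorphXn gA gB.
Qed.

Definition sg (P : spoint E) : spoint E := SPoint (son_morph (spointP P)).

Lemma sgD : {morph sg : P Q / P + Q}.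
Proof. by move=> P Q; apply: val_inj; apply: sadd_morph. Qed.

Lemma sg0 : sg 0 = 0. Proof. exact: val_inj. Qed.

Lemma sgMn P n : sg (P *+ n) = sg P *+ n.
Proof. by elim: n => [|n IH]; rewrite ?mulr0n ?sg0 // !mulrS sgD IH. Qed.

Lemma sgB : zmod_morphism sg.
Proof.
move=> P Q; rewrite sgD; congr (_ + _); apply/eqP.
by rewrite -addr_eq0 -sgD addNr sg0.
Qed.

Lemma iter_sg n (P : spoint E) :
  scoords (iter n sg P) = omap (fun xy => (iter n g xy.1, iter n g xy.2)) (scoords P).
Proof. by elim: n => [|n /= ->]; case: (scoords P) => [[x y]|]. Qed.

Lemma sg_per (P : spoint E) : exists n, iter (p ^ n) sg P = P.
Proof.
case: P => [[[x y]|] hP]; last by exists 0%N; apply: val_inj.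
have iter_pexp z a b : iter (p ^ a) g z = z -> iter (p ^ (a + b)) g z = z.
  move=> h; rewrite expnD mulnC iterM; elim: (p ^ b)%N => //= k ->; exact: h.
have [a ha] := g_per x; have [b hb] := g_per y; exists (a + b)%N.
apply: val_inj; rewrite /= iter_sg /=.
by rewrite iter_pexp // addnC iter_pexp.
Qed.

Variable m : rat.
Hypothesis hA : vge v (4 * m) A.
Hypothesis hB : vge v (6 * m) B.
Hypothesis hAB : (A != 0 /\ v A = 4 * m) \/ (B != 0 /\ v B = 6 * m).

Lemma inE1_g P : inE1 v m P -> inE1 v m (sg P).
Proof.
case: P => [[[x y]|] hP] //; rewrite /inE1 /= => /vgeN_gt [x0 vx].
by rewrite vgeP ?fmorph_eq0 // v_gE // -ltNge.
Qed.

Lemma flog_val z s : 0 < s -> z != 0 -> v z = s - m ->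
  flog E z != 0 /\ v (flog E z) = s - m.
Proof.
move=> s0 z0 vz.
have [n0 vn] : 35%:R != 0 :> K /\ v 35%:R = 0 by apply: (@unitM 5 7); apply: v_unit.
have z350 : 35 * z != 0 by rewrite mulf_neq0.
have vz35 : v (35 * z) = s - m by rewrite valM // vn vz add0r.
rewrite /flog -addrA; rewrite -vz35; apply: valD_eq => //; rewrite vz35.
have hz : vge v (s - m) z by rewrite vgeP // vz.
have h : vge v (5 * s - m) (14 * A * z ^+ 5 + 15 * B * z ^+ 7) by vest.
by apply: vge_gt h _; lra.
Qed.

(** The logarithm of [P *+ n] is 0 and agrees with [n%:R * flog E (x / y)] up to valuation
    [9 s - m], whereas [flog E (x / y)] has valuation exactly [s - m]; here [s = v (x / y) + m]. *)
Lemma torsion_bound (P : spoint E) n : inE1 v m P -> P != 0 -> P *+ n = 0 -> n%:R != 0 :> K ->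
  exists x y, [/\ scoords P = Some (x, y), x / y != 0 & 8 * (v (x / y) + m) <= v n%:R /\ 0 < v (x / y) + m].
Proof.
case: P => [[[x y]|] hP] hP1 P0 en n0; last by case/eqP: P0; apply: val_inj.
have [s0 e1 z0 vz] := inE1_E1 hA hB hP hP1.
exists x, y; split=> //; rewrite vz; split; last by rewrite subrK.
have := (@E1_muln _ _ _ _ hA hB _ (SPoint hP) n s0 e1).2; rewrite en /= flog0 sub0r.
have [f0 vf] := flog_val s0 z0 vz.
rewrite vgeP ?oppr_eq0 ?mulf_neq0 // valN valM // vf; lra.
Qed.

(** The coordinate [z] of a fixed point and the coefficients of the curve have integral valuations,
    so [v z + m] is a positive multiple of 1/4 or of 1/6, while [torsion_bound] allows at most
    1/8. *)
Lemma E1_no_p_torsion (P : spoint E) : inE1 v m P -> P *+ p = 0 -> sg P = P -> P = 0.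
Proof.
move=> h1 h2 h3; apply/eqP/negPn/negP => P0.
have [x [y [eP z0 []]]] := torsion_bound h1 P0 h2 p_neq0.
rewrite v_p => h8 spos.
have gz : g (x / y) = x / y.
  have := congr1 (@scoords K E) h3; rewrite /= eP /= => -[ex ey].
  by rewrite fmorph_div ex ey.
have [k vk] := v_int gz z0.
case: hAB => [[A0 vA]|[B0 vB]].
  have [j vj] := v_int gA A0.
  have e : 4 * (v (x / y) + m) = (4 * k + j)%:~R by rewrite rmorphD rmorphM /= -vj -vk ?vA ?vB; ring.
  have : (0 < 4 * k + j)%R by rewrite -(ltr_int rat) -e; lra.
  by rewrite gtz0_ge1 -(ler_int rat) -e; lra.
have [j vj] := v_int gB B0.
have e : 6 * (v (x / y) + m) = (6 * k + j)%:~R by rewrite rmorphD rmorphM /= -vj -vk ?vA ?vB; ring.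
have : (0 < 6 * k + j)%R by rewrite -(ltr_int rat) -e; lra.
by rewrite gtz0_ge1 -(ler_int rat) -e; lra.
Qed.

(** It is enough to exclude prime orders [q]. If [q] is not [p], then [v q%:R = 0], and
    [torsion_bound] contradicts itself; if [q = p], a fixed point is found with [gdiff_fixed]. *)
Lemma E1_torsion_free (P : spoint E) n : (0 < n)%N -> inE1 v m P -> P *+ n = 0 -> P = 0.
Proof.
elim/ltn_ind: n P => n IH P n0 hP Pn.
have [n1 | n1] := leqP n 1%N.
  by move: Pn; have -> : n = 1%N by apply/eqP; rewrite eqn_leq n1.
have q_pr := pdiv_prime n1; set q := pdiv n in q_pr.
have nq : (n = n %/ q * q)%N by rewrite divnK // pdiv_dvd.
have [k0 kn] : (0 < n %/ q)%N /\ (n %/ q < n)%N.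
  by rewrite divn_gt0 ?prime_gt0 // ltn_Pdiv ?prime_gt1 // pdiv_leq.
have PQ : (P *+ (n %/ q)) *+ q = 0 by rewrite -mulrnA -nq.
have hQ := inE1Mn hA hB (n %/ q) hP.
apply: (IH _ kn) => //.
move: (P *+ _) PQ hQ => Q Qq hQ {IH hP Pn}.
apply/eqP/negPn/negP => Q0.
have [eq|neq] := eqVneq q p; last first.
  have [q0 vq] : q%:R != 0 :> K /\ v q%:R = 0.
    by apply: v_nat; rewrite dvdn_prime2 // eq_sym.
  have [x [y [_ _ []]]] := torsion_bound hQ Q0 Qq q0; rewrite vq; lra.
rewrite eq in Qq; have [N perQ] := sg_per Q.
have [k [D0 kfix]] := gdiff_fixed sgB p_prime Qq Q0 perQ.
have h i : inE1 v m (iter i (gdiff sg) Q) /\ iter i (gdiff sg) Q *+ p = 0.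
  elim: i => //= i [h1 h2]; split.
    by apply: inE1D => //; [apply: inE1_g | apply: inE1N].
  rewrite /gdiff mulrnBl h2 subr0.
  by rewrite -sgMn h2; apply: val_inj.
by case/eqP: D0; apply: E1_no_p_torsion kfix; case: (h k).
Qed.

(** The abscissa of [sg P - P] is [((Y + y) / D) ^+ 2 - X - x] with [D = g x - x], and wildness
    makes [Y + y] as large as [y]. So the point is that [y] is large compared with [D]; this is
    delicate when [P] reduces to a singular point, where both [y] and [3 * x ^+ 2 + A] are small. *)
Lemma gdiff_inE1 (P : spoint E) : ~~ inE1 v m P -> inE1 v m (sg P - P).
Proof.
case: P => [[[x y]|] hP]; rewrite /inE1 /= // negbK => hx.
set X := g x; set Y := g y.
have two0 : 2 != 0 :> K /\ v 2 = 0 by apply: v_unit.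
have three0 : 3 != 0 :> K /\ v 3 = 0 by apply: v_unit.
pose D := X - x.
have vY : vge v (v y) Y by apply: vge_g; apply: vge_v.
(* If [g x = x] but [g y] is not [y], then [g y = - y] and [g y - y = - (2 * y)] has the valuation
   of [y], against wildness. *)
have [D0|D0] := eqVneq D 0.
  have eX : X = x by apply/eqP; rewrite -subr_eq0; apply/eqP.
  rewrite eX eqxx /=; case: eqVneq => // Yy.
  have ey : Y + y = 0.
    have h1 : Y ^+ 2 = y ^+ 2.
      have := spointP (sg (SPoint hP)); rewrite /= -/X -/Y eX => /eqP ->.
      by move: hP => /eqP ->.
    by apply/eqP; rewrite -(mulrI_eq0 _ (mulfI Yy)) -subr_sqr h1 subrr.
  have [y0|y0] := eqVneq y 0; first by case/eqP: Yy; rewrite /Y y0 rmorph0 subrr.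
  have := v_g y0; have -> : g y - y = - (2 * y).
    by transitivity (Y + y - 2 * y); [rewrite /Y; ring | rewrite ey sub0r].
  by rewrite vgtP ?oppr_eq0 ?mulf_neq0 ?two0.1 // valN valM ?two0.1 // two0.2 add0r ltxx.
have Xx : X != x by rewrite -subr_eq0.
rewrite Xx /=.
pose t := v D.
have t2m : 2 * m < t.
  by have := vgt_g hx; rewrite -/X -/D vgtP.
have DD : D * (3 * x ^+ 2 + A + 3 * x * D + D ^+ 2) = (Y - y) * (Y + y).
  have := spointP (sg (SPoint hP)); rewrite /= -/X -/Y => /eqP eY.
  move: hP => /eqP ey; transitivity (Y ^+ 2 - y ^+ 2); last by ring.
  by rewrite eY ey /D; ring.
(* Otherwise [DD] forces the cofactor of [D] above [t + 2 m]. If [v x > 2 m], this gives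
   [v A > 4 m], so [B] has valuation exactly [6 m] and [v y = 3 m < t + m]. If [v x = 2 m], then
   [3 * x ^+ 2 + A] has valuation at least [t + 2 m]; its image under [g - 1] is
   [2 * (3 * x * D) + 3 * D ^+ 2], of valuation exactly [t + 2 m], against wildness. *)
have key : ~~ vge v (t + m) y.
  apply/negP => hy.
  have hDD : vgt v (2 * t + 2 * m) (D * (3 * x ^+ 2 + A + 3 * x * D + D ^+ 2)).
    rewrite DD; have -> : 2 * t + 2 * m = (t + m) + (t + m) by ring.
    by apply: vgtM; [apply: vgt_g | apply: vgeD => //; apply: vge_g].
  have hd : vgt v (t + 2 * m) (3 * x ^+ 2 + A + 3 * x * D + D ^+ 2).
    move: hDD; set d := 3 * _ ^+ 2 + _ + _ + _.
    have [->|d0] := eqVneq d 0; first by rewrite vgt0.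
    by rewrite !vgtP ?mulf_neq0 // valM // -/t; lra.
  have hD : vge v t D by apply: vge_v.
  have hn3 := vge_nat v 3.
  have [hx2|] := boolP (vgt v (2 * m) x).
    have hxD : vgt v (t + 2 * m) (3 * x * D + D ^+ 2).
      apply: vgtD; last by apply: vge_gt (vgeX 2 hD) _; lra.
      have -> : t + 2 * m = (2 * m) + t by ring.
      by apply: vgtM => //; rewrite [3 * x]mulrC -[2 * m]addr0; apply: vgtM.
    have hf : vgt v (t + 2 * m) (3 * x ^+ 2 + A).
      have -> : 3 * x ^+ 2 + A = (3 * x ^+ 2 + A + 3 * x * D + D ^+ 2) - (3 * x * D + D ^+ 2) by ring.
      exact: vgtB.
    have hx4 : vgt v (4 * m) (x ^+ 2).
      have -> : 4 * m = 2 * m + 2 * m by ring.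
      by rewrite expr2; apply: vgtM => //; apply: vgt_ge.
    have hA4 : vgt v (4 * m) A.
      have -> : A = (3 * x ^+ 2 + A) - x ^+ 2 * 3 by ring.
      apply: vgtB; first by apply: vgtW hf _; lra.
      by rewrite -[4 * m]addr0; apply: vgtM.
    case: hAB => [[A0 vA]|[B0 vB]]; first by move: hA4; rewrite vgtP // vA ltxx.
    have [y20 vy2] : y ^+ 2 != 0 /\ v (y ^+ 2) = 6 * m.
      move: hP => /eqP ->; rewrite addrC -vB; apply: valD_eq => //; rewrite vB.
      apply: vgtD.
        have -> : 6 * m = 4 * m + 2 * m by ring.
        by rewrite exprSr; apply: vgtM => //; apply: vgt_ge.
      have -> : 6 * m = 4 * m + 2 * m by ring.
      by apply: vgtM => //; apply: vgt_ge.
    have y0 : y != 0 by move: y20; rewrite sqrf_eq0.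
    move: hy vy2; rewrite vgeP // valX //; lra.
  move=> /vgtN_ge [x0]; move: hx; rewrite vgeP // => h1 h2.
  have vx : v x = 2 * m by lra.
  have xD0 : 3 * x * D != 0 by rewrite !mulf_neq0 ?three0.1.
  have vxD : v (3 * x * D) = t + 2 * m.
    by rewrite !valM ?mulf_neq0 ?three0.1 // three0.2 vx -/t; lra.
  have hD2 : vgt v (t + 2 * m) (D ^+ 2) by apply: vge_gt (vgeX 2 hD) _; lra.
  have hf : vge v (t + 2 * m) (3 * x ^+ 2 + A).
    have -> : 3 * x ^+ 2 + A = (3 * x ^+ 2 + A + 3 * x * D + D ^+ 2) - 3 * x * D - D ^+ 2 by ring.
    apply: vgeB; last exact: vgt_ge.
    by apply: vgeB; [apply: vgt_ge | rewrite vgeP // vxD].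
  have := vgt_g hf.
  have -> : g (3 * x ^+ 2 + A) - (3 * x ^+ 2 + A) = 2 * (3 * x * D) + 3 * D ^+ 2.
    by rewrite rmorphD rmorphM rmorphXn rmorph_nat gA -/X /D; ring.
  have two_xD0 : 2 * (3 * x * D) != 0 by rewrite mulf_neq0 ?two0.1.
  have v2xD : v (2 * (3 * x * D)) = t + 2 * m by rewrite valM ?two0.1 // two0.2 vxD add0r.
  have h3D : vgt v (t + 2 * m) (3 * D ^+ 2).
    by rewrite [3 * _]mulrC -[t + _]addr0; apply: vgtM.
  have [] := @valD_eq _ v (2 * (3 * x * D)) (3 * D ^+ 2) two_xD0; first by rewrite v2xD.
  by move=> nz vnz; rewrite vgtP // vnz v2xD ltxx.
have [y0 vy] := vgeN_gt key.
have [S0 vS] : Y + y != 0 /\ v (Y + y) = v y.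
  have -> : Y + y = 2 * y + (Y - y) by ring.
  have y20 : 2 * y != 0 by rewrite mulf_neq0 ?two0.1.
  have v2y : v (2 * y) = v y by rewrite valM ?two0.1 // two0.2 add0r.
  by rewrite -[X in _ /\ _ = X]v2y; apply: valD_eq => //; rewrite v2y; apply: v_g.
have -> : ((- y - Y) / (x - X)) ^+ 2 - X - x = ((Y + y) / D) ^+ 2 + (- X - x).
  have -> : x - X = - D by rewrite /D; ring.
  by rewrite invrN mulrN; ring.
have q0 : (Y + y) / D != 0 by rewrite mulf_neq0 ?invr_eq0.
have vq : v ((Y + y) / D) = v y - t by rewrite valM ?invr_eq0 // valV // vS.
have q20 : ((Y + y) / D) ^+ 2 != 0 by rewrite expf_neq0.
have vq2 : v (((Y + y) / D) ^+ 2) = 2 * (v y - t) by rewrite valX // vq.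
have [] := @valD_eq _ v (((Y + y) / D) ^+ 2) (- X - x) q20.
  rewrite vq2; apply: (@vge_gt _ _ _ (2 * m)); last by lra.
  by apply: vgeB => //; apply: vgeN; apply: vge_g.
move=> n0 vn; rewrite vgeP // vn vq2 -ltNge; lra.
Qed.

Theorem torsion_fixed (P : spoint E) n : (0 < n)%N -> P *+ n = 0 -> sg P = P.
Proof.
move=> n0 Pn.
have [hP|hP] := boolP (inE1 v m P).
  by rewrite (E1_torsion_free n0 hP Pn); apply: val_inj.
apply/eqP; rewrite -subr_eq0; apply/eqP.
apply: (E1_torsion_free n0 (gdiff_inE1 hP)).
by rewrite mulrnBl -sgMn Pn subr0; apply: val_inj.
Qed.

End WildInertia.

(** * Short vectors of unimodular forms *)

Lemma pigeonhole3 (A B : finType) (f : A -> B) : (2 * #|B| < #|A|)%N ->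
  exists x y z, [/\ x != y, y != z, z != x, f x = f y & f x = f z].
Proof.
move=> cAB; have [/existsP[b /card_gt2P[x [y [z [[]]]]]]|] :=
  boolP [exists b, (2 < #|[set a | f a == b]|)%N].
  rewrite !inE => /eqP fx /eqP fy /eqP fz [xy yz zx].
  by exists x, y, z; rewrite fx fy fz.
rewrite negb_exists => /forallP h; move: cAB; rewrite ltnNge => /negP[].
rewrite -sum1_card (partition_big f predT) //= mulnC -sum_nat_const.
apply: leq_sum => b _; have := h b; rewrite -leqNgt; apply: leq_trans.
by rewrite -sum1_card; apply/eq_leq/eq_bigl => a; rewrite inE.
Qed.

Lemma sqrt_approx_bound (R : realFieldType) (d b u : R) : 0 < b -> 121 <= d * b ^+ 2 ->
  0 <= u -> u ^+ 2 < d * b ^+ 2 -> d * b ^+ 2 <= (u + 1) ^+ 2 ->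
  d <= ((u + 1) / b) ^+ 2 <= 6 / 5 * d.
Proof.
move=> b0 X121 u0 uX Xu; have bb : 0 < b ^+ 2 by rewrite exprn_gt0.
rewrite expr_div_n ler_pdivlMr // ler_pdivrMr // Xu /= -[6 / 5 * d * _]mulrA.
have -> : (u + 1) ^+ 2 = u ^+ 2 + 2 * u + 1 by ring.
move: (d * b ^+ 2) X121 uX {Xu} => X X121 uX.
have [h | h] := lerP (2 * u + 1) (X / 5); first by lra.
have u11 : 0 < u - 11 by lra.
have u1 : 0 < u by lra.
have := mulr_gt0 u11 u1; move: uX; rewrite expr2 mulrBl; lra.
Qed.

(** Square roots, absent from [rat], are rounded up to fractions, which makes the scales
    commensurable: a box will split exactly into cubic cells. With [d * b ^+ 2 >= 121], rounding up
    the numerator changes the square by at most the factor 6/5. *)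
Lemma sqrt_approx (R : archiRealFieldType) (d : R) : 0 < d ->
  exists a b : nat, [/\ (0 < a)%N, (0 < b)%N & d <= (a%:R / b%:R) ^+ 2 <= 6 / 5 * d].
Proof.
move=> d0; pose b := (Num.Def.archi_bound (121 / d)).+1.
have bd : 121 / d < b%:R.
  apply: lt_le_trans (archi_boundP _) _; last by rewrite ler_nat.
  by rewrite divr_ge0 // ltW.
have b1 : 1 <= b%:R :> R by rewrite ler1n.
have b0 : 0 < b%:R :> R by rewrite ltr0n.
have X121 : 121 <= d * b%:R ^+ 2.
  rewrite mulrC -ler_pdivrMr //; apply: le_trans (ltW bd) _.
  by rewrite expr2 -{1}[b%:R]mul1r ler_wpM2r // ltW.
have ex : exists a : nat, d * b%:R ^+ 2 <= a%:R ^+ 2.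
  move: X121; move: (d * _) => X X121.
  exists (Num.Def.archi_bound X).
  have X0 : 0 <= X by apply: le_trans X121.
  have h := archi_boundP X0; have := ler_pM X0 X0 (ltW h) (ltW h); rewrite -!expr2.
  by apply: le_trans; have := ler_wpM2r X0 X121; rewrite -expr2; lra.
case: (ex_minnP ex) => [[|a]] Xa mina.
  by move: (le_trans X121 Xa); rewrite expr0n /=; lra.
exists a.+1, b; split=> //; rewrite -natr1.
apply: sqrt_approx_bound => //; last by rewrite natr1.
by rewrite ltNge; apply/negP => /mina; rewrite ltnn.
Qed.

(** Gram-Schmidt without square roots. As [U] is unitriangular, the coordinates of a lattice point
    can be corrected by integers one at a time, so every unit cube with integral corners contains a
    lattice point. This replaces the comparison of volumes. *)
Lemma LDL (R : archiRealFieldType) n (S : 'M[R]_n) : S^T = S ->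
  (forall c : 'rV_n, c != 0 -> 0 < (c *m S *m c^T) 0 0) ->
  exists (d : 'rV[R]_n) (U : 'M[R]_n),
  [/\ forall i, 0 < d 0 i, S = U *m diag_mx d *m U^T, \det S = \prod_i d 0 i
    & forall k : 'I_n -> int, exists c : 'rV[int]_n,
      forall i, (k i)%:~R <= (map_mx intr c *m U) 0 i < (k i + 1)%:~R].
Proof.
elim: n S => [|n IH] S symS posS.
  exists 0, 1%:M; split; try by case.
  - by apply/matrixP; case.
  - by rewrite det_mx00 big_ord0.
  - by move=> k; exists 0; case.
move: S symS posS; rewrite -[n.+1]/(1 + n)%N => S symS posS.
pose a : R := ulsubmx S 0 0; pose b := dlsubmx S; pose W := a^-1 *: b.
have eul : ulsubmx S = a%:M by rewrite [LHS]mx11_scalar.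
have eur : ursubmx S = b^T by rewrite /b trmx_dlsub symS.
have eS : S = block_mx a%:M b^T b (drsubmx S) by rewrite -eul -eur submxK.
have a0 : 0 < a.
  have := posS (row_mx 1%:M 0); rewrite eS mul_row_block !mul1mx !mul0mx !addr0.
  rewrite tr_row_mx mul_row_col trmx1 trmx0 mulmx1 mulmx0 addr0 !mxE /= mulr1n; apply.
  apply: contraTneq isT => /(congr1 lsubmx); rewrite row_mxKl linear0 => /matrixP/(_ 0 0)/eqP.
  by rewrite !mxE oner_eq0.
have aW : a *: W = b by rewrite /W scalerA mulfV ?gt_eqF // scale1r.
pose S2 := drsubmx S - W *m b^T.
have symS2 : S2^T = S2.
  rewrite /S2 linearB /= trmx_drsub symS trmx_mul trmxK /W linearZ /=.
  by rewrite -scalemxAl -scalemxAr.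
have posS2 (c : 'rV_n) : c != 0 -> 0 < (c *m S2 *m c^T) 0 0.
  move=> c0; have := posS (row_mx (- (c *m W)) c).
  rewrite eS mul_row_block tr_row_mx mul_row_col.
  have -> : - (c *m W) *m a%:M + c *m b = 0.
    by rewrite mul_mx_scalar scalerN scalemxAr aW addNr.
  rewrite mul0mx add0r.
  have -> : - (c *m W) *m b^T + c *m drsubmx S = c *m S2.
    by rewrite /S2 mulmxBr mulNmx mulmxA addrC.
  apply; apply: contraNneq c0 => /(congr1 rsubmx).
  by rewrite row_mxKr linear0 => ->.
have [d [U [d0 eS2 detS2 solve]]] := IH S2 symS2 posS2.
exists (row_mx a%:M d), (block_mx 1%:M 0 W U); split.
- move=> i; case: (split_ordP i) => j ->; rewrite ?row_mxEl ?row_mxEr //.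
  by rewrite ord1 mxE.
- rewrite diag_mx_row tr_block_mx !mulmx_block !mul0mx !mulmx0 !mul1mx !addr0 !add0r.
  rewrite trmx1 trmx0 !mulmx1 !mulmx0 !addr0 -eS2.
  have -> : diag_mx (a%:M : 'rV_1) = a%:M :> 'M_1.
    by apply/matrixP => i j; rewrite !ord1 !mxE.
  rewrite mul_scalar_mx mul_mx_scalar aW {1}eS; congr (block_mx _ _ _ _).
    by rewrite mul0mx addr0 -linearZ /= aW.
  by rewrite /S2 /W linearZ /= -scalemxAr -scalemxAl addrC subrK.
- rewrite (_ : S = block_mx 1%:M 0 W 1%:M *m block_mx a%:M b^T 0 S2).
    rewrite det_mulmx det_lblock det_ublock !det1 !mul1r det_scalar1 detS2.
    rewrite [RHS]big_split_ord /= big_ord1 row_mxEl mxE mulr1n; congr (_ * _).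
    by apply: eq_bigr => i _; rewrite row_mxEr.
  rewrite mulmx_block !mul0mx !mulmx0 !mul1mx !addr0 mul_mx_scalar aW.
  by rewrite {1}eS /S2 addrCA subrr addr0.
move=> k; have [c hc] := solve (fun j => k (rshift 1 j)).
pose f := Num.floor ((map_mx intr c *m W) 0 0).
exists (row_mx ((k (lshift n 0) - f)%:M) c) => i.
rewrite map_row_mx mul_row_block mulmx0 mulmx1 add0r.
case: (split_ordP i) => j ->; last by rewrite row_mxEr; apply: hc.
rewrite row_mxEl ord1 mxE.
have -> : (map_mx intr (k (lshift n 0) - f)%:M : 'M[R]_1) 0 0 = (k (lshift n 0))%:~R - f%:~R.
  by rewrite !mxE mulr1n rmorphB.
by have := floor_itv ((map_mx intr c *m W) 0 0); rewrite -/f !rmorphD /=; lra.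
Qed.

Lemma quad_diag (R : comNzRingType) n (c d : 'rV[R]_n) (U : 'M_n) :
  (c *m (U *m diag_mx d *m U^T) *m c^T) 0 0 = \sum_i d 0 i * (c *m U) 0 i ^+ 2.
Proof.
have -> : c *m (U *m diag_mx d *m U^T) *m c^T = (c *m U) *m diag_mx d *m (c *m U)^T.
  by rewrite trmx_mul !mulmxA.
rewrite mul_mx_diag [LHS]mxE; apply: eq_bigr => i _.
rewrite [X in X * _]mxE [X in _ * X]mxE; move: ((c *m U) 0 i) => x.
by ring.
Qed.

Lemma exp6_5_gt4 (R : realFieldType) n : (11 <= n)%N -> 4 < (6 / 5) ^+ n :> R.
Proof.
move=> n11; have h4 : 2 < (6 / 5) ^+ 4 :> R by lra.
have h1 : 1 <= 6 / 5 :> R by lra.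
apply: (@lt_le_trans _ _ ((6 / 5) ^+ 8)).
  have -> : (6 / 5 : R) ^+ 8 = (6 / 5) ^+ 4 * (6 / 5) ^+ 4 by rewrite -exprD.
  by move: h4; move: (_ ^+ 4) => u u2; have : 0 < (u - 2) * (u - 2); [apply: mulr_gt0; lra | lra].
by rewrite ler_eXn2l ?(leq_trans _ n11) //; lra.
Qed.

(** There are [\prod_i m i] points for [(5 * P) ^ n] cells. Since the squares [r i ^+ 2] multiply to
    at most [(6 / 5) ^+ n], the square of the ratio is at least [(6 / 5) ^+ n], which exceeds 4. *)
Lemma cell_count (R : realFieldType) n (d r : 'I_n -> R) (m : 'I_n -> nat) (P : nat) :
  (11 <= n)%N -> (0 < P)%N -> (forall i, 0 < d i) -> (forall i, r i ^+ 2 <= 6 / 5 * d i) ->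
  (forall i, r i * (m i)%:R = (6 * P)%:R) -> \prod_i d i = 1 ->
  (2 * (5 * P) ^ n < \prod_i m i)%N.
Proof.
move=> n11 P0 d0 rd rm d1.
rewrite -(ltr_nat R) natrM natrX natr_prod.
have N0 : 0 < (5 * P)%:R :> R by rewrite ltr0n muln_gt0.
rewrite -ltr_sqr ?nnegrE; first last.
- by apply: prodr_ge0.
- by rewrite mulr_ge0 // exprn_ge0.
have h : (6 / 5) ^+ n * ((5 * P)%:R ^+ n) ^+ 2 <= (\prod_i (m i)%:R) ^+ 2 :> R.
  have e65 : 0 < (6 / 5 : R) ^+ n by rewrite exprn_gt0 //; lra.
  rewrite -(ler_pM2r e65).
  have -> : (\prod_i (m i)%:R) ^+ 2 * (6 / 5) ^+ n = \prod_i ((m i)%:R ^+ 2 * (6 / 5 * d i)) :> R.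
    by rewrite big_split [X in _ = _ * X]big_split /= -prodrXl d1 mulr1 prodr_const card_ord.
  have -> : (6 / 5) ^+ n * ((5 * P)%:R ^+ n) ^+ 2 * (6 / 5) ^+ n = \prod_(i < n) (6 * P)%:R ^+ 2 :> R.
    rewrite prodr_const card_ord [RHS]exprAC.
    have -> : (6 * P)%:R = 6 / 5 * (5 * P)%:R :> R by rewrite !natrM; field.
    have e : (6 / 5 * (5 * P)%:R) ^+ n = (6 / 5) ^+ n * (5 * P)%:R ^+ n :> R by apply: exprMn.
    by rewrite e [RHS]exprMn mulrAC -expr2.
  apply: ler_prod => i _; rewrite sqr_ge0 /= -(rm i) exprMn mulrC.
  by apply: ler_wpM2l; rewrite ?sqr_ge0.
apply: lt_le_trans h; rewrite exprMn ltr_pM2r; last by rewrite !exprn_gt0.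
by have := exp6_5_gt4 R n11; lra.
Qed.

(** Two points of a unit interval may have squared distance close to 1, but among three the average
    is at most 2/3. This is why three points are put in a cell: with side 6/5 each coordinate
    contributes [36/25 * 2/3 = 24/25 < 1] on average. *)
Lemma spread3 (R : realFieldType) (k a b c : R) :
  k <= a < k + 1 -> k <= b < k + 1 -> k <= c < k + 1 ->
  (a - b) ^+ 2 + (b - c) ^+ 2 + (c - a) ^+ 2 <= 2.
Proof.
move=> /andP[a0 a1] /andP[b0 b1] /andP[c0 c1].
wlog ab : a b a0 a1 b0 b1 / a <= b.
  move=> H; have [h|/ltW h] := lerP a b; first exact: H.
  have := H b a b0 b1 a0 a1 h; rewrite -(sqrrN (b - a)) -(sqrrN (a - c)) -(sqrrN (c - b)) !opprB; lra.
have h (x y : R) : 0 <= x -> 0 <= y -> x + y <= 1 -> x ^+ 2 + y ^+ 2 + (x + y) ^+ 2 <= 2.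
  move=> x0 y0 xy; have xy0 := mulr_ge0 x0 y0.
  have xy2 : (x + y) ^+ 2 <= 1 by rewrite expr_le1 // addr_ge0.
  by move: xy2; rewrite !expr2 !mulrDl !mulrDr; lra.
have [ca|/ltW ac] := lerP c a.
  have := h (a - c) (b - a); rewrite !subr_ge0 ca ab => /(_ isT isT).
  have -> : a - c + (b - a) = b - c by ring.
  rewrite -(sqrrN (a - b)) -(sqrrN (c - a)) !opprB; lra.
have [cb|/ltW bc] := lerP c b.
  have := h (c - a) (b - c); rewrite !subr_ge0 cb ac => /(_ isT isT).
  have -> : c - a + (b - c) = b - a by ring.
  rewrite -(sqrrN (a - b)) !opprB; lra.
have := h (b - a) (c - b); rewrite !subr_ge0 ab bc => /(_ isT isT).
have -> : b - a + (c - b) = c - a by ring.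
rewrite -(sqrrN (a - b)) -(sqrrN (b - c)) !opprB; lra.
Qed.

(* In the coordinates of [LDL], cut a large box of the lattice into cells of side 6/5: three points
   lie in one cell, and two of them are at squared distance less than [n]. *)
Lemma unimodular_short_vector (R : archiRealFieldType) n (S : 'M[R]_n) : (11 <= n)%N -> S^T = S ->
  (forall c : 'rV_n, c != 0 -> 0 < (c *m S *m c^T) 0 0) -> \det S = 1 ->
  exists2 c : 'rV[int]_n, c != 0 &
    (map_mx intr c *m S *m (map_mx intr c)^T) 0 0 < n%:R.
Proof.
move=> n11 symS posS detS.
have [d [U [d0 eS detd solve]]] := LDL symS posS.
have [a ha] := fin_all_exists (fun i => sqrt_approx (d0 i)).
have [b hb] := fin_all_exists ha.
pose P := (\prod_i a i)%N; pose m i := (6 * (P %/ a i) * b i)%N.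
have P0 : (0 < P)%N by rewrite prodn_gt0 // => i; case: (hb i).
pose r i : R := (a i)%:R / (b i)%:R.
have r0 i : 0 < r i by case: (hb i) => ? ? _; rewrite divr_gt0 ?ltr0n.
have rm i : r i * (m i)%:R = (6 * P)%:R.
  have [a0 b0 _] := hb i.
  have -> : (6 * P = 6 * (P %/ a i) * a i)%N.
    by rewrite -mulnA divnK // /P (bigD1 i) //= dvdn_mulr.
  rewrite /m [in LHS]natrM mulrCA divfK ?pnatr_eq0 -?lt0n // -natrM.
  by [].
have cnt : (2 * (5 * P) ^ n < \prod_i m i)%N.
  apply: (@cell_count R n (fun i => d 0 i) r m P) => //.
    by move=> i; have [_ _ /andP[]] := hb i.
  by rewrite -detd.
pose A := {dffun forall i : 'I_n, 'I_(m i)}.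
have hc0 (f : A) : exists c : 'rV[int]_n, forall i, (f i)%:R <= (map_mx intr c *m U) 0 i < (f i)%:R + 1.
  have [c hc] := solve (fun i => (f i : nat)%:Z).
  by exists c => i; have := hc i; rewrite rmorphD.
have [c hc] := fin_all_exists hc0.
pose t (f : A) i := (map_mx intr (c f) *m U) 0 i * r i * (5 / 6).
pose N := (5 * P)%N.
have tN f i : 0 <= t f i < N%:R.
  have /andP[h1 h2] := hc f i; rewrite /t -mulrA.
  have s0 : 0 < r i * (5 / 6) by apply: mulr_gt0 => //; lra.
  rewrite mulr_ge0 ?(ltW s0) ?(le_trans _ h1) ?ler0n //=.
  apply: (@lt_le_trans _ _ ((m i)%:R * (r i * (5 / 6)))).
    rewrite ltr_pM2r //; apply: lt_le_trans h2 _.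
    by rewrite natr1 ler_nat ltn_ord.
  have -> : (m i)%:R * (r i * (5 / 6)) = r i * (m i)%:R * (5 / 6) by ring.
  by rewrite rm /N !natrM; rewrite le_eqVlt; apply/orP; left; apply/eqP; field.
have hcell0 (f : A) : exists e : {ffun 'I_n -> 'I_N}, forall i, (e i)%:R <= t f i < (e i)%:R + 1.
  have he0 i : exists e : 'I_N, (e : nat)%:R <= t f i < (e : nat)%:R + 1.
    have /andP[t0 t1] := tN f i.
    have eN : (Num.truncn (t f i) < N)%N by rewrite truncn_lt_nat.
    by exists (Ordinal eN); rewrite natr1; apply: truncn_itv.
  have [e he] := fin_all_exists he0.
  by exists [ffun i => e i] => i; rewrite ffunE.
have [cell hcell] := fin_all_exists hcell0.
have [f [g [h [fg gh hf efg efh]]]] : exists f g h, [/\ f != g, g != h, h != f, cell f = cell g & cell f = cell h].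
  apply: pigeonhole3; rewrite card_ffun !card_ord card_dep_ffun foldrE big_image /=.
  by rewrite (eq_bigr m) // => i _; rewrite card_ord.
pose q (f g : A) := (map_mx intr (c f - c g) *m S *m (map_mx intr (c f - c g))^T) 0 0 : R.
have qE f' g' : q f' g' <= 36 / 25 * \sum_i (t f' i - t g' i) ^+ 2.
  rewrite /q eS quad_diag mulr_sumr; apply: ler_sum => i _.
  have [_ _ /andP[dr _]] := hb i.
  have -> : 36 / 25 * (t f' i - t g' i) ^+ 2 = r i ^+ 2 * (map_mx intr (c f' - c g') *m U) 0 i ^+ 2.
    have -> : (map_mx intr (c f' - c g') *m U) 0 i = (map_mx intr (c f') *m U) 0 i - (map_mx intr (c g') *m U) 0 i.
      by rewrite map_mxB mulmxBl !mxE.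
    by rewrite /t; field.
  by apply: ler_wpM2r dr; apply: sqr_ge0.
have c_neq f' g' : f' != g' -> c f' - c g' != 0.
  apply: contraNneq => /eqP; rewrite subr_eq0 => /eqP ec; apply/eqP/ffunP => i.
  have := hc f' i; have := hc g' i; rewrite ec => /andP[h1 h2] /andP[h3 h4].
  have := le_lt_trans h1 h4; have := le_lt_trans h3 h2.
  rewrite !natr1 !ltr_nat !ltnS => h5 h6.
  by apply: val_inj; apply/eqP; rewrite eqn_leq h5 h6.
have sum3 : q f g + q g h + q h f < 3 * n%:R.
  apply: (@le_lt_trans _ _ (36 / 25 * \sum_(i < n) 2)).
    apply: le_trans (lerD (lerD (qE f g) (qE g h)) (qE h f)) _.
    rewrite -!mulrDr -!big_split /=; apply: ler_wpM2l; first by lra.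
    apply: ler_sum => i _; apply: (@spread3 _ (cell f i)%:R) => //.
      by rewrite efg; apply: hcell.
    by rewrite efh; apply: hcell.
  rewrite sumr_const card_ord -[2 *+ n]mulr_natr.
  have : 0 < n%:R :> R by rewrite ltr0n (leq_trans _ n11).
  by move: n%:R => u u0; lra.
have [h1|h1] := ltrP (q f g) n%:R; first by exists (c f - c g) => //; apply: c_neq.
have [h2|h2] := ltrP (q g h) n%:R; first by exists (c g - c h) => //; apply: c_neq.
have [h3|h3] := ltrP (q h f) n%:R; first by exists (c h - c f) => //; apply: c_neq.
exfalso; move: sum3 h1 h2 h3; move: (q f g) (q g h) (q h f) (n%:R : R) => u1 u2 u3 u4.
lra.
Qed.

Lemma posdef_det_gt0 (R : archiRealFieldType) n (S : 'M[R]_n) : S^T = S ->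
  (forall c : 'rV_n, c != 0 -> 0 < (c *m S *m c^T) 0 0) -> 0 < \det S.
Proof.
by move=> symS posS; have [d [U [d0 _ -> _]]] := LDL symS posS; apply: prodr_gt0.
Qed.

(** * A generator of the Galois group and a real embedding *)

Local Open Scope classical_set_scope.
Local Open Scope ring_scope.

(** A compactness argument: take an ultrafilter on lists that contains, for each [t], the lists
    including [t]. As [h s z] has finitely many possible values, exactly one of them is taken on a
    set of the ultrafilter, and [H z] is that value. *)
Lemma rado_selection (X Y : eqType) (c : X -> seq Y) (h : seq X -> X -> Y) :
  (forall s z, z \in s -> h s z \in c z) ->
  exists H : X -> Y, forall t : seq X, exists s : seq X,
    {subset t <= s} /\ {in t, forall z, H z = h s z}.
Proof.
move=> hc.
pose F := filter_from [set: seq X] (fun t : seq X => [set s : seq X | {subset t <= s}]).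
have FF : ProperFilter F.
  apply: filter_from_proper; last by move=> t _; exists t.
  apply: filter_from_filter; first by exists [::].
  move=> t1 t2 _ _; exists (t1 ++ t2) => // s /= hs; split=> z hz;
    by apply: hs; rewrite mem_cat hz ?orbT.
have [G [GU FG]] := ultraFilterLemma FF.
have GP : ProperFilter G by apply: ultra_proper.
have G_mem z : G [set s : seq X | z \in s].
  by apply: FG; exists [:: z] => // s /= hs; apply: hs; rewrite inE.
have Hz z : exists y, G [set s | h s z = y].
  have : G [set s | h s z \in c z].
    by apply: filterS (G_mem z) => s /=; apply: hc.
  elim: (c z) => [|y l IH].
    by move=> h0; have [s] := filter_ex h0.
  move=> hyl; have [Gy|Gy] := in_ultra_setVsetC [set s | h s z = y] GU; first by exists y.
  apply: IH; apply: filterS (filterI hyl Gy) => s /= [].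
  by rewrite inE => /orP[/eqP|].
have [H hH] := choice Hz; exists H => t.
have : G [set s : seq X | {subset t <= s} /\ {in t, forall z, H z = h s z}].
  elim: t => [|z t IH]; first by apply: filterS filterT => s _; split.
  apply: filterS (filterI IH (filterI (G_mem z) (hH z))) => s /= [[h1 h2] [h3 h4]].
  by split=> u; rewrite inE => /orP[/eqP->|]; [|exact: h1| |exact: h2].
by move=> /filter_ex [s hs]; exists s.
Qed.

Lemma poly_root_seq (F : fieldType) (p : {poly F}) : p != 0 ->
  exists s : seq F, forall x, root p x -> x \in s.
Proof.
move: {2}(size p) (leqnn (size p)) => n.
elim: n p => [|n IH] p; first by rewrite leqn0 size_poly_eq0 => ->.
move=> sp p0; have [[x rx]|nr] := pselect (exists x, root p x); last first.
  by exists [::] => x rx; case: nr; exists x.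
have /factor_theorem [q eq] := rx.
have q0 : q != 0 by apply: contraNneq p0 => q0; rewrite eq q0 mul0r.
have sq : (size q <= n)%N by move: sp; rewrite eq size_Mmonic ?monicXsubC // size_XsubC addn2.
have [s hs] := IH q sq q0; exists (x :: s) => y.
by rewrite eq rootM root_XsubC inE => /orP[/hs->|->]; rewrite ?orbT.
Qed.

Section Embeddings.
Variables (F K : fieldType) (iota : {rmorphism F -> K}).
Local Notation "q ^iota" := (map_poly iota q) (at level 2, format "q ^iota").

Lemma irreducible_root_dvd (q g : {poly F}) x :
  irreducible_poly q -> root q^iota x -> root g^iota x -> q %| g.
Proof.
move=> irq rq rg; apply/negPn/negP => ndv.
have cop : coprimep q g.
  have [|h] := boolP (coprimep q g) => //.
  have : q %= gcdp q g.
    by rewrite eqp_sym; apply: irq.2; rewrite ?dvdp_gcdl // -coprimep_def.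
  by rewrite /eqp dvdp_gcd (negPf ndv) andbF.
have /Bezout_coprimepP [[u v] /= huv] := cop.
have : (u * q + v * g)^iota %= 1 by rewrite -(rmorph1 (map_poly iota)) eqp_map.
move=> /eqp_root /(_ x); rewrite rmorphD !rmorphM /= /root !hornerE.
by rewrite (eqP rq) (eqP rg) !mulr0 addr0 eqxx oner_eq0.
Qed.

Hypothesis charF : [pchar F] =i pred0.
Hypothesis algK : forall x, algebraicOver iota x.

Lemma PET_seq (s : seq K) : exists z, {in s, forall x, exists q : {poly F}, q^iota.[z] = x}.
Proof.
elim: s => [|x s [y hy]]; first by exists 0.
have [p p0 px] := algK x; have [q q0 qy] := algK y.
have [n [[q1 h1] [q2 h2]]] := pchar0_PET p0 px q0 qy charF.
exists (y *+ n - x) => u; rewrite inE => /orP[/eqP->|/hy[g <-]]; first by exists q1.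
by exists (g \Po q2); rewrite map_comp_poly horner_comp h2.
Qed.

Variables (L : fieldType) (iotaL : {rmorphism F -> L}) (tt : K -> L).
Hypothesis ttP : forall z, exists q : {poly F},
  [/\ irreducible_poly q, root q^iota z & root (map_poly iotaL q) (tt z)].

(** A list [s] generates a field [F(th s)], embedded by sending [th s] to [tt (th s)]. Each element
    has finitely many possible images, so [rado_selection] glues these partial embeddings. The
    second clause records that at [x] the result is one of them: a property common to all the
    choices in [tt] passes to [j]. *)
Lemma embedding_exists : exists j : {rmorphism K -> L},
  (forall a, j (iota a) = iotaL a) /\
  forall x, exists z g, g^iota.[z] = x /\ j x = (map_poly iotaL g).[tt z].
Proof.
have [th hth] := choice PET_seq.
have hg0 (sx : seq K * K) : exists g : {poly F}, sx.2 \in sx.1 -> g^iota.[th sx.1] = sx.2.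
  have [h|h] := boolP (sx.2 \in sx.1); last by exists 0.
  by have [g <-] := hth sx.1 _ h; exists g.
have [g hg] := choice hg0.
have ev z q1 q2 : q1^iota.[z] = q2^iota.[z] -> (map_poly iotaL q1).[tt z] = (map_poly iotaL q2).[tt z].
  move=> e; have [q [irq rq rq']] := ttP z.
  have : q %| q1 - q2.
    apply: irreducible_root_dvd irq rq _.
    by rewrite rmorphB /root /= hornerD hornerN e subrr.
  move=> /dvdpP [r er]; apply/eqP; rewrite -subr_eq0 -hornerN -hornerD -rmorphB er rmorphM hornerM.
  by rewrite (eqP rq') mulr0.
pose h s z := (map_poly iotaL (g (s, z))).[tt (th s)].
have hE s z q : z \in s -> q^iota.[th s] = z -> h s z = (map_poly iotaL q).[tt (th s)].
  by move=> zs eq; apply: ev; rewrite hg.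
have c0 z : exists c : seq L, forall s, z \in s -> h s z \in c.
  have [q q0 rz] := algK z.
  have [c hc] : exists c : seq L, forall x, root (map_poly iotaL q) x -> x \in c.
    by apply: poly_root_seq; rewrite map_poly_eq0.
  exists c => s zs; apply: hc.
  have : (map_poly iotaL (q \Po g (s, z))).[tt (th s)] = (map_poly iotaL 0).[tt (th s)].
    apply: ev; rewrite map_comp_poly horner_comp hg //= (eqP rz).
    by rewrite rmorph0 horner0.
  by rewrite map_comp_poly horner_comp rmorph0 horner0 => /eqP.
have [c hc] := choice c0.
have [j hj] := rado_selection (fun s z => hc z s).
have jD : zmod_morphism j.
  move=> x y; have [s [ss hs]] := hj [:: x; y; x - y].
  rewrite !hs ?inE ?eqxx ?orbT // (@hE s (x - y) (g (s, x) - g (s, y))).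
  - by rewrite rmorphB hornerD hornerN.
  - by apply: ss; rewrite !inE eqxx !orbT.
  - by rewrite rmorphB hornerD hornerN !hg //=; apply: ss; rewrite !inE eqxx ?orbT.
have jM : monoid_morphism j.
  split.
    have [s [ss hs]] := hj [:: 1].
    rewrite hs ?inE // (@hE s 1 1) ?rmorph1 ?hornerC //.
    by apply: ss; rewrite inE.
  move=> x y; have [s [ss hs]] := hj [:: x; y; x * y].
  rewrite !hs ?inE ?eqxx ?orbT // (@hE s (x * y) (g (s, x) * g (s, y))).
  - by rewrite rmorphM hornerM.
  - by apply: ss; rewrite !inE eqxx !orbT.
  - by rewrite rmorphM hornerM !hg //=; apply: ss; rewrite !inE eqxx ?orbT.
pose jm := GRing.isZmodMorphism.Build _ _ j jD.
pose jmm := GRing.isMonoidMorphism.Build _ _ j jM.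
pose jr : {rmorphism K -> L} := HB.pack j jm jmm.
exists jr; split=> [a|x] /=.
  have [s [ss hs]] := hj [:: iota a].
  rewrite hs ?inE // (@hE s _ a%:P) ?map_polyC ?hornerC //.
  by apply: ss; rewrite inE.
have [s [ss hs]] := hj [:: x].
exists (th s), (g (s, x)); rewrite hg ?hs ?inE //.
by apply: ss; rewrite inE.
Qed.

End Embeddings.

Section Topology.
Variables (F K : fieldType) (iota : {rmorphism F -> K}) (p : nat).
Variables (g : padic_int p -> Gal iota).
Hypothesis g_cont : continuous g.

Lemma padic_cvg (u : nat -> padic_int p) (a : padic_int p) :
  (forall n i, (i <= n)%N -> padic_proj (u n) i = padic_proj a i) -> u @ \oo --> a.
Proof.
move=> h U [W [[B oB <-] Ba BU]].
have cv : (fun n => set_val (u n)) @ \oo --> set_val a.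
  apply/cvg_sup => N V [_ [[C oC <-] Ca CV]].
  apply: (filterS CV); exists N => // n /= Nn.
  by rewrite /padic_proj in h; rewrite set_valE h.
have := cv B; rewrite nbhsE => /(_ _) []; first by exists B.
by move=> N _ hN; exists N => // n Nn; apply: BU; apply: hN.
Qed.

Lemma Gal_near (s : Gal iota) x : nbhs s [set t | Gal_fun t x = Gal_fun s x].
Proof.
have c1 : continuous (fun t : Gal iota => (set_val t : {ptws K -> discrete_topology K})).
  exact: initial_continuous.
have c2 := @proj_continuous K (fun _ => discrete_topology K) x.
have h : (fun t : Gal iota => Gal_fun t x : discrete_topology K) @ s --> (Gal_fun s x : discrete_topology K).
  exact: (continuous_comp (c1 s) (c2 _)).
apply: (h [set y | y = Gal_fun s x]).
by apply: open_nbhs_nbhs; split=> //; apply: discrete_open.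
Qed.

(** Evaluation at [x] is locally constant on the Galois group, so limits of [p]-adic integers can be
    tested on a term of the sequence. *)
Lemma padic_seq_eval (u : nat -> padic_int p) (a : padic_int p) x :
  (forall n i, (i <= n)%N -> padic_proj (u n) i = padic_proj a i) ->
  exists n, Gal_fun (g (u n)) x = Gal_fun (g a) x.
Proof.
move=> /padic_cvg h; have := cvg_comp _ _ h (g_cont (x := a)).
move=> /(_ _ (@Gal_near (g a) x)) [N _ hN]; exists N; apply: hN => /=.
exact: leqnn.
Qed.

End Topology.

(** * The fixed field of a possibly infinite Galois extension *)

Section GaloisTheory.
Variables (F K : fieldType) (iota : {rmorphism F -> K}).
Local Notation "q ^iota" := (map_poly iota q) (at level 2, format "q ^iota").
Hypothesis charF : [pchar F] =i pred0.
Hypothesis galK : galois_extension iota.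

Lemma irreducible_eval_eq (q g1 g2 : {poly F}) (L : fieldType) (iotaL : {rmorphism F -> L}) x y :
  irreducible_poly q -> root q^iota x -> root (map_poly iotaL q) y ->
  g1^iota.[x] = g2^iota.[x] -> (map_poly iotaL g1).[y] = (map_poly iotaL g2).[y].
Proof.
move=> irq rq rq' e.
have : q %| g1 - g2.
  apply: irreducible_root_dvd irq rq _.
  by rewrite rmorphB /root /= hornerD hornerN e subrr.
move=> /dvdpP [r er]; apply/eqP; rewrite -subr_eq0 -hornerN -hornerD -rmorphB er rmorphM hornerM.
by rewrite (eqP rq') mulr0.
Qed.

(** If [g] took the value [x] at every conjugate of [z], then [g %% q - x], of degree less than that
    of [q], would vanish at all the roots of [q], distinct by separability. It would be 0, and [x]
    would lie in [F]. *)
Lemma conjugate_moves (x z : K) (g : {poly F}) : ~ (exists a, x = iota a) ->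
  g^iota.[z] = x -> exists q z', [/\ irreducible_poly q, root q^iota z, root q^iota z' & g^iota.[z'] <> x].
Proof.
move=> xF gz; have [_ sepK norK] := galK.
have [q [irq rq sepq]] := sepK z.
apply: contrapT => nex; apply: xF.
have all_eq z' : root q^iota z' -> g^iota.[z'] = x.
  by move=> rz'; apply: contrapT => h; apply: nex; exists q, z'.
have [s eqs] := norK q z irq rq.
have us : uniq s.
  by rewrite -separable_prod_XsubC -(eqp_separable eqs) separable_map.
have ss : size s = (size q).-1.
  by have := eqp_size eqs; rewrite size_map_poly size_prod_XsubC => ->.
have q1 := irq.1.
pose r := g %% q.
have rz z' : root q^iota z' -> r^iota.[z'] = x.
  move=> rz'; rewrite -(all_eq _ rz').
  by rewrite [in RHS](divp_eq g q) rmorphD rmorphM hornerD hornerM (eqP rz') mulr0 add0r.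
have sr : (size r < size q)%N by rewrite ltn_modp -size_poly_gt0 (ltn_trans _ q1).
have r0 : r^iota - x%:P = 0.
  apply: (@roots_geq_poly_eq0 _ _ s) => //.
    apply/allP => y ys; rewrite /root hornerD hornerN hornerC rz ?subrr //.
    by rewrite (eqp_root eqs) root_prod_XsubC.
  rewrite ss; apply: leq_trans (size_polyD _ _) _; rewrite geq_max size_map_poly size_polyN.
  have {}sr : (size r <= (size q).-1)%N by rewrite -ltnS prednK // (ltn_trans _ q1).
  rewrite sr (leq_trans (size_polyC_leq1 _)) //.
  by rewrite -ltnS prednK // (ltn_trans _ q1).
exists r`_0; have /eqP := r0; rewrite subr_eq0 => /eqP /(congr1 (fun p : {poly K} => p`_0)).
by rewrite coef_map coefC eqxx => ->.
Qed.

Lemma root_list (q : {poly F}) x : irreducible_poly q -> root q^iota x ->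
  exists2 s : seq K, uniq s & forall y, root q^iota y = (y \in s).
Proof.
move=> irq rx; have [_ _ norK] := galK; have [s eqs] := norK q x irq rx.
exists (undup s); first exact: undup_uniq.
by move=> y; rewrite (eqp_root eqs) root_prod_XsubC mem_undup.
Qed.

Lemma galois_endo_aut (j : {rmorphism K -> K}) :
  (forall a, j (iota a) = iota a) -> is_aut iota (j : K -> K).
Proof.
move=> jF; split=> //; [exact: rmorphB | by split; [exact: rmorph1 | exact: rmorphM] |].
have surj y : exists x, j x = y.
  have [_ sepK _] := galK; have [q [irq ry _]] := sepK y.
  have [s us sE] := root_list irq ry.
  have js : {subset map j s <= s}.
    move=> _ /mapP [x xs ->]; move: xs; rewrite -!sE => rx.
    have -> : q^iota = map_poly j q^iota.
      by rewrite -map_poly_comp; apply: eq_map_poly => a /=; rewrite jF.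
    exact: rmorph_root.
  have ujs : uniq (map j s) by rewrite map_inj_uniq //; apply: fmorph_inj.
  have [] := uniq_min_size ujs js; first by rewrite size_map.
  by move=> _ /(_ y); rewrite -sE ry => /mapP [x _ ->]; exists x.
have [h hj] := choice surj.
by exists h => // x; apply: (fmorph_inj j); rewrite hj.
Qed.

(** For each [z] of which [x] is a polynomial, [tt z] is chosen to be a conjugate that changes the
    value of the polynomial. Any embedding glued from such choices moves [x]. *)
Lemma galois_fixed x : (forall s : Gal iota, Gal_fun s x = x) -> exists a, x = iota a.
Proof.
move=> fixx; apply: contrapT => xF; have [algK sepK _] := galK.
pose P z z' := (exists q : {poly F}, [/\ irreducible_poly q, root q^iota z & root q^iota z'])
  /\ forall g : {poly F}, g^iota.[z] = x -> g^iota.[z'] <> x.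
have exP z : exists z', P z z'.
  have [[g gz]|ng] := pselect (exists g : {poly F}, g^iota.[z] = x).
    have [q [z' [irq rq rq' nx]]] := conjugate_moves xF gz.
    exists z'; split; first by exists q.
    move=> h hz; rewrite (@irreducible_eval_eq q h g _ iota z z') //.
    by rewrite hz gz.
  have [q [irq rq _]] := sepK z; exists z; split; first by exists q.
  by move=> g gz; case: ng; exists g.
have [tt tP] := choice exP.
have [j [jF jx]] := @embedding_exists _ _ iota charF algK _ iota tt (fun z => (tP z).1).
have [z [g [gz jxe]]] := jx x.
apply: (tP z).2 gz _; rewrite -jxe.
exact: (fixx (Gal_mk (galois_endo_aut jF))).
Qed.

End GaloisTheory.

Lemma odd_torsion_double (V : zmodType) (x : V) n : odd n -> x *+ n = 0 -> x + x = 0 -> x = 0.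
Proof.
move=> od xn xx; move: xn; rewrite -[n]odd_double_half od -mul2n mulrnDr mulr1n mulrnA.
by rewrite mulr2n xx mul0rn addr0.
Qed.

Lemma odd_prime_double_Zp (p n : nat) (a : 'Z_(p ^ n.+1)) : prime p -> odd p -> a + a = 0 -> a = 0.
Proof.
move=> pp op aa.
have p1 : (1 < p ^ n.+1)%N by rewrite -{1}(expn0 p) ltn_exp2l ?prime_gt1.
have ap : a *+ (p ^ n.+1) = 0.
  by rewrite -mulr_natr pchar_Zp // mulr0.
have od : odd (p ^ n.+1) by rewrite oddX op orbT.
exact: odd_torsion_double od ap aa.
Qed.

Section ZpExtension.
Variables (p : nat) (K : fieldType) (iota : {rmorphism rat -> K}).
Hypothesis p_prime : prime p.
Hypothesis p_odd : odd p.
Hypothesis KZp : is_Zp_extension p iota.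

Let charQ : [pchar rat] =i pred0.
Proof. exact: Num.Theory.pchar_num. Qed.

Lemma is_padic_one : is_padic_int (fun n => 1 : 'Z_(p ^ n.+1)).
Proof. by move=> n /=; rewrite modn_small. Qed.

Let one : padic_int p := padic_mk is_padic_one.

Lemma padic_projMn (a : padic_int p) k n : padic_proj (a *+ k) n = padic_proj a n *+ k.
Proof. by elim: k => // k IH; rewrite !mulrS -IH. Qed.

Lemma padic_proj_le (a : padic_int p) i n : (i <= n)%N ->
  (padic_proj a n : nat)%:R = padic_proj a i :> 'Z_(p ^ i.+1).
Proof.
move=> /subnK <-; elim: (n - i)%N => [|k IH]; first by rewrite add0n natr_Zp.
rewrite -IH addSn; have := padicP a (k + i); rewrite -[RHS]natr_Zp.
move: (nat_of_ord (padic_proj a (k + i).+1)) (nat_of_ord (padic_proj a (k + i))) => u w.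
elim: k {IH} => // k IH.
by rewrite addSn => /padic_natr_eq.
Qed.

(** [g] corresponds to the [p]-adic integer 1. The powers of [p] tend to 0, hence the finite orbits
    of [p]-power length; the natural numbers are dense, so what [g] fixes is fixed by the whole
    group; and [p ^ n] is not 0, so no power [p ^ n] of [g] is trivial. *)
Lemma Zp_extension_generator : exists (g : {rmorphism K -> K}) (j : {rmorphism K -> algC}),
  [/\ forall x, exists n, iter (p ^ n) g x = x,
      forall x, g x = x -> exists a, x = iota a,
      forall a, g (iota a) = iota a,
      forall n, exists x, iter (p ^ n) g x != x
    & forall x, j x \is Num.real].
Proof.
have [galK [f [h [fM fK hK _ hc]]]] := KZp.
have f1 : f 1%g = 0.
  by have := fM 1%g 1%g; rewrite mul1g => /esym/eqP; rewrite -subr_eq0 addrK => /eqP.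
have h0 : h 0 = 1%g by rewrite -f1 fK.
have hD a b : h (a + b) = (h a * h b)%g.
  by apply: (can_inj fK); rewrite fM !hK.
pose g := Gal_fun (h one).
have hone k x : Gal_fun (h (one *+ k)) x = iter k g x.
  elim: k x => [|k IH] x; first by rewrite mulr0n h0.
  by rewrite mulrS hD /= -IH.
have [gB gM _ gF] := GalP (h one).
pose gz := GRing.isZmodMorphism.Build _ _ g gB.
pose gm := GRing.isMonoidMorphism.Build _ _ g gM.
pose gr : {rmorphism K -> K} := HB.pack g gz gm.
have p_gt1 n : (1 < p ^ n.+1)%N by rewrite -{1}(expn0 p) ltn_exp2l ?prime_gt1.
have [algK sepK norK] := galK.
have jex (z : K) : exists z' : algC, exists q : {poly rat},
    [/\ irreducible_poly q, root (map_poly iota q) z & root (map_poly (ratr : rat -> algC) q) z'].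
  have [q [irq rq _]] := sepK z.
  have /closed_rootP [z' rz'] : size (map_poly (ratr : rat -> algC) q) != 1.
    by rewrite size_map_poly; have := irq.1; case: (size q) => [|[]].
  by exists z', q.
have [tt ttP] := choice jex.
have [j [jF jx]] := @embedding_exists _ _ iota charQ algK _ (ratr : {rmorphism rat -> algC}) tt ttP.
exists gr, j; split=> //.
- move=> x; have [|n hn] := @padic_seq_eval _ _ _ _ _ hc (fun n => one *+ (p ^ n.+1)) 0 x; last first.
    by exists n.+1; move: hn; rewrite hone h0; exact.
  move=> n i iln; rewrite padic_projMn.
  have -> : (p ^ n.+1 = p ^ i.+1 * p ^ (n - i))%N by rewrite -expnD addSn subnKC.
  by rewrite mulrnA -[1 *+ _]/((p ^ i.+1)%:R) pchar_Zp // mul0rn.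
- move=> x gx; apply: (galois_fixed charQ galK) => s.
  rewrite -(fK s).
  have [|n <-] := @padic_seq_eval _ _ _ _ _ hc (fun n => one *+ (padic_proj (f s) n)) (f s) x; last first.
    by rewrite hone; elim: (nat_of_ord _) => //= k ->.
  by move=> n i iln; rewrite padic_projMn -[1 *+ _]/(_%:R) padic_proj_le.
- move=> n; apply: contrapT => nx.
  have e : h (one *+ (p ^ n)) = h 0.
    rewrite h0; apply: Gal_ext => x; rewrite hone.
    by apply: contrapT => /eqP ne; apply: nx; exists x.
  have := congr1 (fun a => padic_proj a n) (can_inj hK e).
  rewrite padic_projMn /= -[1 *+ _]/((p ^ n)%:R) => /(congr1 val) /=.
  rewrite val_Zp_nat //= modn_small; last by rewrite ltn_exp2l ?prime_gt1.
  by move/eqP; rewrite expn_eq0; case: p p_prime => [|[]].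
- move=> x.
  (* By normality the polynomial of [y] splits in the image of [j], so complex conjugation restricts
     to an involution [s] of [K]; it is trivial because [p] is odd. *)
  have sex (y : K) : exists y', (j y)^* = j y'.
    have [q [irq rq _]] := sepK y; have [s eqs] := norK q y irq rq.
    have rj : root (map_poly j (map_poly iota q)) (j y)^*.
      have -> : map_poly j (map_poly iota q) = map_poly Num.conj (map_poly j (map_poly iota q)).
        rewrite -!map_poly_comp; apply: eq_map_poly => a /=.
        by rewrite jF fmorph_rat.
      by apply: rmorph_root; apply: rmorph_root.
    have := eqs; rewrite -(eqp_map j) => /eqp_root /(_ (j y)^*); rewrite rj.
    rewrite rmorph_prod /= (eq_bigr (fun z => 'X - (j z)%:P)); last first.
      by move=> z _; rewrite rmorphB /= map_polyX map_polyC.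
    rewrite -(big_map j xpredT (fun z => 'X - z%:P)) root_prod_XsubC.
    by move=> /esym /mapP [y' _ e]; exists y'.
  have [s hs] := choice sex.
  have sB : zmod_morphism s by move=> a b; apply: (fmorph_inj j); rewrite rmorphB -!hs !rmorphB.
  have sM : monoid_morphism s.
    split; first by apply: (fmorph_inj j); rewrite -hs !rmorph1.
    by move=> a b; apply: (fmorph_inj j); rewrite rmorphM -!hs !rmorphM.
  have sK : involutive s by move=> a; apply: (fmorph_inj j); rewrite -!hs conjCK.
  have sa : is_aut iota s.
    split=> //; first by exists s.
    by move=> a; apply: (fmorph_inj j); rewrite -hs jF fmorph_rat.
  have s2 : (Gal_mk sa * Gal_mk sa)%g = 1%g by apply: Gal_ext => a; apply: sK.
  have fs : f (Gal_mk sa) = 0.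
    have := fM (Gal_mk sa) (Gal_mk sa); rewrite s2 f1 => e.
    apply: padic_ext => n; apply: (@odd_prime_double_Zp p n) => //.
    by have := congr1 (fun a => padic_proj a n) e.
  have : Gal_mk sa = 1%g by apply: (can_inj fK); rewrite fs f1.
  move=> /(congr1 (fun t => Gal_fun t x)) /= sx.
  have {}sx : s x = x := sx.
  by apply/CrealP; rewrite hs sx.
Qed.

End ZpExtension.

(** * The inertia ideal *)

Section Iterates.
Variables (K : comNzRingType) (g : {rmorphism K -> K}).

Fixpoint gpow n : {rmorphism K -> K} :=
  if n is n'.+1 then GRing.RMorphism.clone K K (g \o gpow n') _ else GRing.RMorphism.clone K K idfun _.

Lemma gpowE n x : gpow n x = iter n g x.
Proof. by elim: n => //= n ->. Qed.

Lemma gpowD m n x : gpow (m + n)%N x = gpow m (gpow n x).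
Proof. by rewrite !gpowE iterD. Qed.

Lemma gpowS n x : gpow n.+1 x = g (gpow n x). Proof. by []. Qed.

Lemma gpowM_fixed q k x : gpow q x = x -> gpow (q * k)%N x = x.
Proof. by move=> h; elim: k => [|k IH]; rewrite ?muln0 // mulnS gpowD IH. Qed.

Lemma gpow_mod q k x : gpow q x = x -> gpow k x = gpow (k %% q)%N x.
Proof.
by move=> h; rewrite [in LHS](divn_eq k q) addnC gpowD mulnC gpowM_fixed.
Qed.

Lemma gpow_comm m n x : gpow m (gpow n x) = gpow n (gpow m x).
Proof. by rewrite -!gpowD addnC. Qed.

Lemma gpow_coprime_fixed m n x : coprime m n -> gpow m x = x -> gpow n x = x -> g x = x.
Proof.
case: m => [|m].
  by rewrite /coprime gcd0n => /eqP ->.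
move=> co hm hn.
have [[u v] /= /eqP e] := coprimeP n (ltn0Sn m) co.
have {}e : (m.+1 * u = n * v + 1)%N by move: e; lia.
by have := gpowM_fixed u hm; rewrite e addnC gpowD (gpowM_fixed v hn).
Qed.

End Iterates.

(** * Integral tensors as functions on the Galois group *)

Section Representable.
Variables (K : comNzRingType) (g : {rmorphism K -> K}) (O : K -> Prop).
Hypotheses (O1 : O 1) (OB : forall x y, O x -> O y -> O (x - y)).
Hypotheses (OM : forall x y, O x -> O y -> O (x * y)) (Og : forall x, O x -> O (g x)).
Local Notation gp := (gpow g).

Let O0 : O 0. Proof. by rewrite -(subrr 1); apply: OB. Qed.
Let ON x : O x -> O (- x). Proof. by move=> h; rewrite -sub0r; apply: OB. Qed.
Let OD x y : O x -> O y -> O (x + y).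
Proof. by move=> hx hy; rewrite -[y]opprK; apply: OB => //; apply: ON. Qed.
Let Ogp n x : O x -> O (gp n x).
Proof. by move=> h; elim: n => //= n IH; apply: Og. Qed.

(* The functions [j |-> sum_i x_i g^j(y_i)] with [x_i] and [y_i] integral and
   [g^q(y_i) = y_i]: the image in the functions on the Galois group of the
   tensor square of the ring of integers. *)
Definition rep q (phi : nat -> K) : Prop := exists s : seq (K * K),
  {in s, forall u, [/\ O u.1, O u.2 & gp q u.2 = u.2]} /\
  forall j, phi j = \sum_(u <- s) u.1 * gp j u.2.

Lemma rep_pure q x y : O x -> O y -> gp q y = y -> rep q (fun j => x * gp j y).
Proof.
move=> Ox Oy fy; exists [:: (x, y)]; split=> [u|j]; last by rewrite big_seq1.
by rewrite inE => /eqP->.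
Qed.

Lemma rep_ext q phi psi : phi =1 psi -> rep q phi -> rep q psi.
Proof. by move=> e [s [h1 h2]]; exists s; split=> // j; rewrite -e h2. Qed.

Lemma rep_const q x : O x -> rep q (fun=> x).
Proof.
move=> Ox; apply: rep_ext (rep_pure Ox O1 (rmorph1 _)) => j.
by rewrite rmorph1 mulr1.
Qed.

Lemma repD q phi psi : rep q phi -> rep q psi -> rep q (fun j => phi j + psi j).
Proof.
move=> [s [h1 h2]] [t [h3 h4]]; exists (s ++ t); split=> [u|j].
  by rewrite mem_cat => /orP[/h1|/h3].
by rewrite big_cat h2 h4.
Qed.

Lemma repM q phi psi : rep q phi -> rep q psi -> rep q (fun j => phi j * psi j).
Proof.
move=> [s [h1 h2]] [t [h3 h4]].
exists [seq (u.1 * w.1, u.2 * w.2) | u <- s, w <- t]; split=> [u|j].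
  move=> /allpairsP [[u1 u2] /= [/h1 [a1 a2 a3] /h3 [b1 b2 b3] ->]] /=.
  by split; rewrite ?rmorphM ?a3 ?b3 //; apply: OM.
rewrite h2 h4 big_allpairs_dep mulr_suml; apply: eq_bigr => u _.
rewrite mulr_sumr; apply: eq_bigr => w _ /=.
by rewrite rmorphM mulrACA.
Qed.

Lemma repB q phi psi : rep q phi -> rep q psi -> rep q (fun j => phi j - psi j).
Proof.
move=> h1 h2; apply: rep_ext (repD h1 (repM (rep_const q (ON O1)) h2)) => j.
by rewrite mulN1r.
Qed.

Lemma rep_sum q (I : eqType) (r : seq I) (phi : I -> nat -> K) :
  {in r, forall i, rep q (phi i)} -> rep q (fun j => \sum_(i <- r) phi i j).
Proof.
elim: r => [|i r IH] h.
  by apply: rep_ext (rep_const q O0) => j; rewrite big_nil.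
apply: (rep_ext (phi := fun j => phi i j + \sum_(i <- r) phi i j)).
  by move=> j; rewrite big_cons.
apply: repD; first by apply: h; rewrite mem_head.
by apply: IH => k kr; apply: h; rewrite inE kr orbT.
Qed.

Lemma rep_per q phi j : rep q phi -> phi j = phi (j %% q)%N.
Proof.
move=> [s [h1 h2]]; rewrite !h2; apply: eq_big_seq => u /h1 [_ _ h].
by rewrite -gpow_mod.
Qed.

Section Norm.
Variables (p m : nat).

(** Expand the product and collect terms with the same monomial [X mu] in the [x i]. The coefficient
    [z mu] is a sum over all [f] with multiplicities [mu], a set stable under cyclic shift; [gp p]
    acts on the terms by this shift, so [z mu] is fixed by it. *)
Lemma rep_norm phi : rep (p * m)%N phi ->
  rep p (fun j => \prod_(k < m) phi (j + p * k)%N).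
Proof.
move=> [s [h1 h2]]; pose n := size s.
pose x (i : 'I_n) := (tnth (in_tuple s) i).1; pose y i := (tnth (in_tuple s) i).2.
have hs i : [/\ O (x i), O (y i) & gp (p * m)%N (y i) = y i] by apply: h1; apply: mem_tnth.
have phiE j : phi j = \sum_i x i * gp j (y i) by rewrite h2 big_tnth.
pose T (f : {ffun 'I_m -> 'I_n}) : {ffun 'I_n -> 'I_m.+1} := [ffun i => inord #|[pred k | f k == i]|].
pose X (mu : {ffun 'I_n -> 'I_m.+1}) := \prod_i x i ^+ mu i.
pose pr (f : {ffun 'I_m -> 'I_n}) := \prod_(k < m) gp (p * k)%N (y (f k)).
pose z mu := \sum_(f | T f == mu) pr f.
have XT (f : {ffun 'I_m -> 'I_n}) : \prod_k x (f k) = X (T f).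
  rewrite (partition_big f predT) //=; apply: eq_bigr => i _.
  rewrite (eq_bigr (fun=> x i)) => [|k /eqP -> //].
  rewrite prodr_const ffunE inordK // ltnS.
  by apply: leq_trans (max_card _) _; rewrite card_ord.
have norm j : \prod_(k < m) phi (j + p * k)%N = \sum_mu X mu * gp j (z mu).
  rewrite (eq_bigr (fun k : 'I_m => \sum_i x i * gp (j + p * k)%N (y i))); last by move=> k _.
  rewrite bigA_distr_bigA /= (partition_big T predT) //=; apply: eq_bigr => mu _.
  rewrite rmorph_sum mulr_sumr; apply: eq_bigr => f /eqP <-.
  rewrite big_split XT /pr rmorph_prod; congr (_ * _).
  by apply: eq_bigr => k _; rewrite gpowD.
pose sh (f : {ffun 'I_m -> 'I_n}) : {ffun 'I_m -> 'I_n} := [ffun k => f (ord_pred k)].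
have sh_bij : bijective sh.
  exists (fun f : {ffun 'I_m -> 'I_n} => [ffun k => f (ordS k)]) => f;
    by apply/ffunP => k; rewrite !ffunE ?ordSK ?ord_predK.
have Tsh f : T (sh f) = T f.
  apply/ffunP => i; rewrite !ffunE; congr (inord _).
  rewrite -[RHS](fintype.card_image (@ordS_inj m)); apply: eq_card => k; rewrite [LHS]inE /sh ffunE.
  apply/idP/fintype.imageP => [e|[k' e ->]]; last by rewrite ordSK.
  by exists (ord_pred k); rewrite ?ord_predK.
have zfix mu : gp p (z mu) = z mu.
  rewrite /z rmorph_sum [RHS](reindex sh) /=; last exact: onW_bij.
  apply: eq_big => [f|f _]; first by rewrite Tsh.
  rewrite /pr rmorph_prod [RHS](reindex_inj (@ordS_inj m)); apply: eq_bigr => k _.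
  rewrite ffunE ordSK -gpowD /= -mulnS.
  have [_ _ hy] := hs (f k).
  by rewrite [LHS](gpow_mod _ hy) [RHS](gpow_mod _ hy) muln_modr modn_mod.
have Oprod (I : finType) (P : pred I) (F : I -> K) : (forall i, P i -> O (F i)) -> O (\prod_(i | P i) F i).
  by move=> h; apply: big_ind.
have Osum (I : finType) (P : pred I) (F : I -> K) : (forall i, P i -> O (F i)) -> O (\sum_(i | P i) F i).
  by move=> h; apply: big_ind.
apply: (rep_ext (phi := fun j => \sum_(mu <- index_enum {ffun 'I_n -> 'I_m.+1}) X mu * gp j (z mu))).
  by move=> j; rewrite norm.
apply: rep_sum => mu _; apply: rep_pure (zfix mu).
  apply: Oprod => i _; have [Ox _ _] := hs i.
  by elim: (nat_of_ord _) => // k IH; rewrite exprS; apply: OM.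
apply: Osum => f _; apply: Oprod => k _; apply: Ogp.
by have [] := hs (f k).
Qed.

End Norm.

(* If the elements [x - g(x)] generate the unit ideal, the fixed ring of [g^p] is
   a Galois extension of the fixed ring of [g] in the sense of rings. *)
Lemma galois_idempotent p (s : seq (K * K)) : prime p ->
  (forall x, exists n, gp (p ^ n)%N x = x) ->
  {in s, forall u, O u.1 /\ O u.2} -> \sum_(u <- s) u.1 * (u.2 - g u.2) = 1 ->
  exists phi, [/\ rep p phi, phi 0%N = 1 & forall j, ~~ (p %| j)%N -> phi j = 0].
Proof.
move=> pp per hs s1.
have [N hN] : exists N, {in s, forall u, gp (p ^ N.+1)%N u.2 = u.2}.
  elim: s {hs s1} => [|u s [N IH]]; first by exists 0%N.
  have [n hn] := per u.2; exists (n + N)%N => w; rewrite inE => /orP[/eqP->|/IH].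
    by rewrite -addnS expnD gpowM_fixed.
  by rewrite -addnS expnD mulnC; apply: gpowM_fixed.
set q := (p ^ N.+1)%N in hN.
have q_gt1 : (1 < q)%N by rewrite /q -{1}(expn0 p) ltn_exp2l ?prime_gt1.
(* With [k * t] congruent to 1 modulo [q], the difference [u.2 - g u.2] telescopes into differences
   under [gp k]. Replacing the first term of each by its image under [gp j] gives a function equal
   to 1 at 0 and 0 at [k]. *)
have hes k : ~~ (p %| k)%N -> exists e, [/\ rep q e, e 0%N = 1 & e k = 0].
  move=> pk; have k_gt0 : (0 < k)%N by case: k pk => //; rewrite dvdn0.
  have co : coprime k q by rewrite coprimeXr // coprime_sym prime_coprime.
  have [[t w] /= /eqP kt] := coprimeP q k_gt0 co.
  have {}kt : (k * t = q * w + 1)%N by move: kt; lia.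
  pose e j := \sum_(u <- s) \sum_(i <- iota 0 t)
    u.1 * (gp j (gp (k * i)%N u.2) - gp k (gp (k * i)%N u.2)).
  exists e; split.
  - apply: rep_sum => u us; apply: rep_sum => i _.
    have [Ou1 Ou2] := hs u us; have fu := hN u us.
    apply: repM; first exact: rep_const.
    apply: repB; last by apply: rep_const; do 2!apply: Ogp.
    apply: (rep_ext (phi := fun j => 1 * gp j (gp (k * i)%N u.2))); first by move=> j; rewrite mul1r.
    by apply: rep_pure => //; [apply: Ogp | rewrite gpow_comm fu].
  - rewrite -s1 /e; apply: eq_big_seq => u us.
    rewrite -big_distrr /=; congr (_ * _).
    transitivity (\sum_(0 <= i < t) - (gp (k * i.+1)%N u.2 - gp (k * i)%N u.2)).
      rewrite /index_iota subn0; apply: eq_bigr => i _.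
      by rewrite opprB -gpowD mulnS.
    rewrite sumrN (telescope_sumr (fun i => gp (k * i)%N u.2)) // opprB muln0 /=; congr (_ - _).
    by rewrite kt addnC gpowD (gpowM_fixed w (hN u us)).
  - by rewrite /e big1 // => u _; rewrite big1 // => i _; rewrite subrr mulr0.
have [e0 [re0 e00 e0n]] : exists e, [/\ rep q e, e 0%N = 1 & forall j, ~~ (p %| j)%N -> e j = 0].
  suff H b : exists e, [/\ rep q e, e 0%N = 1 & forall j, (j < b)%N -> ~~ (p %| j)%N -> e j = 0].
    have [e [re e0 en]] := H q; exists e; split=> // j pj; rewrite (rep_per _ re) en ?ltn_mod ?(ltnW q_gt1) //.
    by rewrite /dvdn modn_dvdm // /q expnS dvdn_mulr.
  elim: b => [|b [e [re e0 en]]]; first by exists (fun=> 1); split=> //; apply: rep_const.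
  have [pb|pb] := boolP (p %| b)%N.
    exists e; split=> // j; rewrite ltnS leq_eqVlt => /orP[/eqP->|]; last exact: en.
    by rewrite pb.
  have [e' [re' e'0 e'b]] := hes b pb.
  exists (fun j => e j * e' j); split; [exact: repM | by rewrite e0 e'0 mulr1 |].
  move=> j; rewrite ltnS leq_eqVlt => /orP[/eqP->|jb pj]; first by rewrite e'b mulr0.
  by rewrite en // mul0r.
pose m := (p ^ N)%N; have m_gt0 : (0 < m)%N by rewrite expn_gt0 prime_gt0.
(* The norm of [1 - e0] has period [p]; it vanishes at 0, where its factor of index 0 does, and is 1
   away from the multiples of [p]. *)
exists (fun j => 1 - \prod_(k < m) (1 - e0 (j + p * k)%N)); split.
- apply: repB; first exact: rep_const.
  apply: (@rep_norm p m (fun j => 1 - e0 j)); rewrite /m -expnS; apply: repB => //; by apply: rep_const.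
- by rewrite (bigD1 (Ordinal m_gt0)) //= muln0 addn0 e00 subrr mul0r subr0.
- move=> j pj; rewrite big1 ?subrr // => k _.
  by rewrite e0n ?subr0 // dvdn_addl // dvdn_mulr.
Qed.

End Representable.

Section Integers.
Variables (K : fieldType) (iota : {rmorphism rat -> K}).

Definition algint (x : K) : Prop := integralOver (intr : int -> K) x.

Lemma algint_int (n : int) : algint n%:~R.
Proof. exact: (integral_id (intr : {rmorphism int -> K})). Qed.
Lemma algint1 : algint 1. Proof. exact: (algint_int 1). Qed.
Lemma algintB x y : algint x -> algint y -> algint (x - y).
Proof. exact: (@integral_sub _ _ (intr : {rmorphism int -> K})). Qed.
Lemma algintD x y : algint x -> algint y -> algint (x + y).
Proof. exact: (@integral_add _ _ (intr : {rmorphism int -> K})). Qed.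
Lemma algintM x y : algint x -> algint y -> algint (x * y).
Proof. exact: (@integral_mul _ _ (intr : {rmorphism int -> K})). Qed.

Lemma algint_sum (I : Type) (r : seq I) (P : pred I) (f : I -> K) :
  (forall i, P i -> algint (f i)) -> algint (\sum_(i <- r | P i) f i).
Proof. by move=> h; apply: big_ind => //; [exact: (algint_int 0) | exact: algintD]. Qed.

Lemma algint_prod (I : Type) (r : seq I) (P : pred I) (f : I -> K) :
  (forall i, P i -> algint (f i)) -> algint (\prod_(i <- r | P i) f i).
Proof. by move=> h; apply: big_ind => //; [exact: algint1 | exact: algintM]. Qed.

Lemma algint_morph (g : {rmorphism K -> K}) x : algint x -> algint (g x).
Proof.
move=> [q mq rq]; exists q => //; have := rmorph_root g rq; rewrite -map_poly_comp.
by congr root; apply: eq_map_poly => a /=; rewrite rmorph_int.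
Qed.

Lemma algint_rat (a : rat) : algint (iota a) -> exists z : int, a = z%:~R.
Proof.
move=> [q mq rq].
have rr : root (map_poly (intr : int -> rat) q) a.
  rewrite -(fmorph_root iota) -map_poly_comp.
  by congr root: rq; apply: eq_map_poly => b /=; rewrite rmorph_int.
have : ratr a \in Aint.
  apply: (@root_monic_Aint (map_poly intr q)).
  - have := rmorph_root (ratr : {rmorphism rat -> algC}) rr; rewrite -map_poly_comp.
    by congr root; apply: eq_map_poly => b /=; rewrite rmorph_int.
  - exact: monic_map.
  - by apply/polyOverP => i; rewrite coef_map /= intr_int.
move=> /(Cint_rat_Aint (Crat_rat a)) /intrP [z e]; exists z.
have e' : ratr a = ratr z%:~R :> algC by rewrite e rmorph_int.
exact: (fmorph_inj (ratr : {rmorphism rat -> algC}) e').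
Qed.

End Integers.

(** * The trace form on the integers of the first layer *)

Section Minkowski.
Variables (p : nat) (K : fieldType) (iota : {rmorphism rat -> K}).
Variables (g : {rmorphism K -> K}) (j : {rmorphism K -> algC}).
Hypotheses (p_prime : prime p) (p_ge11 : (11 <= p)%N).
Hypothesis g_per : forall x, exists n, gpow g (p ^ n) x = x.
Hypothesis g_fix : forall x, g x = x -> exists a, x = iota a.
Hypothesis gQ : forall a, g (iota a) = iota a.
Hypothesis j_real : forall x, j x \is Num.real.
Local Notation gp := (gpow g).
Local Notation O := (@algint K).

Let p_gt0 : (0 < p)%N. Proof. exact: prime_gt0. Qed.
Let i0 : 'I_p := Ordinal p_gt0.

Definition int1 x := O x /\ gp p x = x.
Definition tr x := \sum_(i < p) gp i x.

Let gpQ n a : gp n (iota a) = iota a.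
Proof. by rewrite gpowE; elim: n => //= n ->. Qed.

Lemma algint_gpow n x : O x -> O (gp n x).
Proof. by move=> h; elim: n => //= n IH; apply: algint_morph. Qed.

Lemma gpow_sum_fixed x : gp p x = x -> g (tr x) = tr x.
Proof.
move=> fx; rewrite /tr rmorph_sum; apply: (addrI x).
transitivity (\sum_(i < p.+1) gp i x); first by rewrite big_ord_recl.
by rewrite big_ord_recr /= fx addrC.
Qed.

Lemma gpow_prod_fixed x : x != 0 -> gp p x = x -> g (\prod_(i < p) gp i x) = \prod_(i < p) gp i x.
Proof.
move=> x0 fx; rewrite rmorph_prod; apply: (mulfI x0).
transitivity (\prod_(i < p.+1) gp i x); first by rewrite big_ord_recl.
by rewrite big_ord_recr /= fx mulrC.
Qed.

Lemma tr_int x : int1 x -> exists z : int, tr x = z%:~R.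
Proof.
move=> [Ox fx]; have [a ea] := g_fix (gpow_sum_fixed fx).
have : O (iota a) by rewrite -ea; apply: algint_sum => i _; apply: algint_gpow.
by move=> /algint_rat [z ez]; exists z; rewrite ea ez rmorph_int.
Qed.

Variable s : seq (K * K).
Hypothesis sP : {in s, forall u, [/\ O u.1, O u.2 & gp p u.2 = u.2]}.
Hypothesis s1 : \sum_(u <- s) u.1 * u.2 = 1.
Hypothesis s0 : forall k, ~~ (p %| k)%N -> \sum_(u <- s) u.1 * gp k u.2 = 0.

(** By [s1] and [s0] the pairs in [s] behave as dual bases for the trace:
    [x = \sum_(u <- s) u.1 * tr (x * u.2)]. Thus the integers are their own trace dual, the mark of
    an unramified extension. *)
Lemma tr_selfdual x : gp p x = x -> (forall y, int1 y -> O (tr (x * y))) -> O x.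
Proof.
move=> fx h.
have -> : x = \sum_(u <- s) u.1 * tr (x * u.2).
  transitivity (\sum_(i < p) gp i x * \sum_(u <- s) u.1 * gp i u.2).
    rewrite (bigD1 i0) //= s1 mulr1 big1 ?addr0 // => i ni.
    rewrite s0 ?mulr0 //; apply/negP => /dvdn_leq; rewrite lt0n leqNgt ltn_ord => H.
    by have := H ni.
  transitivity (\sum_(i < p) \sum_(u <- s) u.1 * gp i (x * u.2)).
    apply: eq_bigr => i _; rewrite mulr_sumr; apply: eq_bigr => u _.
    by rewrite rmorphM mulrCA.
  by rewrite exchange_big; apply: eq_bigr => u _; rewrite mulr_sumr.
rewrite big_seq; apply: algint_sum => u us; have [Ou1 Ou2 fu] := sP us.
by apply: algintM => //; apply: h.
Qed.

Lemma int1_moved : exists2 t, int1 t & g t != t.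
Proof.
apply: contrapT => h; have /eqP[] := oner_neq0 K.
rewrite -s1 -[RHS](s0 (k := 1)); last by rewrite dvdn1 neq_ltn prime_gt1 // orbT.
apply: eq_big_seq => u us; have [Ou1 Ou2 fu] := sP us.
congr (_ * _); apply/eqP; rewrite eq_sym; apply/negPn/negP => gt; apply: h.
by exists u.2.
Qed.

Definition emb (b : 'I_p -> K) : 'M[K]_p := \matrix_(i, k) gp k (b i).

(** Only independence and integrality are required; such a family generates all the integers once
    its discriminant [\det S] is minimal in absolute value. *)
Definition lattice_basis (b : 'I_p -> K) (S : 'M[int]_p) : Prop :=
  [/\ forall i, int1 (b i), emb b *m (emb b)^T = map_mx intr S & \det (emb b) != 0].

Lemma gram_tr b i k : (emb b *m (emb b)^T) i k = tr (b i * b k).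
Proof. by rewrite !mxE; apply: eq_bigr => l _; rewrite !mxE rmorphM. Qed.

Lemma int1M x y : int1 x -> int1 y -> int1 (x * y).
Proof. by move=> [Ox fx] [Oy fy]; split; [exact: algintM | rewrite rmorphM fx fy]. Qed.

Lemma gram_exists b : (forall i, int1 (b i)) -> exists S : 'M[int]_p, emb b *m (emb b)^T = map_mx intr S.
Proof.
move=> hb; have h i k := tr_int (int1M (hb i) (hb k)).
have h' i : exists f : 'I_p -> int, forall k, tr (b i * b k) = (f k)%:~R.
  by have [f hf] := choice (h i); exists f.
have [f hf] := choice h'.
by exists (\matrix_(i, k) f i k); apply/matrixP => i k; rewrite gram_tr hf !mxE.
Qed.

Lemma lattice_basis_exists : exists b S, lattice_basis b S.
Proof.
have [t [Ot ft] gt] := int1_moved.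
pose b (i : 'I_p) := t ^+ i.
have hb i : int1 (b i).
  split; last by rewrite rmorphXn ft.
  by rewrite /b; elim: (nat_of_ord i) => [|k IH]; [exact: algint1 | rewrite exprS; apply: algintM].
have [S hS] := gram_exists hb; exists b, S; split=> //.
have -> : emb b = Vandermonde p (\row_k gp k t).
  by apply/matrixP => i k; rewrite !mxE /b rmorphXn.
rewrite det_Vandermonde; apply/prodf_neq0 => i _; apply/prodf_neq0 => k ik.
rewrite !mxE subr_eq0; apply/eqP => e.
have h : gp (k - i) t = t.
  apply: (fmorph_inj (gp i)); rewrite -gpowD subnKC ?(ltnW ik) //.
case/eqP: gt; apply: (gpow_coprime_fixed _ ft h).
rewrite prime_coprime //; apply/negP => /dvdn_leq; rewrite subn_gt0 ik => /(_ isT).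
by rewrite leqNgt (leq_ltn_trans (leq_subr _ _)).
Qed.

Lemma minimal_basis : exists b S, lattice_basis b S /\
  forall b' S', lattice_basis b' S' -> (`|\det S| <= `|\det S'|)%N.
Proof.
have [b0 [S0 h0]] := lattice_basis_exists.
have ex : exists n, `[< exists b S, lattice_basis b S /\ `|\det S|%N = n >].
  by exists `|\det S0|%N; apply/asboolP; exists b0, S0.
case: (ex_minnP ex) => n /asboolP [b [S [h <-]]] hmin.
by exists b, S; split=> // b' S' h'; apply: hmin; apply/asboolP; exists b', S'.
Qed.

Variables (b : 'I_p -> K) (S : 'M[int]_p).
Hypothesis bS : lattice_basis b S.
Hypothesis bmin : forall b' S', lattice_basis b' S' -> (`|\det S| <= `|\det S'|)%N.

Let hb : forall i, int1 (b i). Proof. by case: bS. Qed.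
Let hS : emb b *m (emb b)^T = map_mx intr S. Proof. by case: bS. Qed.
Let dB : \det (emb b) != 0. Proof. by case: bS. Qed.
Let uB : emb b \in unitmx. Proof. by rewrite unitmxE unitfE. Qed.

Lemma rowmul_emb (r : 'rV[rat]_p) :
  map_mx iota r *m emb b = \row_k gp k (\sum_i iota (r 0 i) * b i).
Proof.
apply/rowP => k; rewrite !mxE rmorph_sum; apply: eq_bigr => i _.
by rewrite !mxE rmorphM gpQ.
Qed.

Lemma basis_free (r r' : 'rV[rat]_p) :
  \sum_i iota (r 0 i) * b i = \sum_i iota (r' 0 i) * b i -> r = r'.
Proof.
move=> e; have : map_mx iota r *m emb b = map_mx iota r' *m emb b.
  by rewrite !rowmul_emb e.
by move=> /(can_inj (mulmxK uB)) /map_mx_inj.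
Qed.

(** The coordinates solve a linear system over [K] whose columns are permuted cyclically by [g], so
    they are fixed by [g] and hence rational. *)
Lemma basis_coords x : gp p x = x -> exists r : 'rV[rat]_p, x = \sum_i iota (r 0 i) * b i.
Proof.
move=> fx; pose X : 'rV[K]_p := \row_k gp k x; pose q := X *m invmx (emb b).
have qX : q *m emb b = X by rewrite /q mulmxKV.
have qk (k : 'I_p) : \sum_i q 0 i * gp k (b i) = gp k x.
  by have /rowP/(_ k) := qX; rewrite !mxE => <-; apply: eq_bigr => i _; rewrite !mxE.
have gq : map_mx g q = q.
  apply: (can_inj (mulmxK uB)); rewrite qX; apply/rowP => k; rewrite !mxE.
  have [k' [hk hkb]] : exists k' : 'I_p, (forall y, gp p y = y -> gp k y = gp k'.+1 y) /\ True.
    case: k => [[|k] kp]; last by exists (Ordinal (ltnW kp)).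
    have pp : (p.-1 < p)%N by rewrite prednK.
    by exists (Ordinal pp); split=> // y; rewrite /= -gpowS prednK.
  rewrite hk // -[RHS]/(g (gp k' x)) -qk rmorph_sum; apply: eq_bigr => i _.
  by rewrite !mxE hk ?rmorphM //; case: (hb i).
have hq i : exists a, q 0 i = iota a.
  by apply: g_fix; have /rowP/(_ i) := gq; rewrite mxE.
have [r hr] := choice hq; exists (\row_i r i).
by rewrite -[LHS](qk i0); apply: eq_bigr => i _; rewrite hr mxE.
Qed.

Lemma det_replace (b' : 'I_p -> K) (l : 'I_p) (r : 'rV[rat]_p) :
  (forall i, i != l -> b' i = b i) -> b' l = \sum_i iota (r 0 i) * b i ->
  \det (emb b') = iota (r 0 l) * \det (emb b).
Proof.
move=> h1 h2; rewrite (expand_det_row _ l).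
have cof k : cofactor (emb b') l k = cofactor (emb b) l k.
  congr (_ * \det _); apply/matrixP => i k'; rewrite !mxE.
  by rewrite h1 // eq_sym neq_lift.
transitivity ((map_mx iota r *m emb b *m \adj (emb b)) 0 l).
  rewrite rowmul_emb -h2 !mxE; apply: eq_bigr => k _.
  by rewrite cof !mxE.
by rewrite -mulmxA mul_mx_adj mul_mx_scalar !mxE mulrC.
Qed.

(** If coordinate [l] were not an integer, replacing [b l] by [x] with fractional coordinates would
    multiply the discriminant by the square of a number strictly between 0 and 1. *)
Lemma basis_integral x : int1 x -> exists n : 'rV[int]_p, x = \sum_i iota ((n 0 i)%:~R) * b i.
Proof.
move=> ix; have [r er] := basis_coords ix.2.
exists (map_mx Num.floor r); rewrite er.
suff h l : r 0 l = (Num.floor (r 0 l))%:~R.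
  by apply: eq_bigr => i _; rewrite mxE -h.
apply/eqP/negPn/negP => nl.
pose r' := r - map_mx intr (map_mx Num.floor r).
have r'E i : r' 0 i = r 0 i - (Num.floor (r 0 i))%:~R by rewrite !mxE.
have r'01 : 0 < r' 0 l < 1.
  rewrite r'E; have := floor_itv (r 0 l); rewrite rmorphD /= => /andP[h1 h2].
  by rewrite subr_gt0 lt_def nl h1 /= ltrBlDl.
pose x' := \sum_i iota (r' 0 i) * b i.
have ix' : int1 x'.
  split; last by rewrite rmorph_sum; apply: eq_bigr => i _; rewrite rmorphM gpQ; case: (hb i) => _ ->.
  have -> : x' = x - \sum_i (Num.floor (r 0 i))%:~R * b i.
    rewrite er -sumrB; apply: eq_bigr => i _.
    by rewrite r'E rmorphB rmorph_int mulrBl.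
  apply: algintB; first by case: ix.
  apply: algint_sum => i _; apply: algintM; first exact: algint_int.
  by case: (hb i).
pose b' i := if i == l then x' else b i.
have hb' i : int1 (b' i) by rewrite /b'; case: ifP.
have [S' hS'] := gram_exists hb'.
have detb' : \det (emb b') = iota (r' 0 l) * \det (emb b).
  by apply: det_replace => [i /negPf h|]; rewrite /b' ?h ?eqxx.
have r'0 : r' 0 l != 0 by case/andP: r'01 => /lt0r_neq0.
have lb' : lattice_basis b' S'.
  by split=> //; rewrite detb' mulf_neq0 ?fmorph_eq0.
have detS' : (\det S')%:~R = r' 0 l ^+ 2 * (\det S)%:~R :> rat.
  apply: (fmorph_inj iota); rewrite rmorphM rmorphXn !rmorph_int -!det_map_mx -hS -hS'.
  by rewrite !det_mulmx !det_tr detb'; ring.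
have := bmin lb'; rewrite leqNgt => /negP[].
have dS : \det S != 0.
  have : (\det S)%:~R != 0 :> K.
    by rewrite -det_map_mx -hS det_mulmx det_tr mulf_neq0.
  by apply: contraNneq => ->; rewrite rmorph0.
rewrite -ltz_nat !abszE -(ltr_int rat) !intr_norm detS' normrM.
rewrite gtr_pMl ?normr_gt0 ?intr_eq0 //.
case/andP: r'01 => h1 h2; rewrite ger0_norm ?sqr_ge0 // expr2.
by apply: mulr_ilt1 => //; apply: ltW.
Qed.

Let el (r : 'rV[rat]_p) : K := \sum_i iota (r 0 i) * b i.
Let SQ : 'M[rat]_p := map_mx intr S.

Lemma tr_basis (r r' : 'rV[rat]_p) : tr (el r * el r') = iota ((r *m SQ *m r'^T) 0 0).
Proof.
transitivity (((map_mx iota r *m emb b) *m (map_mx iota r' *m emb b)^T) 0 0).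
  by rewrite !rowmul_emb mxE; apply: eq_bigr => k _; rewrite !mxE rmorphM.
rewrite trmx_mul mulmxA -[_ *m emb b *m _]mulmxA hS.
transitivity (map_mx iota (r *m SQ *m r'^T) 0 0); last by rewrite mxE.
congr (fun_of_matrix _ 0 0); rewrite !map_mxM map_trmx; congr (_ *m _ *m _).
by apply/matrixP => i k; rewrite !mxE rmorph_int.
Qed.

Lemma el_fixed r : gp p (el r) = el r.
Proof.
by rewrite rmorph_sum; apply: eq_bigr => i _; rewrite rmorphM gpQ; case: (hb i) => _ ->.
Qed.

Let SQ_unit : SQ \in unitmx.
Proof.
rewrite unitmxE unitfE -(fmorph_eq0 iota) -det_map_mx.
have -> : map_mx iota SQ = emb b *m (emb b)^T.
  by rewrite hS; apply/matrixP => i k; rewrite !mxE rmorph_int.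
by rewrite det_mulmx det_tr mulf_neq0.
Qed.

(** The rows of [invmx SQ] are the coordinates of the dual basis, which is integral by
    [tr_selfdual]; so the inverse Gram matrix has integer entries. *)
Lemma gram_unimodular : exists n : int, \det S * n = 1.
Proof.
pose R := invmx SQ.
have hR i : exists n : 'rV[int]_p, row i R = map_mx intr n.
  have ix : int1 (el (row i R)).
    split; last exact: el_fixed.
    apply: tr_selfdual; first exact: el_fixed.
    move=> y iy; have [n en] := basis_integral iy.
    have -> : y = el (map_mx intr n) by rewrite en; apply: eq_bigr => k _; rewrite mxE.
    rewrite tr_basis -row_mul mulVmx // row1 -rowE !mxE rmorph_int.
    exact: algint_int.
  have [n en] := basis_integral ix; exists n; apply: basis_free.
  by rewrite -[LHS]/(el _) en; apply: eq_bigr => k _; rewrite mxE.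
have [N hN] := choice hR; exists (\det (\matrix_i N i)).
apply: (@intr_inj rat); rewrite rmorphM rmorph1 /= -!det_map_mx -/SQ.
have -> : map_mx intr (\matrix_i N i) = R.
  by apply/row_matrixP => i; rewrite hN; apply/rowP => k; rewrite !mxE.
by rewrite -det_mulmx mulmxV // det1.
Qed.

Lemma SQ_sym : SQ^T = SQ.
Proof.
apply/matrixP => i k; rewrite !mxE; apply: (fmorph_inj iota); rewrite !rmorph_int.
have /matrixP h := hS; have := h i k; have := h k i; rewrite !gram_tr !mxE => <- <-.
by rewrite mulrC.
Qed.

Let j_rat a : j (iota a) = ratr a.
Proof. exact: (fmorph_eq_rat (j \o iota)). Qed.

Lemma tr_sq (r : 'rV[rat]_p) : ratr ((r *m SQ *m r^T) 0 0) = \sum_(k < p) j (gp k (el r)) ^+ 2 :> algC.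
Proof.
rewrite -j_rat -tr_basis rmorph_sum; apply: eq_bigr => k _.
by rewrite -expr2 !rmorphXn.
Qed.

Lemma SQ_posdef (r : 'rV[rat]_p) : r != 0 -> 0 < (r *m SQ *m r^T) 0 0.
Proof.
move=> r0; have e0 : el r != 0.
  apply: contraNneq r0 => e0; apply/eqP/basis_free; rewrite -/(el r) e0.
  by rewrite big1 // => i _; rewrite mxE rmorph0 mul0r.
rewrite -(ltr_rat algC) rmorph0 tr_sq (bigD1 i0) //=.
apply: ltr_wpDr; first by apply: sumr_ge0 => k _; rewrite -realEsqr.
by rewrite real_exprn_even_gt0 //= fmorph_eq0.
Qed.

Lemma minkowski_contradiction : False.
Proof.
have dpos := posdef_det_gt0 SQ_sym SQ_posdef.
have [n dn] := gram_unimodular.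
have dS1 : \det SQ = 1.
  move: dpos; rewrite /SQ det_map_mx ltr0z => d0.
  have n0 : 0 < n by rewrite -(pmulr_rgt0 _ d0) dn.
  have [d1 n1] : 1 <= \det S /\ 1 <= n by rewrite -!gtz0_ge1.
  suff -> : \det S = 1 by [].
  nia.
have [c c0 hc] := unimodular_short_vector p_ge11 SQ_sym SQ_posdef dS1.
pose r : 'rV[rat]_p := map_mx intr c; pose x := el r.
have r0 : r != 0.
  by apply: contraNneq c0 => /matrixP h; apply/eqP/matrixP => i k; have := h i k; rewrite !mxE => /eqP; rewrite intr_eq0 => /eqP.
have x0 : x != 0.
  apply: contraNneq r0 => e0; apply/eqP/basis_free; rewrite -/(el r) -/x e0.
  by rewrite big1 // => i _; rewrite mxE rmorph0 mul0r.
have Ox : O x.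
  apply: algint_sum => i _; apply: algintM; last by case: (hb i).
  by rewrite mxE rmorph_int; apply: algint_int.
have [z ez] : exists z : int, \prod_(k < p) gp k x = z%:~R.
  have [a ea] := g_fix (gpow_prod_fixed x0 (el_fixed r)).
  have : O (iota a) by rewrite -ea; apply: algint_prod => i _; apply: algint_gpow.
  by move=> /algint_rat [z ez]; exists z; rewrite ea ez rmorph_int.
have z0 : z != 0.
  apply: contraTneq isT => z0; have : \prod_(k < p) gp k x != 0.
    by apply/prodf_neq0 => k _; rewrite fmorph_eq0.
  by rewrite ez z0 eqxx.
have nn : {in predT, forall k : 'I_p, 0 <= j (gp k x) ^+ 2} by move=> k _; rewrite -realEsqr.
have : \prod_(k < p) j (gp k x) ^+ 2 <= ((\sum_(k < p) j (gp k x) ^+ 2) / p%:R) ^+ p.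
  by have := (leif_AGM nn).1; rewrite card_ord.
rewrite prodrXl -rmorph_prod ez rmorph_int -tr_sq.
set t := (_ *m _ *m _) 0 0.
have z1 : 1 <= z ^+ 2 by rewrite -gtz0_ge1 exprn_even_gt0.
have t0 : 0 < t by apply: SQ_posdef.
have p0 : 0 < p%:R :> rat by rewrite ltr0n.
have -> : (ratr t / p%:R : algC) ^+ p = ratr ((t / p%:R) ^+ p).
  by rewrite rmorphXn fmorph_div rmorph_nat.
have -> : z%:~R ^+ 2 = ratr (z ^+ 2)%:~R :> algC by rewrite rmorph_int rmorphXn.
rewrite ler_rat => h.
have : (t / p%:R) ^+ p < 1.
  by rewrite exprn_ilt1 ?gt_eqF // ?divr_ge0 ?(ltW t0) ?(ltW p0) // ltr_pdivrMr // mul1r.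
rewrite ltNge => /negP[]; apply: le_trans h.
by rewrite -[1]/(1%:~R) ler_int.
Qed.

End Minkowski.

Theorem inertia_ideal_proper (p : nat) (K : fieldType) (iota : {rmorphism rat -> K})
    (g : {rmorphism K -> K}) (j : {rmorphism K -> algC}) :
  prime p -> (11 <= p)%N ->
  (forall x, exists n, gpow g (p ^ n) x = x) ->
  (forall x, g x = x -> exists a, x = iota a) ->
  (forall a, g (iota a) = iota a) ->
  (forall x, j x \is Num.real) ->
  forall s : seq (K * K), {in s, forall u, algint u.1 /\ algint u.2} ->
  \sum_(u <- s) u.1 * (u.2 - g u.2) <> 1.
Proof.
move=> pp p11 gper gfix gQ jre s hs s1.
have [phi [[t [h1 h2]] phi0 phin]] := galois_idempotent (@algint1 K) (@algintB K) (@algintM K)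
  (fun x => @algint_morph K g x) pp gper hs s1.
have t1 : \sum_(u <- t) u.1 * u.2 = 1 by rewrite -phi0 h2.
have t0 k : ~~ (p %| k)%N -> \sum_(u <- t) u.1 * gpow g k u.2 = 0.
  by move=> pk; rewrite -h2 phin.
have [b [S [bS bmin]]] := minimal_basis pp gfix h1 t1 t0.
exact: (minkowski_contradiction pp p11 gfix gQ jre h1 t1 t0 bS bmin).
Qed.

(** * A maximal ideal containing a proper ideal *)

Section MaximalIdeal.
Variables (K : comNzRingType) (O J : K -> Prop).
Hypotheses (O1 : O 1) (OB : forall x y, O x -> O y -> O (x - y)).
Hypothesis OM : forall x y, O x -> O y -> O (x * y).
Hypothesis JO : forall x, J x -> O x.

Let O0 : O 0. Proof. by rewrite -(subrr 1); apply: OB. Qed.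
Let ON x : O x -> O (- x). Proof. by move=> h; rewrite -sub0r; apply: OB. Qed.
Let OD x y : O x -> O y -> O (x + y).
Proof. by move=> hx hy; rewrite -[y]opprK; apply: OB => //; apply: ON. Qed.

(** The ideal of [O] generated by [X] and [J]. Zorn's lemma is applied to sets [X] of additional
    generators: a union of a chain needs no closure property, and the empty chain gives back [J]. *)
Definition combo (X : K -> Prop) (x : K) : Prop := exists s : seq (K * K),
  (forall u, u \in s -> O u.1 /\ (X u.2 \/ J u.2)) /\ x = \sum_(u <- s) u.1 * u.2.

Lemma maximal_ideal : ~ combo (fun=> False) 1 -> exists M : K -> Prop,
  [/\ forall x, M x -> O x, forall x y, M x -> M y -> M (x - y),
      forall x y, O x -> M y -> M (x * y), forall x, J x -> M x &
      ~ M 1 /\ forall a, O a -> ~ M a -> exists2 r, O r & M (1 - r * a)].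
Proof.
move=> J1.
pose P (X : set K) := (forall x, X x -> O x) /\ ~ combo X 1.
have [C CP totC|A [[AO A1] Amax]] := @Zorn_bigcup K P.
  split=> [x [X CX Xx]|[s [hs s1]]]; first by have [h _] := CP X CX; apply: h.
  have [sJ|[X CX hX]] : (forall u, u \in s -> O u.1 /\ J u.2) \/
      exists2 X, C X & forall u, u \in s -> O u.1 /\ (X u.2 \/ J u.2).
    elim: s hs {s1} => [|u s IH] hs; first by left.
    have [hu1 hu2] := hs u (mem_head u s).
    have {}IH := IH (fun w ws => hs w (mem_behead (s := u :: s) ws)).
    case: hu2 => [[X CX Xu]|Ju].
      right; case: IH => [h|[X' CX' h]].
        exists X => // w; rewrite inE => /orP[/eqP->|/h [h1 h2]]; first by split=> //; left.
        by split=> //; right.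
      have [XX|XX] := totC X X' CX CX'.
        exists X' => // w; rewrite inE => /orP[/eqP->|/h //].
        by split=> //; left; apply: XX.
      exists X => // w; rewrite inE => /orP[/eqP->|/h [h1 h2]]; first by split=> //; left.
      by split=> //; case: h2 => h2; [left; apply: XX | right].
    case: IH => [h|[X CX h]].
      by left=> w; rewrite inE => /orP[/eqP->|/h].
    right; exists X => // w; rewrite inE => /orP[/eqP->|/h //].
    by split=> //; right.
  - by apply: J1; exists s; split=> // u us; have [h1 h2] := sJ u us; split=> //; right.
  - by have [_ []] := CP X CX; exists s.
have comboB X x y : combo X x -> combo X y -> combo X (x - y).
  move=> [s [hs ->]] [t [ht ->]]; exists (s ++ [seq (- u.1, u.2) | u <- t]); split.
    move=> u; rewrite mem_cat => /orP[/hs //|/mapP [w /ht [h1 h2] ->]] /=.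
    by split=> //; apply: ON.
  rewrite big_cat big_map -sumrN; congr (_ + _).
  by apply: eq_bigr => u _; rewrite mulNr.
have comboM X x y : O x -> combo X y -> combo X (x * y).
  move=> Ox [s [hs ->]]; exists [seq (x * u.1, u.2) | u <- s]; split.
    by move=> u /mapP [w /hs [h1 h2] ->] /=; split=> //; apply: OM.
  by rewrite big_map mulr_sumr; apply: eq_bigr => u _; rewrite mulrA.
exists (combo A); split; [ | exact: comboB | exact: comboM | | split=> //].
- move=> x [s [hs ->]]; rewrite big_seq; apply: big_ind => // u /hs [h1 [h2|h2]]; apply: OM => //.
    exact: AO.
  exact: JO.
- move=> x Jx; exists [:: (1, x)]; split; last by rewrite big_seq1 mul1r.
  by move=> u; rewrite inE => /eqP-> /=; split=> //; right.
move=> a Oa nMa; pose B := A `|` [set a].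
have AB : A `<` B.
  split; first by move=> x Ax; left.
  move=> h; apply: nMa; exists [:: (1, a)]; split; last by rewrite big_seq1 mul1r.
  by move=> u; rewrite inE => /eqP-> /=; split=> //; left; apply: h; right.
have nPB := Amax B AB.
have [s [hs s1]] : combo B 1.
  apply: contrapT => h; apply: nPB; split=> // x [/AO //|->]; exact: Oa.
have : exists2 r, O r & combo A (\sum_(u <- s) u.1 * u.2 - r * a).
  elim: s hs {s1} => [|u s IH] hs.
    exists 0 => //; exists [::]; split=> //; rewrite !big_nil mul0r subr0 //.
  have [hu1 hu2] := hs u (mem_head u s).
  have [r Or cr] := IH (fun w ws => hs w (mem_behead (s := u :: s) ws)).
  have [h|h] : (A u.2 \/ J u.2) \/ u.2 = a by case: hu2 => [[h|h]|h]; [left; left|right|left; right].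
    exists r => //; rewrite big_cons -addrA.
    have -> : u.1 * u.2 + (\sum_(u <- s) u.1 * u.2 - r * a) =
      (\sum_(u <- s) u.1 * u.2 - r * a) - (- u.1) * u.2 by ring.
    apply: comboB => //; exists [:: (- u.1, u.2)]; split; last by rewrite big_seq1.
    by move=> w; rewrite inE => /eqP-> /=; split=> //; apply: ON.
  exists (u.1 + r); first exact: OD.
  by rewrite big_cons h mulrDl opprD addrACA subrr add0r.
by rewrite -s1.
Qed.

End MaximalIdeal.

Section PrimitivePolynomial.
Variables (K : fieldType) (iota : {rmorphism rat -> K}).
Hypothesis algK : forall x, algebraicOver iota x.
Local Notation O := (@algint K).

(** A relation of content 1 keeps a nonzero coefficient modulo every prime; this is what will make
    the localisation of [O] at [M] a valuation ring. *)
Lemma primitive_int_poly x : exists2 f : {poly int}, root (map_poly (intr : int -> K) f) x &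
  forall l : nat, prime l -> exists i, ~~ (l %| f`_i)%Z.
Proof.
have [q q0 rq] := algK x.
have [f [d d0 eq]] := rat_poly_scale q.
have f0 : f != 0.
  by apply: contraNneq q0 => f0; rewrite eq f0 map_poly0 scaler0.
have rf : root (map_poly (intr : int -> K) f) x.
  move: rq; rewrite eq linearZ /= rootZ; last by rewrite fmorph_eq0 invr_eq0 intr_eq0.
  by rewrite -map_poly_comp; congr root; apply: eq_map_poly => a /=; rewrite rmorph_int.
exists (zprimitive f).
  have c0 : (zcontents f)%:~R != 0 :> K.
    by rewrite -(rmorph_int iota) fmorph_eq0 intr_eq0 zcontents_eq0.
  by move: rf; rewrite {1}[f]zpolyEprim map_polyZ rootZ.
move=> l pl; apply: contrapT => h.
have : (l %| zcontents (zprimitive f))%Z.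
  rewrite dvdz_contents; apply/polyOverP => i.
  by apply: contrapT => hi; apply: h; exists i; apply/negP.
rewrite zcontents_primitive f0 dvdz1 /= => /eqP l1.
by rewrite l1 in pl.
Qed.

End PrimitivePolynomial.

Section Tails.
Variable K : fieldType.
Local Notation O := (@algint K).

Lemma algintX x n : O x -> O (x ^+ n).
Proof.
by move=> h; elim: n => [|n IH]; [exact: algint1 | rewrite exprS; apply: algintM].
Qed.

(* Multiplying the relation by [b ^+ m] makes [b * x] a root of a monic polynomial. *)
Lemma algint_lead (b x : K) (m : nat) (f : nat -> K) : O b -> (forall i, O (f i)) ->
  b * x ^+ m.+1 + \sum_(i < m.+1) f i * x ^+ i = 0 -> O (b * x).
Proof.
move=> Ob Of e.
pose r := \poly_(i < m.+1) (f i * b ^+ (m - i)); pose q := 'X^(m.+1) + r.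
have sq : (size r < size ('X^(m.+1) : {poly K}))%N.
  by rewrite size_polyXn ltnS size_poly.
have mq : q \is monic by rewrite monicE lead_coefDl // lead_coefXn.
apply: (@integral_root_monic _ _ (intr : {rmorphism int -> K}) _ q) => //.
  rewrite /root hornerD hornerXn horner_poly; apply/eqP.
  transitivity (b ^+ m * (b * x ^+ m.+1 + \sum_(i < m.+1) f i * x ^+ i)); last by rewrite e mulr0.
  rewrite mulrDr; congr (_ + _); first by rewrite exprMn mulrA -exprSr.
  rewrite mulr_sumr; apply: eq_bigr => i _.
  have -> : b ^+ m = b ^+ (m - i) * b ^+ i by rewrite -exprD subnK // -ltnS.
  by rewrite exprMn; ring.
apply/(@integral_poly _ _ (intr : {rmorphism int -> K})) => i.
rewrite coefD coefXn coef_poly; apply: (@algintD K); first exact: (algint_int K (i == m.+1)).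
by case: ifP => _; [apply: algintM => //; apply: algintX | exact: (algint_int K 0)].
Qed.

Variables (N : nat) (a : nat -> K) (x : K).
Hypothesis Oa : forall i, O (a i).
Hypothesis ax : \sum_(i < N) a i * x ^+ i = 0.

Definition tail m : K := \sum_(i < N - m) a (i + m)%N * x ^+ i.

Lemma tailS m : (m < N)%N -> tail m = a m + x * tail m.+1.
Proof.
move=> mN; rewrite /tail subnS; case: (N - m)%N (subn_gt0 m N) => [|n _]; first by rewrite mN.
rewrite big_ord_recl /= add0n expr0 mulr1 mulr_sumr; congr (_ + _).
by apply: eq_bigr => i _; rewrite /bump /= addnS exprS mulrCA.
Qed.

Lemma tail_end m : (N <= m)%N -> tail m = 0.
Proof. by rewrite -subn_eq0 /tail => /eqP->; rewrite big_ord0. Qed.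

Lemma tail_rel m : (m <= N)%N -> tail m * x ^+ m + \sum_(i < m) a i * x ^+ i = 0.
Proof.
elim: m => [|m IH] mN.
  by rewrite big_ord0 addr0 mulr1 -[RHS]ax /tail subn0; apply: eq_bigr => i _; rewrite addn0.
by rewrite -[RHS](IH (ltnW mN)) (tailS mN) big_ord_recr /= exprS; ring.
Qed.

(** By [tail_rel], [tail m] is the leading coefficient of a relation of degree [m] for [x], so its
    product with [x] is integral; adding a coefficient gives the previous tail. Hence a descending
    induction on the index. *)
Lemma algint_tail m : O (tail m.+1) /\ O (x * tail m.+1).
Proof.
have base k : (N <= k)%N -> O (tail k) /\ O (x * tail k).
  by move=> Nk; rewrite tail_end // mulr0; split; exact: (algint_int K 0).
have [|mN] := leqP N m.+1; first exact: base.
suff h d : (d < N)%N -> O (tail (N - d)) /\ O (x * tail (N - d)).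
  have -> : m.+1 = (N - (N - m.+1))%N by rewrite subKn // ltnW.
  by apply: h; lia.
elim: d => [|d IH] dN; first by apply: base; rewrite subn0.
have [h1 h2] := IH (ltnW dN).
have e : (N - d = (N - d.+1).+1)%N by lia.
have Nd : (N - d.+1 < N)%N by lia.
have Ot : O (tail (N - d.+1)) by rewrite tailS //; apply: algintD => //; rewrite -e.
split=> //; rewrite mulrC.
have := tail_rel (ltnW Nd).
have -> : (N - d.+1 = (N - d.+2).+1)%N by lia.
move=> hr; apply: algint_lead hr => //.
by rewrite -(_ : N - d.+1 = (N - d.+2).+1)%N //; lia.
Qed.

(* If all the [tail]s and their multiples by [x] were in [M], then so would all the [a i]. *)
Lemma fraction_outside (M : K -> Prop) i : (forall y z, M y -> M z -> M (y - z)) -> ~ M (a i) -> (i < N)%N ->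
  exists c d, [/\ O c, O d, d * x = c & ~ M c \/ ~ M d].
Proof.
move=> MB nM iN; apply: contrapT => h; apply: nM.
have M0 : M 0.
  have [|[]] := pselect (M (tail i.+1)); first by move=> h0; rewrite -(subrr (tail i.+1)); apply: MB.
  apply: contrapT => h1; apply: h; exists (x * tail i.+1), (tail i.+1).
  have [h2 h3] := algint_tail i; split=> //; [by rewrite mulrC | by right].
have hM m : M (tail m.+1) /\ M (x * tail m.+1).
  have [h1 h2] := algint_tail m.
  split; apply: contrapT => h3; apply: h; exists (x * tail m.+1), (tail m.+1);
    by split=> //; [rewrite mulrC | auto].
have -> : a i = tail i - x * tail i.+1 by rewrite tailS // addrK.
apply: MB; last by case: (hM i).
case: i iN => [|i] iN {h}; last by case: (hM i).
suff -> : tail 0 = 0 by [].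
by have := tail_rel (leq0n N); rewrite big_ord0 addr0 mulr1.
Qed.

End Tails.

(** * The valuation of an inertia prime *)

Section RationalValuation.
Variable p : nat.
Hypothesis p_prime : prime p.

Definition ratval (a : rat) : rat := (logn p `|numq a|)%:R - (logn p `|denq a|)%:R.

Lemma ratval_frac (a : rat) (z d : int) : z != 0 -> d != 0 -> a * d%:~R = z%:~R ->
  ratval a = (logn p `|z|)%:R - (logn p `|d|)%:R.
Proof.
move=> z0 d0 e.
have a0 : numq a != 0.
  rewrite numq_eq0; apply: contraNneq z0 => a0; move: e; rewrite a0 mul0r => e.
  by rewrite -(intr_eq0 rat) -e.
have e' : numq a * d = z * denq a.
  apply/eqP; rewrite -(eqr_int rat) !intrM -e; rewrite -{2}(divq_num_den a).
  have : (denq a)%:~R != 0 :> rat by rewrite intr_eq0 denq_neq0.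
  move: (numq a)%:~R (denq a)%:~R (d%:~R) => u w t w0; apply/eqP; field.
  exact: w0.
have := congr1 (fun k : int => logn p `|k|%N) e'.
rewrite !abszM !lognM ?absz_gt0 ?denq_neq0 // => h.
rewrite /ratval; apply/eqP; rewrite subr_eq addrAC eq_sym subr_eq -!natrD h.
by rewrite addnC.
Qed.

Lemma ratval_int (z : int) : z != 0 -> ratval z%:~R = (logn p `|z|)%:R.
Proof. by move=> z0; rewrite (ratval_frac z0 (d := 1)) ?mulr1 // logn1 subr0. Qed.

Lemma ratvalM a b : a != 0 -> b != 0 -> ratval (a * b) = ratval a + ratval b.
Proof.
move=> a0 b0.
rewrite (@ratval_frac _ (numq a * numq b) (denq a * denq b)) ?mulf_neq0 ?numq_eq0 ?denq_neq0 //; last first.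
  rewrite !intrM -{1}(divq_num_den a) -{1}(divq_num_den b).
  have : (denq a)%:~R != 0 :> rat by rewrite intr_eq0 denq_neq0.
  have : (denq b)%:~R != 0 :> rat by rewrite intr_eq0 denq_neq0.
  move: (numq a)%:~R (denq a)%:~R (numq b)%:~R (denq b)%:~R => u w t s w0 s0; field.
  by rewrite w0 s0.
rewrite !abszM !lognM ?absz_gt0 ?numq_eq0 ?denq_neq0 // !natrD /ratval.
by rewrite opprD addrACA.
Qed.

Lemma ratvalX a n : a != 0 -> ratval (a ^+ n) = n%:R * ratval a.
Proof.
move=> a0; elim: n => [|n IH]; first by rewrite mul0r (ratval_int (z := 1)) // logn1.
by rewrite exprS ratvalM ?expf_neq0 // IH -natr1 mulrDl mul1r addrC.
Qed.

End RationalValuation.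

(** * The residue field and the valuation at an inertia prime *)

Section InertiaPrime.
Variables (p : nat) (K : fieldType) (iota : {rmorphism rat -> K}) (g : {rmorphism K -> K}).
Hypothesis p_prime : prime p.
Hypothesis algK : forall x, algebraicOver iota x.
Hypothesis g_per : forall x, exists n, gpow g (p ^ n) x = x.
Hypothesis g_fix : forall x, g x = x -> exists a, x = iota a.
Hypothesis gQ : forall a, g (iota a) = iota a.
Hypothesis g_moves : forall n, exists x, gpow g (p ^ n) x != x.
Local Notation gp := (gpow g).
Local Notation O := (@algint K).

Variable M : K -> Prop.
Hypothesis MO : forall x, M x -> O x.
Hypothesis MB : forall x y, M x -> M y -> M (x - y).
Hypothesis MM : forall x y, O x -> M y -> M (x * y).
Hypothesis Mg : forall x, O x -> M (x - g x).
Hypothesis M1 : ~ M 1.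
Hypothesis Mmax : forall a, O a -> ~ M a -> exists2 r, O r & M (1 - r * a).

Let M0 : M 0. Proof. by rewrite -(mulr0 0); apply: MM; [exact: (algint_int K 0) | rewrite -(subrr (1 - g 1)); apply: MB; apply: Mg; exact: algint1]. Qed.
Let MN x : M x -> M (- x). Proof. by move=> h; rewrite -sub0r; apply: MB. Qed.
Let MD x y : M x -> M y -> M (x + y).
Proof. by move=> hx hy; rewrite -[y]opprK; apply: MB => //; apply: MN. Qed.
Let Mr x y : M x -> O y -> M (x * y). Proof. by move=> hx hy; rewrite mulrC; apply: MM. Qed.
Let Onat n : O n%:R. Proof. exact: (algint_int K n). Qed.

Lemma M_prime a b : O a -> O b -> M (a * b) -> M a \/ M b.
Proof.
move=> Oa Ob ab; have [|nMa] := pselect (M a); [by left|right].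
have [r Or h] := Mmax Oa nMa.
have -> : b = (1 - r * a) * b + r * (a * b) by ring.
by apply: MD; [apply: Mr | apply: MM].
Qed.

Lemma M_exp a n : O a -> M (a ^+ n) -> M a.
Proof.
move=> Oa; elim: n => [|n IH]; first by move/M1.
by rewrite exprS => h; case: (M_prime Oa (algintX n Oa) h).
Qed.

Lemma M_trans a b c : M (a - b) -> M (b - c) -> M (a - c).
Proof. by move=> h1 h2; (have -> : a - c = (a - b) + (b - c) by ring); apply: MD. Qed.

Lemma M_sym a b : M (a - b) -> M (b - a).
Proof. by move=> h; rewrite -opprB; apply: MN. Qed.

Lemma M_mul a b c d : O a -> O d -> M (a - b) -> M (c - d) -> M (a * c - b * d).
Proof.
move=> Oa Od h1 h2; have -> : a * c - b * d = a * (c - d) + (a - b) * d by ring.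
by apply: MD; [apply: MM | apply: Mr].
Qed.

Lemma M_pow a b n : O a -> O b -> M (a - b) -> M (a ^+ n - b ^+ n).
Proof.
move=> Oa Ob h; elim: n => [|n IH]; first by rewrite subrr.
by rewrite !exprS; apply: M_mul => //; apply: algintX.
Qed.

Lemma M_gp n x : O x -> M (gp n x - x).
Proof.
move=> Ox; elim: n => [|n IH]; first by rewrite subrr.
apply: M_trans IH; apply: M_sym; apply: Mg; exact: algint_gpow.
Qed.

Lemma gp_M n x : O x -> M (gp n x) -> M x.
Proof.
by move=> Ox h; (have -> : x = gp n x - (gp n x - x) by ring); apply: MB => //; apply: M_gp.
Qed.

(** [g] is trivial modulo [M], which is the inertia condition. It lets membership in [M] be tested
    on norms, that is, on integers. *)
Lemma M_gp_prod n x : O x -> M (\prod_(i < n) gp i x - x ^+ n).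
Proof.
move=> Ox; elim: n => [|n IH]; first by rewrite big_ord0 subrr.
rewrite big_ord_recr exprSr; apply: M_mul => //; last exact: M_gp.
by apply: algint_prod => i _; apply: algint_gpow.
Qed.

Lemma natK_neq0 n : (0 < n)%N -> n%:R != 0 :> K.
Proof. by move=> n0; rewrite -(rmorph_nat iota) fmorph_eq0 pnatr_eq0 -lt0n. Qed.

Lemma fixed_int x : O x -> g x = x -> exists z : int, x = z%:~R.
Proof.
move=> Ox /g_fix [a ea]; move: Ox; rewrite ea => /algint_rat [z ez].
by exists z; rewrite ez rmorph_int.
Qed.

Definition gnorm n x := \prod_(i < p ^ n) gp i x.

Lemma gnorm_fixed n x : gp (p ^ n) x = x -> g (gnorm n x) = gnorm n x.
Proof.
move=> fx; have [->|x0] := eqVneq x 0.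
  have m0 : (0 < p ^ n)%N by rewrite expn_gt0 prime_gt0.
  by rewrite /gnorm (bigD1 (Ordinal m0)) //= mul0r rmorph0.
rewrite /gnorm rmorph_prod; apply: (mulfI x0).
transitivity (\prod_(i < (p ^ n).+1) gp i x); first by rewrite big_ord_recl.
by rewrite big_ord_recr /= fx mulrC.
Qed.

Lemma gnorm_neq0 n x : x != 0 -> gnorm n x != 0.
Proof. by move=> x0; apply/prodf_neq0 => i _; rewrite fmorph_eq0. Qed.

Lemma O_gnorm n x : O x -> O (gnorm n x).
Proof. by move=> Ox; apply: algint_prod => i _; apply: algint_gpow. Qed.

Lemma M_gnorm n x : O x -> M (gnorm n x) -> M x.
Proof.
move=> Ox h; apply: (@M_exp _ (p ^ n) Ox).
by (have -> : x ^+ (p ^ n) = gnorm n x - (gnorm n x - x ^+ (p ^ n)) by ring); apply: MB => //; apply: M_gp_prod.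
Qed.

Lemma gnorm_M n x : O x -> M x -> M (gnorm n x).
Proof.
move=> Ox Mx; have m0 : (0 < p ^ n)%N by rewrite expn_gt0 prime_gt0.
rewrite /gnorm (bigD1 (Ordinal m0)) //=; apply: Mr => //.
by apply: algint_prod => i _; apply: algint_gpow.
Qed.

Lemma M_nat_prime n : (0 < n)%N -> M n%:R -> exists2 l, prime l & M l%:R.
Proof.
elim/ltn_ind: n => n IH n0 Mn.
have [n1|n1] := leqP n 1%N.
  by case: M1; move: Mn; have -> : n = 1%N by apply/eqP; rewrite eqn_leq n1.
have pr := pdiv_prime n1.
move: Mn; rewrite -(divnK (pdiv_dvd n)) natrM => /M_prime [] // h; last by exists (pdiv n).
apply: IH h; first by rewrite ltn_Pdiv // prime_gt1.
by rewrite divn_gt0 ?prime_gt0 // pdiv_leq.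
Qed.

Lemma algint_multiple x : exists2 d : nat, (0 < d)%N & O (d%:R * x).
Proof.
have [->|x0] := eqVneq x 0; first by exists 1%N => //; rewrite mulr0; exact: (Onat 0).
have [f rf hf] := primitive_int_poly algK x.
have f0 : f != 0 by have [i] := hf 2%N isT; apply: contraNneq => ->; rewrite coef0 dvdz0.
pose a i : K := (f`_i)%:~R.
have ax : \sum_(i < size f) a i * x ^+ i = 0.
  by move: rf; rewrite /root /map_poly horner_poly => /eqP.
have Oa i : O (a i) by exact: algint_int.
have [s1|s1] := leqP (size f) 1%N.
  move: ax; have -> : size f = 1%N by apply/eqP; rewrite eqn_leq s1 size_poly_gt0.
  rewrite big_ord1 expr0 mulr1 /a -[X in f`_X]/((1.-1)%N) => h.
  case/eqP: f0; apply/polyP => i; rewrite coef0; have [->|i0] := posnP i.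
    by apply/eqP; rewrite -(intr_eq0 rat) -(fmorph_eq0 iota) rmorph_int h.
  by rewrite nth_default // (leq_trans s1).
have [_ h] := algint_tail Oa ax (size f).-2.
have e : (size f).-2.+1 = (size f).-1 by case: (size f) s1 => [|[]].
rewrite e in h; have lt : ((size f).-1 < size f)%N by rewrite ltn_predL size_poly_gt0.
rewrite (tailS _ _ lt) tail_end ?prednK ?size_poly_gt0 // mulr0 addr0 in h.
exists `|lead_coef f|%N; first by rewrite absz_gt0 lead_coef_eq0.
have : O ((sgz (lead_coef f))%:~R * (x * a (size f).-1)).
  by apply: algintM => //; exact: algint_int.
rewrite /a -/(lead_coef f) mulrCA -intrM mulrC.
have -> : sgz (lead_coef f) * lead_coef f = `|lead_coef f|%N :> int by rewrite abszE mulrC [RHS]normrEsg mulrC sgrz; ring.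
by [].
Qed.

(** [M] contains some nonzero [z], obtained from an element moved by [g]; the norm of [z] is a
    nonzero integer of [M]. *)
Lemma residue_char : exists2 l, prime l & M l%:R.
Proof.
have [x mx] := g_moves 0; rewrite expn0 /= in mx.
have [d d0 Odx] := algint_multiple x.
pose z := d%:R * x - g (d%:R * x).
have z0 : z != 0.
  by rewrite /z rmorphM rmorph_nat -mulrBr mulf_neq0 ?natK_neq0 // subr_eq0 eq_sym.
have Mz : M z by apply: Mg.
have Oz := MO Mz; have [n fz] := g_per z.
have [k ek] := fixed_int (O_gnorm n Oz) (gnorm_fixed fz).
have Mk : M (`|k|%N%:R).
  have -> : `|k|%N%:R = (sgz k)%:~R * gnorm n z.
    by rewrite ek -intrM -[LHS]/((`|k|%N)%:~R); congr _%:~R; rewrite abszE [LHS]normrEsg sgrz; ring.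
  by apply: MM; [exact: algint_int | apply: gnorm_M].
apply: M_nat_prime Mk; rewrite absz_gt0.
by apply: contraNneq (gnorm_neq0 n z0) => k0; rewrite ek k0.
Qed.

Section ResidueCharacteristic.
Variable l : nat.
Hypotheses (l_prime : prime l) (Ml : M l%:R).

Lemma M_int (z : int) : M z%:~R -> (l %| z)%Z.
Proof.
move=> Mz; apply: contrapT => /negP ndv.
have co : coprimez l z by rewrite coprimezE prime_coprime.
have [[u w] /= e] := coprimezP _ _ co.
apply: M1; have -> : 1 = u%:~R * l%:R + w%:~R * z%:~R :> K.
  by rewrite -[l%:R]/(l%:~R) -!intrM -intrD e.
by apply: MD; apply: MM => //; exact: algint_int.
Qed.

Lemma M_of_dvd (z : int) : (l %| z)%Z -> M z%:~R.
Proof. by move=> /dvdzP [q ->]; rewrite intrM; apply: MM => //; exact: algint_int. Qed.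

(** In other words, the localisation of [O] at [M] is a valuation ring of [K]. *)
Lemma pruefer x : exists a b, [/\ O a, O b, b * x = a & ~ M a \/ ~ M b].
Proof.
have [f rf hf] := primitive_int_poly algK x.
pose a i : K := (f`_i)%:~R.
have ax : \sum_(i < size f) a i * x ^+ i = 0.
  by move: rf; rewrite /root /map_poly horner_poly => /eqP.
have Oa i : O (a i) by exact: algint_int.
have [i hi] := hf l l_prime.
apply: (@fraction_outside _ _ _ _ Oa ax M i MB); first by move/M_int; apply/negP.
by rewrite ltnNge; apply: contra hi => h; rewrite nth_default // dvdz0.
Qed.

(* [g x / x] is a unit [a / b] of the localization at [M], of norm 1. *)
Lemma tame_unit x : x != 0 -> exists a b n, [/\ O a /\ ~ M a, O b /\ ~ M b, g x * b = x * a,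
  gp (p ^ n) x = x & M (a ^+ (p ^ n) - b ^+ (p ^ n))].
Proof.
move=> x0; have [a [b [Oa Ob eab nM]]] := pruefer (g x / x).
have e : g x * b = x * a by rewrite -eab; field.
have [n fx] := g_per x.
have b0 : b != 0.
  apply: contraTneq isT => b0; move: eab nM; rewrite b0 mul0r => <-; case; exact.
have nn : gnorm n a = gnorm n b.
  apply: (mulfI (gnorm_neq0 n x0)); rewrite {2}/gnorm -!big_split /=.
  transitivity (\prod_(i < p ^ n) gp i (g x * b)).
    by apply: eq_bigr => i _; rewrite e rmorphM.
  rewrite (eq_bigr (fun i : 'I__ => gp i (g x) * gp i b)) => [|i _]; last by rewrite rmorphM.
  rewrite !big_split /=; congr (_ * _).
  rewrite -[RHS](gnorm_fixed fx) /gnorm rmorph_prod; apply: eq_bigr => i _.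
  exact: (gpow_comm g i 1 x).
have Mab : M a <-> M b.
  by split=> h; [apply: (@M_gnorm n) => //; rewrite -nn | apply: (@M_gnorm n) => //; rewrite nn]; apply: gnorm_M.
have [nMa nMb] : ~ M a /\ ~ M b by case: nM => h; split=> // h'; apply: h; apply/Mab.
exists a, b, n; split=> //.
apply: M_trans (M_gp_prod (p ^ n) Ob).
by rewrite -/(gnorm n b) -nn; apply: M_sym; apply: M_gp_prod.
Qed.

(** The trace of [u] is an integer congruent to [(p ^ n)%:R * u], and [p] is invertible modulo [l].
    So the residue field is the prime field. *)
Lemma M_int_residue u : l != p -> O u -> exists r : nat, M (u - r%:R).
Proof.
move=> lp Ou; have [n fu] := g_per u.
pose T := \sum_(i < p ^ n) gp i u.
have MT m : M (\sum_(i < m) gp i u - m%:R * u).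
  elim: m => [|m IH]; first by rewrite big_ord0 mul0r subrr.
  rewrite big_ord_recr /= -natr1 mulrDl mul1r opprD addrACA; apply: MD => //.
  exact: M_gp.
have fT : g T = T.
  rewrite /T rmorph_sum; apply: (addrI u).
  transitivity (\sum_(i < (p ^ n).+1) gp i u); first by rewrite big_ord_recl.
  by rewrite big_ord_recr /= fu addrC.
have OT : O T by apply: algint_sum => i _; apply: algint_gpow.
have [t et] := fixed_int OT fT.
have co : coprimez l (p ^ n)%N.
  by rewrite coprimezE /= coprimeXr // prime_coprime // dvdn_prime2.
have [[c d] /= ecd] := coprimezP _ _ co.
have Mu : M (u - (d * t)%:~R).
  have -> : u - (d * t)%:~R = c%:~R * u * l%:R - d%:~R * (T - (p ^ n)%:R * u).
    have e1 : c%:~R * l%:R + d%:~R * (p ^ n)%:R = 1 :> K.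
      by rewrite -[l%:R]/(l%:~R) -[(p ^ n)%:R]/((p ^ n)%N%:~R) -!intrM -intrD ecd.
    have aux (C D P L t' w : K) : C * L + D * P = 1 ->
        w - D * t' = C * w * L - D * (t' - P * w).
      by move=> h; rewrite -{1}[w]mul1r -h; ring.
    by rewrite et intrM; apply: aux.
  by apply: MB; apply: MM => //; [apply: algintM => //; exact: algint_int | exact: algint_int | exact: MT].
have z0 : 0 <= (d * t %% l)%Z by apply: modz_ge0; rewrite eqz_nat -lt0n prime_gt0.
exists `|(d * t %% l)%Z|%N.
apply: M_trans Mu _.
have -> : `|(d * t %% l)%Z|%N%:R = (d * t %% l)%Z%:~R :> K by rewrite -[in RHS](gez0_abs z0).
rewrite -intrB; apply: M_of_dvd.
by rewrite {1}(divz_eq (d * t) l) addrK dvdz_mull.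
Qed.


Lemma M_fermat u : l != p -> O u -> ~ M u -> M (u ^+ l.-1 - 1).
Proof.
move=> lp Ou nMu; have [r hr] := M_int_residue lp Ou.
have nd : ~~ (l %| r)%N.
  apply/negP => h; apply: nMu.
  rewrite (_ : u = (u - r%:R) + r%:R); last by ring.
  by apply: MD => //; exact: (@M_of_dvd r).
have co : coprime r l by rewrite coprime_sym prime_coprime.
apply: M_trans (M_pow _ Ou (Onat r) hr) _.
have r0 : (0 < r)%N by case: r nd {hr co} => //; rewrite dvdn0.
have := Euler_exp_totient co; rewrite totient_prime // => /eqP h.
have h1 : (1 <= r ^ l.-1)%N by rewrite expn_gt0 r0.
rewrite eqn_mod_dvd // in h.
have -> : r%:R ^+ l.-1 - 1 = (r ^ l.-1 - 1)%N%:R :> K by rewrite natrB // natrX.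
exact: (@M_of_dvd (r ^ l.-1 - 1)%N).
Qed.

(** Units of the residue field have order dividing [l - 1], so the exponent [p ^ n] may be lowered
    to its gcd with [l - 1], a power of [p] less than [p ^ l]. The gain is an exponent independent
    of [n], hence of the elements. *)
Lemma M_pow_gcd a b n : l != p -> O a -> ~ M a -> O b -> ~ M b ->
  M (a ^+ (p ^ n) - b ^+ (p ^ n)) -> M (a ^+ (p ^ l) - b ^+ (p ^ l)).
Proof.
move=> lp Oa nMa Ob nMb h.
have m0 : (0 < p ^ n)%N by rewrite expn_gt0 prime_gt0.
have hd : (gcdn (p ^ n) l.-1 %| p ^ l)%N.
  have [k kn ek] := elimT (dvdn_pfactor (gcdn (p ^ n) l.-1) n p_prime) (dvdn_gcdl _ _).
  rewrite ek dvdn_exp2l //; apply: ltnW; rewrite -(ltn_exp2l _ _ (prime_gt1 p_prime)).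
  apply: leq_ltn_trans (ltn_expl l (prime_gt1 p_prime)).
  rewrite -ek; apply: leq_trans (leq_pred l); apply: dvdn_leq (dvdn_gcdr _ _).
  by have := prime_gt1 l_prime; case: l => [|[]].
have [km kn e _] := egcdnP l.-1 m0.
have key u : O u -> ~ M u -> M (u ^+ (km * p ^ n) - u ^+ gcdn (p ^ n) l.-1).
  move=> Ou nMu; rewrite e exprD mulnC exprM.
  have h1 := M_pow kn (algintX l.-1 Ou) (algint1 K) (M_fermat lp Ou nMu).
  rewrite expr1n in h1; rewrite -[X in _ - X]mul1r.
  by apply: M_mul => //; [do 2 apply: algintX | apply: algintX | rewrite subrr].
have hg : M (a ^+ gcdn (p ^ n) l.-1 - b ^+ gcdn (p ^ n) l.-1).
  apply: M_trans (M_sym (key a Oa nMa)) _; apply: M_trans (key b Ob nMb).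
  by rewrite mulnC !exprM; apply: M_pow => //; apply: algintX.
by rewrite -(divnK hd) mulnC !exprM; apply: M_pow => //; apply: algintX.
Qed.

Lemma gpow_unit x : l != p -> x != 0 ->
  exists A B, [/\ O A, O B, ~ M B, gp (p ^ l) x * B = x * A & M (A - B)].
Proof.
move=> lp x0; have [a [b [n [[Oa nMa] [Ob nMb] e _ h]]]] := tame_unit x0.
have {}h := M_pow_gcd lp Oa nMa Ob nMb h.
exists (\prod_(i < p ^ l) gp i a), (\prod_(i < p ^ l) gp i b); split.
- by apply: algint_prod => i _; apply: algint_gpow.
- by apply: algint_prod => i _; apply: algint_gpow.
- by move=> h'; apply: nMb; apply: (@M_gnorm l).
- elim: (p ^ l)%N => [|m IH]; first by rewrite !big_ord0.
  rewrite !big_ord_recr /= -gpowS.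
  transitivity (gp m (g x * b) * \prod_(i < m) gp i b).
    by rewrite rmorphM -(gpow_comm g 1 m x) /=; ring.
  by rewrite e rmorphM mulrAC IH; ring.
- apply: M_trans (M_gp_prod _ Oa) _; apply: M_trans h _; apply: M_sym; exact: M_gp_prod.
Qed.

(* If [l != p], then [t = g ^ (p ^ l)] acts on [w = t x - x] as a unit congruent to 1, so that the
   vanishing sum of the [t ^ i w] is [p ^ N * w] up to such units. *)
Lemma residue_char_eq : l = p.
Proof.
apply/eqP/contraT => lp; have [x mx] := g_moves l.
pose w := gp (p ^ l) x - x; have w0 : w != 0 by rewrite subr_eq0.
have [A [B [OA OB nMB eAB hAB]]] := gpow_unit lp w0.
have sums k : exists C D, [/\ O C, O D, ~ M D, (gp (p ^ l * k) x - x) * D = w * C & M (C - k%:R * D)].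
  elim: k => [|k [C [D [OC OD nMD e h]]]].
    exists 0, 1; split=> //; [exact: (Onat 0) | exact: algint1 | |]; rewrite ?muln0 ?mul0r.
      by rewrite subrr mul0r mulr0.
    by rewrite subrr.
  exists (gp (p ^ l) D * B + A * gp (p ^ l) C), (gp (p ^ l) D * B); split.
  - by apply: algintD; apply: algintM => //; apply: algint_gpow.
  - by apply: algintM => //; apply: algint_gpow.
  - by move=> /(M_prime (algint_gpow _ _ OD) OB) [/(gp_M OD)|].
  - rewrite mulnS gpowD; have := congr1 (gp (p ^ l)) e; rewrite !rmorphM rmorphB /= => e'.
    transitivity (w * (gp (p ^ l) D * B) + (gp (p ^ l) (gp (p ^ l * k) x) - gp (p ^ l) x) * gp (p ^ l) D * B).
      by rewrite /w; ring.
    by rewrite e' mulrAC eAB; ring.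
  - have -> : gp (p ^ l) D * B + A * gp (p ^ l) C - k.+1%:R * (gp (p ^ l) D * B) =
      (A - B) * gp (p ^ l) C + B * ((gp (p ^ l) C - C) + (C - k%:R * D) - k%:R * (gp (p ^ l) D - D)).
      by rewrite -natr1; ring.
    apply: MD; first by apply: Mr => //; apply: algint_gpow.
    apply: MM => //; apply: MB; first by apply: MD => //; apply: M_gp.
    by apply: MM => //; apply: M_gp.
have [n fx] := g_per x; have [C [D [OC OD nMD e h]]] := sums (p ^ n)%N.
have C0 : C = 0.
  apply: (mulfI w0); rewrite -e mulr0 mulnC (gpowM_fixed _ fx) subrr mul0r //.
rewrite C0 sub0r in h; have {h} := MN h; rewrite opprK => /(M_prime (Onat _) OD) [h|//].
have /M_exp : M (p%:R ^+ n) by rewrite -natrX.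
move=> /(_ (Onat p)) /(@M_int p) h'; have : (l %| p)%N := h'.
by rewrite dvdn_prime2 // (negbTE lp).
Qed.


End ResidueCharacteristic.

Lemma M_p : M p%:R.
Proof. by have [l pl Ml] := residue_char; rewrite -(residue_char_eq pl Ml). Qed.

Lemma M_frobenius x y n : O x -> O y ->
  M ((x + y) ^+ (p ^ n) - (x ^+ (p ^ n) + y ^+ (p ^ n))).
Proof.
have step u w : O u -> O w -> M ((u + w) ^+ p - (u ^+ p + w ^+ p)).
  move=> Ou Ow; have [q ep] : exists q, p = q.+1 by exists p.-1; rewrite prednK // prime_gt0.
  have -> : (u + w) ^+ p - (u ^+ p + w ^+ p) =
      \sum_(i < q) (u ^+ (q - i) * w ^+ i.+1) *+ 'C(p, i.+1).
    rewrite ep exprDn big_ord_recl big_ord_recr /= subn0 bin0 !expr0 mulr1 mulr1n.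
    rewrite /bump /= add1n subnn binn expr0 mul1r mulr1n addrA [X in X - _]addrAC [X in X - _]addrC addrK.
    by apply: eq_bigr => i _; rewrite add1n subSS.
  apply: big_ind => [||i _]; [exact: M0 | exact: MD |].
  rewrite -[_ *+ _]mulr_natr; apply: MM; first by apply: algintM; apply: algintX.
  by apply: (@M_of_dvd p M_p 'C(p, i.+1)); apply: prime_dvd_bin => //; rewrite ep !ltnS leq0n ltn_ord.
move=> Ox Oy; elim: n => [|n IH]; first by rewrite !expr1 subrr.
rewrite expnSr !exprM; apply: M_trans (step _ _ _ _); [|exact: algintX|exact: algintX].
by apply: M_pow => //; [apply: algintX; apply: algintD | apply: algintD; apply: algintX].
Qed.

(** In residue characteristic [p] the Frobenius map is injective, so [a] and [b] from [tame_unit],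
    congruent after raising to the power [p ^ n], are already congruent. *)
Lemma wild_unit x : x != 0 -> exists a b,
  [/\ O a, O b, ~ M b, g x * b = x * a & M (a - b)].
Proof.
move=> x0; have [a [b [n [[Oa _] [Ob nMb] e _ h]]]] := tame_unit p_prime M_p x0.
exists a, b; split=> //; apply: (@M_exp _ (p ^ n)); first exact: algintB.
have := M_frobenius n (algintB Oa Ob) Ob; rewrite subrK => h'.
have -> : (a - b) ^+ (p ^ n) =
  (a ^+ (p ^ n) - b ^+ (p ^ n)) - (a ^+ (p ^ n) - ((a - b) ^+ (p ^ n) + b ^+ (p ^ n))) by ring.
exact: MB.
Qed.


Lemma gnormM n x y : gnorm n (x * y) = gnorm n x * gnorm n y.
Proof. by rewrite /gnorm -big_split; apply: eq_bigr => i _; rewrite rmorphM. Qed.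

Lemma gnormD n k x : gp (p ^ n) x = x -> gnorm (n + k) x = gnorm n x ^+ (p ^ k).
Proof.
move=> fx; rewrite /gnorm expnD.
elim: (p ^ k)%N => [|m IH]; first by rewrite muln0 big_ord0.
rewrite mulnS addnC big_split_ord /= IH [RHS]exprSr; congr (_ * _).
apply: eq_bigr => i _; rewrite addnC gpowD; congr (gp i _).
exact: gpowM_fixed.
Qed.

Lemma gnorm_iota x : exists n a, gp (p ^ n) x = x /\ gnorm n x = iota a.
Proof.
have [n fx] := g_per x; have [a ea] := g_fix (gnorm_fixed fx).
by exists n, a.
Qed.

Definition vdeg x : nat := sval (cid (gnorm_iota x)).
Definition vnorm x : rat := sval (cid (svalP (cid (gnorm_iota x)))).
(** The usual formula for extending the [p]-adic valuation when a single prime lies above [p]. The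
    layer [vdeg x] is an arbitrary choice, immaterial by [vfunE]. *)
Definition vfun x : rat := ratval p (vnorm x) / (p ^ vdeg x)%:R.

Lemma vfunE n a x : x != 0 -> gp (p ^ n) x = x -> gnorm n x = iota a ->
  ratval p a = vfun x * (p ^ n)%:R.
Proof.
move=> x0 fx ea; rewrite /vfun.
have [fx' ea'] : gp (p ^ vdeg x) x = x /\ gnorm (vdeg x) x = iota (vnorm x).
  exact: (svalP (cid (svalP (cid (gnorm_iota x))))).
move: (vdeg x) (vnorm x) fx' ea' => n' a' fx' ea'.
have a0 : a != 0 by rewrite -(fmorph_eq0 iota) -ea gnorm_neq0.
have a'0 : a' != 0 by rewrite -(fmorph_eq0 iota) -ea' gnorm_neq0.
have e : a ^+ (p ^ n') = a' ^+ (p ^ n).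
  by apply: (fmorph_inj iota); rewrite !rmorphXn -ea -ea' -!gnormD // addnC.
have := congr1 (ratval p) e; rewrite !ratvalX //.
have q0 k : (p ^ k)%:R != 0 :> rat by rewrite pnatr_eq0 -lt0n expn_gt0 prime_gt0.
move: (q0 n) (q0 n'); move: (p ^ n)%:R (p ^ n')%:R (ratval p a) (ratval p a').
by move=> u w r r' u0 w0 h; apply: (mulfI w0); rewrite h; field.
Qed.


Lemma pexp_gt0 n : 0 < (p ^ n)%:R :> rat.
Proof. by rewrite ltr0n expn_gt0 prime_gt0. Qed.

Lemma vfunM x y : x != 0 -> y != 0 -> vfun (x * y) = vfun x + vfun y.
Proof.
move=> x0 y0; have [n fx] := g_per x; have [k fy] := g_per y.
have fx' : gp (p ^ (n + k)) x = x by rewrite expnD; apply: gpowM_fixed.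
have fy' : gp (p ^ (n + k)) y = y by rewrite expnD mulnC; apply: gpowM_fixed.
have [a ea] := g_fix (gnorm_fixed fx'); have [b eb] := g_fix (gnorm_fixed fy').
have a0 : a != 0 by rewrite -(fmorph_eq0 iota) -ea gnorm_neq0.
have b0 : b != 0 by rewrite -(fmorph_eq0 iota) -eb gnorm_neq0.
have fxy : gp (p ^ (n + k)) (x * y) = x * y by rewrite rmorphM fx' fy'.
have exy : gnorm (n + k) (x * y) = iota (a * b) by rewrite gnormM ea eb rmorphM.
apply: (mulIf (lt0r_neq0 (pexp_gt0 (n + k)))).
rewrite -(vfunE (mulf_neq0 x0 y0) fxy exy) mulrDl -(vfunE x0 fx' ea) -(vfunE y0 fy' eb).
exact: ratvalM.
Qed.

Lemma vfun_O x : O x -> x != 0 -> exists n z, [/\ gnorm n x = z%:~R, z != 0 &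
  vfun x * (p ^ n)%:R = (logn p `|z|)%:R].
Proof.
move=> Ox x0; have [n fx] := g_per x.
have [z ez] := fixed_int (O_gnorm n Ox) (gnorm_fixed fx).
have z0 : z != 0 by apply: contraNneq (gnorm_neq0 n x0) => z0; rewrite ez z0.
exists n, z; split=> //; rewrite -(vfunE (a := z%:~R) x0 fx) ?ratval_int //.
by rewrite ez rmorph_int.
Qed.

Lemma vfun_ge0 x : O x -> x != 0 -> 0 <= vfun x.
Proof.
move=> Ox x0; have [n [z [_ _ e]]] := vfun_O Ox x0.
by rewrite -(pmulr_lge0 _ (pexp_gt0 n)) e ler0n.
Qed.

Lemma vfun_gt0 x : M x -> x != 0 -> 0 < vfun x.
Proof.
move=> Mx x0; have Ox := MO Mx; have [n [z [ez z0 e]]] := vfun_O Ox x0.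
rewrite -(pmulr_lgt0 _ (pexp_gt0 n)) e ltr0n logn_gt0 mem_primes p_prime absz_gt0 z0.
have Mz : M z%:~R by rewrite -ez; apply: gnorm_M.
exact: (M_int p_prime M_p Mz).
Qed.

Lemma vfun_unit x : O x -> ~ M x -> vfun x = 0.
Proof.
move=> Ox nMx; have x0 : x != 0 by apply/eqP => x0; apply: nMx; rewrite x0; exact: M0.
have [n [z [ez z0 e]]] := vfun_O Ox x0.
apply: (mulIf (lt0r_neq0 (pexp_gt0 n))); rewrite e mul0r; apply/eqP.
rewrite pnatr_eq0 -leqn0 leqNgt logn_gt0 mem_primes p_prime absz_gt0 z0.
apply/negP => h; apply: nMx; apply: (M_gnorm (n := n) Ox).
by rewrite ez; apply: (M_of_dvd M_p).
Qed.

(** By [pruefer] one of [x] and [y] divides the other, and therefore the sum, in the localisation at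
    [M]; integral elements have nonnegative valuation, and those outside [M] have valuation 0. *)
Lemma vfunD r x y : x != 0 -> y != 0 -> x + y != 0 ->
  r <= vfun x -> r <= vfun y -> r <= vfun (x + y).
Proof.
have main u w a b : u != 0 -> u + w != 0 -> O a -> O b -> ~ M b -> b * w = u * a ->
    r <= vfun u -> r <= vfun (u + w).
  move=> u0 uw Oa Ob nMb e h.
  have b0 : b != 0 by apply/eqP => b0; apply: nMb; rewrite b0; exact: M0.
  have e' : (u + w) * b = u * (b + a) by rewrite mulrDl mulrDr -e [w * b]mulrC.
  have ba0 : b + a != 0.
    by apply: contraNneq (mulf_neq0 uw b0) => ba; rewrite e' ba mulr0.
  have := congr1 vfun e'; rewrite !vfunM // (vfun_unit Ob nMb) addr0 => ->.
  by rewrite (le_trans h) // lerDl vfun_ge0 //; apply: algintD.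
move=> x0 y0 xy hx hy; have [a [b [Oa Ob e nM]]] := pruefer p_prime M_p (y / x).
have e' : b * y = x * a by rewrite -e; field.
case: nM => nM; last exact: (main _ _ a b).
by rewrite addrC; apply: (main _ _ b a) => //; rewrite 1?addrC // mulrC -e' mulrC.
Qed.

Definition inertia_valuation := Valuation vfunM vfunD.
Local Notation v := inertia_valuation.

Lemma inertia_val_wild x : x != 0 -> vgt v (v x) (g x - x).
Proof.
move=> x0; have [a [b [Oa Ob nMb e h]]] := wild_unit x0.
have [->|d0] := eqVneq (g x - x) 0; first exact: vgt0.
have b0 : b != 0 by apply/eqP => b0; apply: nMb; rewrite b0; exact: M0.
have e' : (g x - x) * b = x * (a - b) by rewrite mulrBl e -mulrBr.
have ab0 : a - b != 0.
  by apply: contraNneq (mulf_neq0 d0 b0) => ba; rewrite e' ba mulr0.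
rewrite vgtP //=; have := congr1 vfun e'; rewrite !vfunM // (vfun_unit Ob nMb) addr0 => ->.
by rewrite ltrDl vfun_gt0.
Qed.

Lemma inertia_val_fixed x : g x = x -> x != 0 -> exists k : int, v x = k%:~R.
Proof.
move=> gx x0; have [a ea] := g_fix gx.
have e : gnorm 0 x = iota a by rewrite /gnorm big_ord1.
have := vfunE (n := 0) x0 gx e; rewrite expn0 mulr1 /= => <-.
by exists ((logn p `|numq a|)%:Z - (logn p `|denq a|)%:Z); rewrite intrB.
Qed.

Lemma inertia_val_nat n : (0 < n)%N -> v n%:R = (logn p n)%:R.
Proof.
move=> n0; have nK := natK_neq0 n0.
have e : gnorm 0 n%:R = iota n%:R by rewrite /gnorm big_ord1 !rmorph_nat.
have gn : gp (p ^ 0) n%:R = n%:R by rewrite rmorph_nat.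
have := vfunE nK gn e; rewrite expn0 mulr1 /= => <-.
by rewrite (ratval_int p (z := n)) //; rewrite eqz_nat -lt0n.
Qed.

End InertiaPrime.

(** * Transport to the given Weierstrass equation *)

Lemma Zp_extension_valuation (p : nat) (K : fieldType) (iota : {rmorphism rat -> K}) :
  prime p -> (11 <= p)%N -> is_Zp_extension p iota ->
  exists (g : {rmorphism K -> K}) (v : valuation K),
    [/\ forall x, exists n, iter (p ^ n) g x = x,
        forall x, g x = x -> exists a, x = iota a,
        forall x, x != 0 -> vgt v (v x) (g x - x),
        forall x, g x = x -> x != 0 -> exists k : int, v x = k%:~R &
        (forall a, g (iota a) = iota a) /\ forall n, (0 < n)%N -> v n%:R = (logn p n)%:R].
Proof.
move=> p_prime p_ge11 KZp.
have p_odd : odd p by apply: contraTT p_ge11 => /(prime_oddPn p_prime)->.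
have [[algK _ _] _] := KZp.
have [g [j [per fix_ gQ moves jr]]] := Zp_extension_generator p_prime p_odd KZp.
have g_per x : exists n, gpow g (p ^ n) x = x.
  by have [n h] := per x; exists n; rewrite gpowE.
have g_moves n : exists x, gpow g (p ^ n) x != x.
  by have [x h] := moves n; exists x; rewrite gpowE.
pose J (x : K) := exists2 y, algint y & x = y - g y.
have JO x : J x -> algint x.
  by move=> [y Oy ->]; apply: algintB => //; apply: algint_morph.
have J1 : ~ combo (@algint K) J (fun=> False) 1.
  move=> [s [hs e]].
  suff [t ht et] : exists2 t : seq (K * K), {in t, forall u, algint u.1 /\ algint u.2} &
      \sum_(u <- t) u.1 * (u.2 - g u.2) = \sum_(u <- s) u.1 * u.2.
    by apply: (inertia_ideal_proper p_prime p_ge11 g_per fix_ gQ jr ht); rewrite et -e.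
  elim: s hs {e} => [|u s IH] hs; first by exists [::] => //; rewrite !big_nil.
  have [t ht et] := IH (fun w ws => hs w (mem_behead (s := u :: s) ws)).
  have [Ou [//|[y Oy ey]]] := hs u (mem_head u s).
  exists ((u.1, y) :: t); last by rewrite !big_cons et ey.
  by move=> w; rewrite inE => /orP[/eqP->|/ht].
have [M [MO MB MM JM [M1 Mmax]]] := maximal_ideal (algint1 K) (@algintB K) (@algintM K) JO J1.
have Mg x : algint x -> M (x - g x) by move=> Ox; apply: JM; exists x.
exists g, (inertia_valuation p_prime algK g_per fix_ g_moves MO MB MM Mg M1 Mmax); split=> //.
- by move=> x; apply: inertia_val_wild.
- by move=> x; apply: inertia_val_fixed.
- by split=> // n; apply: inertia_val_nat.
Qed.

Section Weierstrass.
Variables (F : fieldType) (E : elliptic_curve F).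
Hypotheses (two0 : 2 != 0 :> F) (three0 : 3 != 0 :> F).
Local Notation a1 := (wa1 E).
Local Notation a2 := (wa2 E).
Local Notation a3 := (wa3 E).
Local Notation a4 := (wa4 E).
Local Notation a6 := (wa6 E).
Local Notation b2 := (a1 ^+ 2 + 4 * a2).
Local Notation b4 := (2 * a4 + a1 * a3).
Local Notation b6 := (a3 ^+ 2 + 4 * a6).

Let smooth_nat m n : (2 ^ m * 3 ^ n)%:R != 0 :> F.
Proof. by rewrite natrM !natrX mulf_neq0 ?expf_neq0. Qed.

Let nz : ((2 != 0 :> F) * (3 != 0 :> F) * (4 != 0 :> F) * (8 != 0 :> F) * (16 != 0 :> F) *
  (27 != 0 :> F) * (32 != 0 :> F) * (12 != 0 :> F) * (48 != 0 :> F))%type.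
Proof.
by do !split; [| | exact: (smooth_nat 2 0) | exact: (smooth_nat 3 0) | exact: (smooth_nat 4 0) |
  exact: (smooth_nat 0 3) | exact: (smooth_nat 5 0) | exact: (smooth_nat 2 1) | exact: (smooth_nat 4 1)].
Qed.

(** The classical [- c4 / 48] and [- c6 / 864], obtained by completing the square and then the
    cube. *)
Definition shortA := b4 / 2 - b2 ^+ 2 / 3 / 2 ^+ 4.
Definition shortB := b6 / 2 ^+ 2 - b2 * b4 / 3 / 2 ^+ 3 + b2 ^+ 3 / 3 ^+ 3 / 2 ^+ 5.

Lemma short_smooth : 2 * (4 * shortA ^+ 3 + 27 * shortB ^+ 2) != 0.
Proof.
rewrite mulf_neq0 //; have := ec_smooth E; apply: contraNneq => h.
have : - 2 ^+ 4 * (4 * shortA ^+ 3 + 27 * shortB ^+ 2) = discriminant E.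
  rewrite /shortA /shortB /discriminant; case: (ec_weierstrass E) => c1 c2 c3 c4 c6 /=.
  by field; rewrite ?nz.
by rewrite h mulr0 => <-.
Qed.

Definition short : scurve F := SCurve short_smooth.

Definition short_coords (P : option (F * F)) : option (F * F) :=
  omap (fun xy => (xy.1 + b2 / 3 / 2 ^+ 2, xy.2 + (a1 * xy.1 + a3) / 2)) P.

Lemma short_on P : on_curve E P -> son short (short_coords P).
Proof.
case: P => [[x y]|] //= /eqP e; apply/eqP.
transitivity (y ^+ 2 + a1 * x * y + a3 * y + (a1 * x + a3) ^+ 2 / 2 ^+ 2); first by field; rewrite ?nz.
by rewrite e /shortA /shortB; field; rewrite ?nz.
Qed.

Lemma short_coords_add P Q : on_curve E P -> on_curve E Q ->
  short_coords (coords_add E P Q) = sadd short (short_coords P) (short_coords Q).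
Proof.
case: P Q => [[x1 y1]|] // [[x2 y2]|] // hP hQ.
have := short_on hP; have := short_on hQ; rewrite /= => /eqP sQ /eqP sP.
rewrite (inj_eq (addIr _)).
(* The change of coordinates shears [y] by [a1 * x / 2], so it adds [a1 / 2] to every slope. *)
have chordE l L : L = l + a1 / 2 -> short_coords (Some (chord E l x1 y1 x2)) =
    Some (sline L (x1 + b2 / 3 / 2 ^+ 2) (y1 + (a1 * x1 + a3) / 2) (x2 + b2 / 3 / 2 ^+ 2)).
  by move=> ->; congr (Some (_, _)) => /=; field; rewrite ?nz.
case: eqVneq => [ex|nx] /=; last first.
  apply: chordE; field; rewrite ?nz /=.
  have : x2 - x1 != 0 by rewrite subr_eq0 eq_sym.
  move=> d; rewrite d /=.
  by rewrite (_ : _ - _ = 12 * (x2 - x1)) ?mulf_neq0 ?nz //; ring.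
have -> : (y1 + y2 + a1 * x2 + a3 == 0) =
    (y1 + (a1 * x1 + a3) / 2 + (y2 + (a1 * x2 + a3) / 2) == 0).
  by congr (_ == 0); rewrite ex; field; rewrite ?nz.
case: eqVneq => [//|ny]; apply: chordE.
have eY := s_same (E := short) sP (etrans sQ _) ny.
have {}eY : y1 + (a1 * x1 + a3) / 2 = y2 + (a1 * x2 + a3) / 2 by apply: eY; rewrite ex.
rewrite -eY in ny.
have n0 : 2 * y1 + a1 * x1 + a3 != 0.
  by apply: contraNneq ny => h; rewrite -h; apply/eqP; field; rewrite ?nz.
by rewrite /= /shortA; field; rewrite ?nz ?n0.
Qed.

Definition to_short (P : ec_point E) : spoint short := SPoint (short_on (ec_pointP P)).

Lemma to_shortD P Q : to_short (ec_add P Q) = to_short P + to_short Q.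
Proof. by apply: val_inj; apply: short_coords_add; apply: ec_pointP. Qed.

Lemma to_short_iter P n : to_short (iter n (ec_add P) (ec_zero E)) = to_short P *+ n.
Proof.
elim: n => [|n IH]; first exact: val_inj.
by rewrite iterS to_shortD IH mulrS.
Qed.

End Weierstrass.

Section BaseChange.
Variables (F K : fieldType) (iota : {rmorphism F -> K}) (E : elliptic_curve F).

Lemma ec_map_inj : injective (ec_map iota (E := E)).
Proof.
move=> P Q /(congr1 (@coords _ _)); case: P Q => [[[x y]|] hP] [[[x' y']|] hQ] //= h; apply: val_inj => //=.
by case: h => /fmorph_inj <- /fmorph_inj <-.
Qed.

Lemma ec_mapD (P Q : ec_point E) : ec_map iota (ec_add P Q) = ec_add (ec_map iota P) (ec_map iota Q).
Proof.
have chordE l x1 y1 x2 : map_coords iota (Some (chord E l x1 y1 x2)) =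
    Some (chord (base_change iota E) (iota l) (iota x1) (iota y1) (iota x2)).
  by congr (Some (_, _)); rewrite /=; ring.
apply: val_inj; case: P Q => [[[x1 y1]|] hP] [[[x2 y2]|] hQ] //=.
rewrite fmorph_eq; case: eqVneq => _ /=.
  have -> : iota y1 + iota y2 + iota (wa1 E) * iota x2 + iota (wa3 E) =
    iota (y1 + y2 + wa1 E * x2 + wa3 E) by ring.
  rewrite fmorph_eq0; case: eqVneq => // _; apply: etrans (chordE _ _ _ _) _; rewrite fmorph_div.
  by congr (Some (chord _ (_ / _) _ _ _)); ring.
apply: etrans (chordE _ _ _ _) _; rewrite fmorph_div.
by congr (Some (chord _ (_ / _) _ _ _)); ring.
Qed.

Lemma ec_map_iter (P : ec_point E) n :
  ec_map iota (iter n (ec_add P) (ec_zero E)) =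
  iter n (ec_add (ec_map iota P)) (ec_zero (base_change iota E)).
Proof.
elim: n => [|n IH]; first exact: val_inj.
by rewrite !iterS ec_mapD IH.
Qed.

Lemma ec_map_torsion (P : ec_point E) :
  torsion (base_change iota E) (ec_map iota P) <-> torsion E P.
Proof.
have e0 : ec_map iota (ec_zero E) = ec_zero (base_change iota E) by apply: val_inj.
split=> -[n n0 h]; exists n => //; last by rewrite -ec_map_iter h.
by apply: ec_map_inj; rewrite ec_map_iter h.
Qed.

End BaseChange.

Lemma val_level (K : fieldType) (v : valuation K) (E : scurve K) : exists m : rat,
  [/\ vge v (4 * m) (sA E), vge v (6 * m) (sB E) &
    (sA E != 0 /\ v (sA E) = 4 * m) \/ (sB E != 0 /\ v (sB E) = 6 * m)].
Proof.
have [A0|A0] := eqVneq (sA E) 0.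
  have B0 : sB E != 0.
    by apply: contraNneq (s_smooth E) => B0; rewrite A0 B0; apply/eqP; ring.
  exists (v (sB E) / 6); rewrite A0 vge0 mulrC divfK // vge_v; split=> //.
  by right.
have eA : 4 * (v (sA E) / 4) = v (sA E) by field.
have [B0|B0] := eqVneq (sB E) 0.
  exists (v (sA E) / 4); rewrite B0 vge0 eA vge_v; split=> //; by left.
have eB : 6 * (v (sB E) / 6) = v (sB E) by field.
have [h|h] := leP (v (sA E) / 4) (v (sB E) / 6).
  exists (v (sA E) / 4); rewrite !vgeP // eA; split=> //; last by left.
  by rewrite -eB ler_pM2l.
exists (v (sB E) / 6); rewrite !vgeP // eB; split=> //; last by right.
by rewrite -eA ler_pM2l // ltW.
Qed.

Theorem corollary7p6 (p : nat) (p_prime : prime p) (p_ge11 : (11 <= p)%N)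
    (K : fieldType) (iota : {rmorphism rat -> K})
    (KZp : is_Zp_extension p iota) (E : elliptic_curve rat) :
  torsion (base_change iota E) = ec_map (E := E) iota @` torsion E.
Proof.
have [g [v [g_per g_fix v_g v_int [gQ v_nat]]]] := Zp_extension_valuation p_prime p_ge11 KZp.
have nat0 n : (0 < n)%N -> n%:R != 0 :> K.
  by move=> n0; rewrite -(rmorph_nat iota) fmorph_eq0 pnatr_eq0 -lt0n.
have two0 := nat0 2 isT; have three0 := nat0 3 isT.
set EK := base_change iota E.
apply/seteqP; split=> [P [n n0 nP]|_ [P tP <-]]; last by apply/ec_map_torsion.
suff [Q eQ] : exists Q, ec_map iota Q = P.
  by exists Q => //; apply/(ec_map_torsion iota); rewrite eQ; exists n.
have [m [hA hB hAB]] := val_level v (short EK two0 three0).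
have p0 := nat0 p (prime_gt0 p_prime).
have vp : v p%:R = 1 by rewrite v_nat ?prime_gt0 // logn_prime // eqxx.
have v0 n' : ~~ (p %| n')%N -> n'%:R != 0 :> K /\ v n'%:R = 0.
  move=> nd; have n'0 : (0 < n')%N by case: n' nd => //; rewrite dvdn0.
  by split; [exact: nat0 | rewrite v_nat // lognE p_prime n'0 (negPf nd)].
have gE : [/\ g (wa1 EK) = wa1 EK, g (wa2 EK) = wa2 EK, g (wa3 EK) = wa3 EK,
  g (wa4 EK) = wa4 EK & g (wa6 EK) = wa6 EK] by split; apply: gQ.
have [g1 g2 g3 g4 g6] := gE.
have gA : g (shortA EK) = shortA EK.
  by rewrite /shortA !(rmorph_nat, rmorphXn, fmorphV, rmorphB, rmorphD, rmorphM) g1 g2 g3 g4.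
have gB : g (shortB EK) = shortB EK.
  by rewrite /shortB !(rmorph_nat, rmorphXn, fmorphV, rmorphB, rmorphD, rmorphM) g1 g2 g3 g4 g6.
have tor : to_short two0 three0 P *+ n = 0.
  by rewrite -to_short_iter nP; apply: val_inj.
have := torsion_fixed p_prime p_ge11 p0 vp v0 v_g v_int g_per (gA : g (sA (short EK two0 three0)) = _) gB hA hB hAB n0 tor.
move=> /(congr1 (@scoords _ _)).
case: P nP tor => [[[x y]|] hP] nP tor /= => [[hx hy]|_]; last first.
  by exists (ec_zero E); apply: val_inj.
(* The passage to the short equation has coefficients fixed by [g], so the original coordinates are
   fixed too. *)
have gx : g x = x.
  apply: (addIr ((wa1 EK ^+ 2 + 4 * wa2 EK) / 3 / 2 ^+ 2)); rewrite -[RHS]hx.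
  by rewrite !(rmorph_nat, rmorphXn, fmorphV, rmorphB, rmorphD, rmorphM) g1 g2.
have gy : g y = y.
  apply: (addIr ((wa1 EK * x + wa3 EK) / 2)); rewrite -[RHS]hy.
  by rewrite !(rmorph_nat, rmorphXn, fmorphV, rmorphB, rmorphD, rmorphM) g1 g3 gx.
have [x0 ex] := g_fix x gx; have [y0 ey] := g_fix y gy.
have hQ : on_curve E (Some (x0, y0)).
  rewrite /= -(inj_eq (fmorph_inj iota)); have := hP; rewrite /= ex ey.
  by rewrite !(rmorphD, rmorphM, rmorphXn).
by exists (Point hQ); apply: val_inj; rewrite /= ex ey.
Qed.
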